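(* Let $k=1$ (linear elements). Let $u$ be the solution of the boundary value problem $$-\varepsilon u''+a u'+c u=f \ \text{ in } (-1,1),\qquad u(-1)=u(1)=0,$$ let $u_N\in V^N$ be the solution of the streamline-diffusion method $$B_{\mathrm{SD}}(u_N,v_N)=(f,v_N)+f_{\mathrm{Stab}}(v_N)\qquad\text{for all } v_N\in V^N$$ on the piecewise equidistant mesh described in the context, and let $u_I\in V^N$ be the piecewise linear interpolant of $u$ at the mesh points. Suppose that the stabilisation parameters satisfy $$0\le\delta_i\le\min\left\{\frac{\gamma}{2\|c\|_\infty^2},\ \frac{h_i^2}{\varepsilon},\ (\mathcal K+1)N^{-1}\right\},\qquad i=-N+1,\dots,N.$$ Then there is a constant $C>0$, independent of $\varepsilon$ and $N$, such that $$\|u-u_N\|+\|u_I-u_N\|_{\mathrm{SD}}\ \le\ C\left((\mathcal K+1)N^{-1}\right)^{3/2}\ \le\ C\left(N^{-1}\ln N\right)^{3/2}.$$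
   Context: **Problem and standing assumptions.** $\varepsilon\in(0,1]$ is a (small) perturbation parameter. The data $a,c,f$ are sufficiently smooth and satisfy on $[-1,1]$: $a(x)=-x\,b(x)$ with $b(x)>0$, $c(x)\ge 0$, $c(0)>0$. Moreover $\left(c-\tfrac12 a'\right)(x)\ge\gamma>0$ for all $x\in[-1,1]$, with a constant $\gamma$. **The exponent $\lambda$.** Put $\bar\lambda:=c(0)/|a'(0)|$. The parameter $\lambda$ satisfies $0<\lambda<\bar\lambda$ (or $\lambda=\bar\lambda$ if $\bar\lambda$ is not an integer); for such $\lambda$ the a priori bounds $|u^{(i)}(x)|\le C\left(1+(\varepsilon^{1/2}+|x|)^{\lambda-i}\right)$, $x\in[-1,1]$, are known to hold with $C$ independent of $\varepsilon$ for all derivative orders $i$ needed ($0\le i\le 2$). It is assumed throughout that $\lambda\in(0,2)$ (that is, $\lambda\in(0,k+1)$ with $k=1$). **Mesh** (with $k=1$). Let $N$ be a positive integer, sufficiently large, and set $$\sigma=\max\left\{\varepsilon^{(1-\lambda/2)/2},\,N^{-3}\right\},\qquad \mathcal K=\left\lfloor 1-\frac{\ln\sigma}{\ln 10}\right\rfloor .$$ It is assumed that $N/(\mathcal K+1)$ is a (positive) integer. The interval $(0,1]$ is partitioned into the $\mathcal K+1$ subintervals $(0,10^{-\mathcal K}],(10^{-\mathcal K},10^{-\mathcal K+1}],\dots,(10^{-1},1]$, and each of these is divided uniformly into $N/(\mathcal K+1)$ parts. This gives mesh points $0=x_0<x_1<\dots<x_N=1$; the mesh is extended to $[-1,0]$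 by symmetry, $x_{-i}=-x_i$. Put $I_i=(x_{i-1},x_i)$ and $h_i=x_i-x_{i-1}$ for $i=-N+1,\dots,N$. **Finite element space.** $V^N$ is the space of all $v\in C([-1,1])$ with $v(-1)=v(1)=0$ whose restriction to each $I_i$ is a polynomial of degree at most $1$. **Norms and forms.** $(\cdot,\cdot)$ and $\|\cdot\|$ are the inner product and norm of $L^2((-1,1))$, $\|\cdot\|_{I_i}$ is the norm of $L^2(I_i)$, $\|\cdot\|_\infty$ is the supremum norm on $(-1,1)$, $|v|_1:=\|v'\|$. Define $$B_\varepsilon(v,w):=(\varepsilon v',w')+(av',w)+(cv,w),\qquad B_{\mathrm{SD}}(v,w):=B_\varepsilon(v,w)+B_{\mathrm{Stab}}(v,w),$$ $$B_{\mathrm{Stab}}(v,w):=\sum_{i=-N+1}^N\delta_i\int_{x_{i-1}}^{x_i}\left(-\varepsilon v''+av'+cv\right)\,a w'\,dx,\qquad f_{\mathrm{Stab}}(w):=\sum_{i=-N+1}^N\delta_i\int_{x_{i-1}}^{x_i}f\,a w'\,dx,$$ $$\|v\|_{\mathrm{SD}}:=\left(\varepsilon|v|_1^2+\|v\|^2+\sum_{i=-N+1}^N\|\sqrt{\delta_i}\,a v'\|_{I_i}^2\right)^{1/2}.$$ **Constants.** $C$ denotes a generic positive constant (possibly different at each occurrence) independent of $\varepsilon$ and $N$; it may depend on $a,c,f,\gamma,\lambda$. *)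

(* Defs.v *)
(* Stdlib reals with Coquelicot.  Functions on [-1,1] are represented by total
   functions R -> R whose values outside [-1,1] are irrelevant. *)
From Stdlib Require Import Reals ZArith.
From Coquelicot Require Import Coquelicot.
Open Scope R_scope.

Definition cI (x : R) : Prop := -1 <= x <= 1.

(* Differentiability relative to [-1,1], i.e. one-sided at the end points. *)
Definition derivative_on (g dg : R -> R) : Prop :=
  forall x, cI x ->
    filterdiff g (within cI (locally x)) (fun y => scal y (dg x)).

Fixpoint class_C (m : nat) (g : R -> R) : Prop :=
  match m with
  | O => continuous_on cI g
  | S m' => exists dg, derivative_on g dg /\ class_C m' dg
  end.

(* [da] is a'.  Continuity of b is what makes b(0) = -a'(0), so a'(0) < 0. *)
Definition admissible_data (m : nat) (a da c f : R -> R) (gamma : R) : Prop :=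
  class_C m a /\ class_C m c /\ class_C m f /\ derivative_on a da /\
  (exists b, continuous_on cI b /\
     forall x, cI x -> 0 < b x /\ a x = - x * b x) /\
  (forall x, cI x -> 0 <= c x) /\ 0 < c 0 /\
  0 < gamma /\ (forall x, cI x -> gamma <= c x - / 2 * da x).

Definition admissible_lambda (da c : R -> R) (lambda : R) : Prop :=
  let lambda_bar := c 0 / Rabs (da 0) in
  0 < lambda < 2 /\
  (lambda < lambda_bar \/
   (lambda = lambda_bar /\ forall z : Z, lambda_bar <> IZR z)).

Definition bvp_solution (eps : R) (a c f u : R -> R) : Prop :=
  continuous_on cI u /\ u (-1) = 0 /\ u 1 = 0 /\
  forall x, -1 < x < 1 ->
    ex_derive u x /\ ex_derive (Derive u) x /\
    - eps * Derive_n u 2 x + a x * Derive u x + c x * u x = f x.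

Definition sigma (eps lambda : R) (N : nat) : R :=
  Rmax (Rpower eps ((1 - lambda / 2) / 2)) (/ INR N ^ 3).

(* The argument of the floor is >= 1 when eps <= 1 and lambda < 2. *)
Definition calK (eps lambda : R) (N : nat) : nat :=
  Z.to_nat (Int_part (1 - ln (sigma eps lambda N) / ln 10)).

(* 0, 10^-K, 10^-(K-1), ..., 10^-1, 1 for j = 0, ..., K+1. *)
Definition breakpoint (K j : nat) : R :=
  match j with
  | O => 0
  | S j' => / 10 ^ (K - j')
  end.

(* x_i for 0 <= i <= N, with n = N/(K+1) cells in each subinterval. *)
Definition half_mesh (K N i : nat) : R :=
  let n := (N / (K + 1))%nat in
  let j := (i / n)%nat in
  breakpoint K j
    + INR (i mod n) * ((breakpoint K (S j) - breakpoint K j) / INR n).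

Definition mesh (eps lambda : R) (N : nat) (i : Z) : R :=
  let K := calK eps lambda N in
  if Z.leb 0 i then half_mesh K N (Z.to_nat i)
  else - half_mesh K N (Z.to_nat (- i)).

(* Sum over i = -N+1, ..., N. *)
Definition sum_cells (N : nat) (g : Z -> R) : R :=
  sum_n_m (fun j : nat => g (Z.of_nat j - Z.of_nat N)%Z) 1 (2 * N).

Definition is_cell (N : nat) (i : Z) : Prop :=
  (- Z.of_nat N + 1 <= i <= Z.of_nat N)%Z.

Definition in_VN (N : nat) (x : Z -> R) (v : R -> R) : Prop :=
  continuous_on cI v /\ v (-1) = 0 /\ v 1 = 0 /\
  forall i, is_cell N i ->
    exists p q, forall y, x (i - 1)%Z < y < x i -> v y = p + q * y.

Definition is_interpolant (N : nat) (x : Z -> R) (u uI : R -> R) : Prop :=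
  in_VN N x uI /\
  forall i, (- Z.of_nat N <= i <= Z.of_nat N)%Z -> uI (x i) = u (x i).

(* The functions integrated below are piecewise continuous, so that the Riemann
   and Lebesgue integrals agree and the values of Derive and Derive_n at the
   mesh points do not matter. *)
Definition inner (v w : R -> R) : R := RInt (fun y => v y * w y) (-1) 1.

Definition norm_on (l r : R) (v : R -> R) : R :=
  sqrt (RInt (fun y => v y ^ 2) l r).

Definition norm_L2 (v : R -> R) : R := norm_on (-1) 1 v.

Definition norm_sup (v : R -> R) : R :=
  real (Lub_Rbar (fun r => exists y, -1 < y < 1 /\ r = Rabs (v y))).

Definition B_eps (eps : R) (a c v w : R -> R) : R :=
  inner (fun y => eps * Derive v y) (Derive w)
    + inner (fun y => a y * Derive v y) w
    + inner (fun y => c y * v y) w.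

Definition B_Stab (eps : R) (a c : R -> R) (N : nat) (x delta : Z -> R)
    (v w : R -> R) : R :=
  sum_cells N (fun i => delta i *
    RInt (fun y => (- eps * Derive_n v 2 y + a y * Derive v y + c y * v y)
                   * (a y * Derive w y)) (x (i - 1)%Z) (x i)).

Definition f_Stab (a f : R -> R) (N : nat) (x delta : Z -> R)
    (w : R -> R) : R :=
  sum_cells N (fun i => delta i *
    RInt (fun y => f y * (a y * Derive w y)) (x (i - 1)%Z) (x i)).

Definition B_SD (eps : R) (a c : R -> R) (N : nat) (x delta : Z -> R)
    (v w : R -> R) : R :=
  B_eps eps a c v w + B_Stab eps a c N x delta v w.

Definition norm_SD (eps : R) (a : R -> R) (N : nat) (x delta : Z -> R)
    (v : R -> R) : R :=
  sqrt (eps * norm_L2 (Derive v) ^ 2 + norm_L2 v ^ 2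
        + sum_cells N (fun i =>
            norm_on (x (i - 1)%Z) (x i)
              (fun y => sqrt (delta i) * a y * Derive v y) ^ 2)).

Definition sd_solution (eps : R) (a c f : R -> R) (N : nat)
    (x delta : Z -> R) (uN : R -> R) : Prop :=
  in_VN N x uN /\
  forall v, in_VN N x v ->
    B_SD eps a c N x delta uN v = inner f v + f_Stab a f N x delta v.

Definition admissible_delta (eps gamma : R) (c : R -> R) (K N : nat)
    (x delta : Z -> R) : Prop :=
  forall i, is_cell N i ->
    0 <= delta i <=
      Rmin (gamma / (2 * norm_sup c ^ 2))
        (Rmin ((x i - x (i - 1)%Z) ^ 2 / eps) (INR (K + 1) / INR N)).

(* Main.v *)
Require Import Defs.
From Stdlib Require Import Reals ZArith Lra Lia Psatz.
From Coquelicot Require Import Coquelicot.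
Open Scope R_scope.

(* A priori bounds.  Near the turning point one subtracts a polynomial q of degree
   k - 1, where k - 1 < lambda < k, so that the right-hand side of the equation for
   v = u - q is O(|x|^k).  With p = kappa eps + x^2 the function p^(lambda/2) - A p^(k/2)
   is then a barrier, which gives |v| <= C r^lambda for r = sqrt eps + |x|; the correction
   term is what allows lambda = c(0)/|a'(0)|.  (For lambda = 1 one may increase lambda.)
   Each derivative w of v solves a first-order equation eps w' = a w + G, which is stable
   when integrated away from the turning point; so the bounds |v^(i)| <= C r^(lambda - i)
   follow one after the other, first for |x| of order sqrt eps and then on all of [-1,1]
   by comparison with multiples of r^(lambda - i).

   Energy argument.  Let chi = u_I - u_N, eta = u_I - u, H = (K+1)/N.  For linear elements
   (eps eta', chi') = 0, and on a cell of width h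
     int a eta' chi = - h^2/12 [a u'' chi] + O(H^2 h^(1/2) ||chi||)
   by the corrected trapezoidal rule.  The boundary terms telescope within each uniform
   block of the mesh and leave one term of size H^(3/2) |x|^(1/2) ||chi|| at every
   breakpoint x; this sum is geometric, and it is responsible for the order 3/2.  In the
   innermost interval (-S, S), S = 10^-K, either S^2 <= eps^(1 - lambda/2), and
   the sharp bounds on u'' and u''' suffice, or S <= N^-3, and the crude bounds do. *)

(** The obstacle is the pairing of a (u_I - u)' with chi. The derivative of the interpolation error
    is only O(H) in the relevant weights, and chi' is controlled neither by eps nor by delta, which
    may vanish. The missing half order has to come from cancellation, and the cancellation uses
    u''', so bounds for three derivatives are derived from the data. Squares are compared
    throughout: a cell may spend C H^3 times its length, which sums to O(H^3). The entry N^-3 of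
    sigma is tuned to this budget: if 10^-K <= N^-3 <= H^3, the innermost interval may even spend C
    times its length. The other entry gives 10^-2K <= eps^(1 - lambda/2), the reciprocal size of
    u'', so that h^2 u'' = O(H^2) there. The restrictions on delta fit the same budget. delta <=
    h^2/eps pays for eps u'' in the stabilisation residual, delta <= H for the rest of that
    residual, which is only O(H), and the bound by c for coercivity. Data and solution are replaced
    by functions that are differentiable on all of R, so that one-sided derivatives disappear and
    integrands are continuous; a finite element function enters a cell only through its two affine
    coefficients. *)

Ltac spec H :=
  lazymatch type of H with ?A -> _ =>
    let G := fresh in assert (G : A); [|specialize (H G); clear G] end.

(** * Derivatives, continuity and mean values of real functions *)

Lemma is_derive_val (f : R -> R) (x l l' : R) : is_derive f x l -> l = l' -> is_derive f x l'.
Proof. now intros H <-. Qed.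

Lemma deriv_plus (f g : R -> R) (x a b : R) :
  is_derive f x a -> is_derive g x b -> is_derive (fun y => f y + g y) x (a + b).
Proof. intros; now apply @is_derive_plus. Qed.

Lemma deriv_minus (f g : R -> R) (x a b : R) :
  is_derive f x a -> is_derive g x b -> is_derive (fun y => f y - g y) x (a - b).
Proof. intros; now apply @is_derive_minus. Qed.

Lemma deriv_opp (f : R -> R) (x a : R) : is_derive f x a -> is_derive (fun y => - f y) x (- a).
Proof. intros; now apply @is_derive_opp. Qed.

Lemma deriv_mult (f g : R -> R) (x a b : R) :
  is_derive f x a -> is_derive g x b -> is_derive (fun y => f y * g y) x (a * g x + f x * b).
Proof. intros; apply @is_derive_mult; auto; intros; apply Rmult_comm. Qed.

Lemma deriv_div (f : R -> R) (x a k : R) :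
  is_derive f x a -> is_derive (fun y => f y / k) x (a / k).
Proof.
  intros H. unfold Rdiv. eapply is_derive_val.
  apply (deriv_mult f (fun _ => / k) x a 0 H). apply @is_derive_const. ring.
Qed.

Lemma deriv_const (k x : R) : is_derive (fun _ => k) x 0.
Proof. apply @is_derive_const. Qed.

Lemma deriv_id (x : R) : is_derive (fun y => y) x 1.
Proof. apply @is_derive_id. Qed.

Lemma deriv_comp (f g : R -> R) (x df dg : R) :
  is_derive f (g x) df -> is_derive g x dg -> is_derive (fun y => f (g y)) x (dg * df).
Proof. intros; now apply @is_derive_comp. Qed.

Lemma deriv_exp (g : R -> R) (x dg : R) :
  is_derive g x dg -> is_derive (fun y => exp (g y)) x (dg * exp (g x)).
Proof. intros; apply (deriv_comp exp g); auto. apply is_derive_exp. Qed.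

Lemma is_derive_continuous (f : R -> R) (x l : R) : is_derive f x l -> continuous f x.
Proof. intros H. apply (ex_derive_continuous f). now exists l. Qed.

Lemma continuous_pt (f : R -> R) (x : R) : continuous f x <-> continuity_pt f x.
Proof. symmetry; apply continuity_pt_filterlim. Qed.

(** Syntax-directed differentiation. The cases with a partially applied operation catch functions
    such as [fun y => k + y] in eta-reduced form; the constant rule comes after the search through
    the hypotheses. *)
Ltac deriv :=
  lazymatch goal with
  | |- is_derive (fun y => _ + _) _ _ => apply deriv_plus; deriv
  | |- is_derive (fun y => _ - _) _ _ => apply deriv_minus; deriv
  | |- is_derive (fun y => - _) _ _ => apply deriv_opp; deriv
  | |- is_derive (fun y => _ * _) _ _ => apply deriv_mult; deriv
  | |- is_derive (fun y => _ / ?k) _ _ => apply deriv_div; deriv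
  | |- is_derive (fun y => exp _) _ _ => apply deriv_exp; deriv
  | |- is_derive (fun y => y) _ _ => apply deriv_id
  | |- is_derive Ropp _ _ => apply (deriv_opp (fun y => y)), deriv_id
  | |- is_derive (Rplus ?k) _ _ => apply (deriv_plus (fun _ => k) (fun y => y)); [apply deriv_const | apply deriv_id]
  | |- is_derive (Rminus ?k) _ _ => apply (deriv_minus (fun _ => k) (fun y => y)); [apply deriv_const | apply deriv_id]
  | |- is_derive (Rmult ?k) _ _ => apply (deriv_mult (fun _ => k) (fun y => y)); [apply deriv_const | apply deriv_id]
  | H : forall x, is_derive ?f x _ |- is_derive ?f _ _ => apply H
  | H : forall x, _ -> is_derive ?f x _ |- is_derive ?f _ _ => apply H
  | H : is_derive ?f ?x _ |- is_derive ?f ?x _ => apply H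
  | |- is_derive (fun _ => ?k) _ _ => apply deriv_const
  | |- _ => idtac
  end.

Lemma cont_plus (f g : R -> R) x : continuous f x -> continuous g x -> continuous (fun y => f y + g y) x.
Proof. intros; now apply @continuous_plus. Qed.
Lemma cont_minus (f g : R -> R) x : continuous f x -> continuous g x -> continuous (fun y => f y - g y) x.
Proof. intros; now apply @continuous_minus. Qed.
Lemma cont_opp (f : R -> R) x : continuous f x -> continuous (fun y => - f y) x.
Proof. intros; now apply @continuous_opp. Qed.
Lemma cont_mult (f g : R -> R) x : continuous f x -> continuous g x -> continuous (fun y => f y * g y) x.
Proof. intros; now apply @continuous_mult. Qed.
Lemma cont_const (k x : R) : continuous (fun _ : R => k) x.
Proof. apply continuous_const. Qed.
Lemma cont_id (x : R) : continuous (fun y : R => y) x.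
Proof. apply continuous_id. Qed.
Lemma cont_div (f : R -> R) (k x : R) : continuous f x -> continuous (fun y => f y / k) x.
Proof. intros; unfold Rdiv; apply cont_mult; auto; apply cont_const. Qed.
Lemma cont_pow (f : R -> R) n x : continuous f x -> continuous (fun y => f y ^ n) x.
Proof. intros H; induction n; simpl. apply cont_const. now apply cont_mult. Qed.
Lemma cont_exp (f : R -> R) x : continuous f x -> continuous (fun y => exp (f y)) x.
Proof.
  intros H. apply (continuous_comp f exp); auto.
  eapply is_derive_continuous, is_derive_exp.
Qed.
Lemma cont_abs (f : R -> R) x : continuous f x -> continuous (fun y => Rabs (f y)) x.
Proof. intros H. apply (continuous_comp f Rabs); auto. apply continuous_Rabs. Qed.

Ltac cont :=
  lazymatch goal with
  | |- continuous (fun y => _ + _) _ => apply cont_plus; cont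
  | |- continuous (fun y => _ - _) _ => apply cont_minus; cont
  | |- continuous (fun y => - _) _ => apply cont_opp; cont
  | |- continuous (fun y => _ * _) _ => apply cont_mult; cont
  | |- continuous (fun y => _ / ?k) _ => apply cont_div; cont
  | |- continuous (fun y => _ ^ _) _ => apply cont_pow; cont
  | |- continuous (fun y => exp _) _ => apply cont_exp; cont
  | |- continuous (fun y => Rabs _) _ => apply cont_abs; cont
  | |- continuous (fun y => y) _ => apply cont_id
  | |- continuous Ropp _ => apply (cont_opp (fun y => y)), cont_id
  | |- continuous (Rplus ?k) _ => apply (cont_plus (fun _ => k) (fun y => y)); [apply cont_const | apply cont_id]
  | |- continuous (Rminus ?k) _ => apply (cont_minus (fun _ => k) (fun y => y)); [apply cont_const | apply cont_id]
  | |- continuous (Rmult ?k) _ => apply (cont_mult (fun _ => k) (fun y => y)); [apply cont_const | apply cont_id]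
  | H : forall x, continuous ?f x |- continuous ?f _ => apply H
  | H : continuous ?f ?x |- continuous ?f ?x => apply H
  | H : forall x, is_derive ?f x _ |- continuous ?f _ => eapply is_derive_continuous, H
  | |- continuous (fun _ => ?k) _ => apply cont_const
  | |- _ => idtac
  end.

Lemma MVT_closed (f df : R -> R) (x y : R) :
  x <= y -> (forall z, x <= z <= y -> is_derive f z (df z)) ->
  exists z, x <= z <= y /\ f y - f x = df z * (y - x).
Proof.
  intros Hxy Hd.
  destruct (MVT_gen f x y df) as [z [Hz E]].
  - intros z Hz. rewrite Rmin_left, Rmax_right in Hz by lra. apply Hd; lra.
  - intros z Hz. rewrite Rmin_left, Rmax_right in Hz by lra.
    apply continuous_pt. eapply is_derive_continuous, Hd; lra.
  - rewrite Rmin_left, Rmax_right in Hz by lra. now exists z.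
Qed.

Lemma derive_zero_eq (f : R -> R) (l r x y : R) :
  (forall z, l < z < r -> is_derive f z 0) -> l < x < r -> l < y < r -> f x = f y.
Proof.
  intros Hd Hx Hy.
  assert (G : forall s t, l < s < r -> l < t < r -> s <= t -> f s = f t).
  { intros s t Hs Ht Hst.
    destruct (MVT_closed f (fun _ => 0) s t Hst) as [z [_ E]].
    intros z Hz; apply Hd; lra. lra. }
  destruct (Rle_dec x y). now apply G. symmetry; apply G; lra.
Qed.

Lemma continuous_bounded (f : R -> R) (l r : R) :
  l <= r -> (forall x, l <= x <= r -> continuous f x) ->
  exists M, 0 < M /\ forall x, l <= x <= r -> Rabs (f x) <= M.
Proof.
  intros Hlr Hc.
  destruct (continuity_ab_maj (fun x => Rabs (f x)) l r Hlr) as [m [Hm _]].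
  { intros x Hx. apply continuous_pt. apply cont_abs; auto. }
  exists (Rabs (f m) + 1). split. pose proof (Rabs_pos (f m)); lra.
  intros x Hx. specialize (Hm x Hx); simpl in Hm; lra.
Qed.

(** A strict violation at [x] would persist in a ball that meets the open interval. This carries
    facts known only inside an interval to its end points. *)
Lemma closed_le_on (l r : R) (f g : R -> R) : l < r ->
  (forall x, continuous f x) -> (forall x, continuous g x) ->
  (forall x, l < x < r -> f x <= g x) -> forall x, l <= x <= r -> f x <= g x.
Proof.
  intros Hlr Hf Hg H x [H1 H2].
  destruct (Rle_dec (f x) (g x)) as [|Hn]; auto. exfalso.
  assert (Hp : 0 < f x - g x) by lra.
  assert (Hc : continuous (fun y => f y - g y) x) by cont.
  destruct (proj1 (filterlim_locally _ _) Hc (mkposreal _ Hp)) as [d Hd].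
  assert (Hd0 := cond_pos d).
  assert (exists y, Rabs (y - x) < d /\ l < y < r) as [y [Hy1 Hy2]].
  { pose (e := Rmin (d / 2) ((r - l) / 3)).
    assert (He : 0 < e /\ e <= d / 2 /\ e <= (r - l) / 3).
    { split; [apply Rmin_pos; lra|split; [apply Rmin_l|apply Rmin_r]]. }
    destruct (Rle_dec x ((l + r) / 2)).
    - exists (x + e). split; [apply Rabs_def1|]; lra.
    - exists (x - e). split; [apply Rabs_def1|]; lra. }
  specialize (Hd y Hy1). specialize (H y Hy2).
  unfold ball in Hd; simpl in Hd; unfold AbsRing_ball, abs, minus, plus, opp in Hd; simpl in Hd.
  apply Rabs_def2 in Hd. lra.
Qed.

Lemma closed_eq_on (l r : R) (f g : R -> R) : l < r ->
  (forall x, continuous f x) -> (forall x, continuous g x) ->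
  (forall x, l < x < r -> f x = g x) -> forall x, l <= x <= r -> f x = g x.
Proof.
  intros Hlr Hf Hg H x Hx. apply Rle_antisym; apply (closed_le_on l r); auto;
    intros; right; [|symmetry]; auto.
Qed.

Lemma closed_le (f g : R -> R) :
  (forall x, continuous f x) -> (forall x, continuous g x) ->
  (forall x, -1 < x < 1 -> f x <= g x) -> forall x, cI x -> f x <= g x.
Proof. intros Hf Hg H x Hx. apply (closed_le_on (-1) 1); auto; lra. Qed.

Lemma closed_eq (f g : R -> R) :
  (forall x, continuous f x) -> (forall x, continuous g x) ->
  (forall x, -1 < x < 1 -> f x = g x) -> forall x, cI x -> f x = g x.
Proof. intros Hf Hg H x Hx. apply (closed_eq_on (-1) 1); auto; lra. Qed.

(** * Extension of the data and of the solution to the whole line *)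

Definition clamp (x : R) : R := Rmax (-1) (Rmin 1 x).

Lemma clamp_cI x : cI (clamp x).
Proof.
  unfold clamp, cI, Rmax, Rmin. repeat destruct Rle_dec; lra.
Qed.

Lemma clamp_id x : cI x -> clamp x = x.
Proof.
  unfold clamp, cI, Rmax, Rmin. repeat destruct Rle_dec; lra.
Qed.

Lemma clamp_lipschitz x y : Rabs (clamp x - clamp y) <= Rabs (x - y).
Proof.
  unfold clamp, Rmax, Rmin.
  repeat destruct Rle_dec; unfold Rabs; repeat destruct Rcase_abs; lra.
Qed.

(** [clamp] is the nearest-point retraction onto [-1,1]. Being 1-Lipschitz with values in the
    interval, it turns continuity within the interval into continuity on R. *)
Lemma continuous_clamp (g : R -> R) :
  continuous_on cI g -> forall x, continuous (fun y => g (clamp y)) x.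
Proof.
  intros Hg x P HP.
  specialize (Hg (clamp x) (clamp_cI x) P HP).
  destruct Hg as [d Hd]. exists d. intros y Hy. apply Hd; [|apply clamp_cI].
  unfold ball in *; simpl in *; unfold AbsRing_ball, abs, minus, plus, opp in *; simpl in *.
  eapply Rle_lt_trans; [|exact Hy]. apply clamp_lipschitz.
Qed.

Lemma locally_interval l r y : l < y < r -> locally y (fun t : R => l < t < r).
Proof.
  intros H. apply (open_and (fun t => l < t) (fun t => t < r)); auto.
  apply open_gt. apply open_lt.
Qed.

Lemma derivative_on_is_derive (g dg : R -> R) x :
  derivative_on g dg -> -1 < x < 1 -> is_derive g x (dg x).
Proof.
  intros H Hx. assert (Hc : cI x) by (unfold cI; lra). specialize (H x Hc).
  destruct H as [Hl Hd]. split; auto.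
  intros y Hy. intros e.
  assert (Hw : is_filter_lim (within cI (locally x)) y).
  { intros P HP. specialize (Hy P HP). unfold within. revert Hy. apply filter_imp. auto. }
  specialize (Hd y Hw e). unfold within in Hd.
  pose proof (locally_interval (-1) 1 x Hx) as Ho.
  generalize (filter_and _ _ Hd Ho). apply filter_imp.
  intros z [Hz1 Hz2]. apply Hz1. unfold cI; lra.
Qed.

Lemma RInt_self (g : R -> R) (l : R) : RInt g l l = 0.
Proof. apply (RInt_point (V := R_CompleteNormedModule)). Qed.

Lemma RInt_cont_correct (g : R -> R) (l r : R) :
  (forall x, continuous g x) -> is_RInt g l r (RInt g l r).
Proof.
  intros Hg. apply (@RInt_correct R_CompleteNormedModule).
  apply (@ex_RInt_continuous R_CompleteNormedModule); auto.
Qed.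

Lemma is_derive_RInt_cont (g : R -> R) (k : R) :
  (forall x, continuous g x) -> forall x, is_derive (fun y => k + RInt g 0 y) x (g x).
Proof.
  intros Hg x. eapply is_derive_val.
  apply (deriv_plus (fun _ => k) (fun y => RInt g 0 y)). apply deriv_const.
  apply (is_derive_RInt g (fun y => RInt g 0 y) 0 x); auto.
  apply filter_forall. intros y. now apply RInt_cont_correct. ring.
Qed.

Lemma is_derive_unique_on (f g df dg : R -> R) :
  (forall x, -1 < x < 1 -> f x = g x) ->
  (forall x, -1 < x < 1 -> is_derive f x (df x)) ->
  (forall x, -1 < x < 1 -> is_derive g x (dg x)) ->
  forall x, -1 < x < 1 -> df x = dg x.
Proof.
  intros E Hf Hg x Hx.
  rewrite <- (is_derive_unique _ _ _ (Hf x Hx)), <- (is_derive_unique _ _ _ (Hg x Hx)).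
  apply Derive_ext_loc. generalize (locally_interval (-1) 1 x Hx). apply filter_imp. auto.
Qed.

(** The extension is built from the top derivative downwards: the highest derivative is continued by
    its boundary values, and each lower one is the antiderivative with the right value at 0.
    Agreement in the open interval suffices, since continuity recovers the end points. *)
Lemma class_C_extension (m : nat) (g : R -> R) :
  class_C m g ->
  exists G : nat -> R -> R,
    (forall k x, (k < m)%nat -> is_derive (G k) x (G (S k) x)) /\
    (forall x, continuous (G m) x) /\
    (forall x, -1 < x < 1 -> G 0%nat x = g x).
Proof.
  revert g; induction m as [|m IH]; intros g Hg; simpl in Hg.
  - exists (fun _ x => g (clamp x)). split; [|split].
    + intros; lia.
    + intros x. now apply (continuous_clamp g Hg x).
    + intros x Hx. rewrite clamp_id; auto. unfold cI; lra.
  - destruct Hg as [dg [Hd Hc]]. destruct (IH dg Hc) as [G [G1 [G2 G3]]].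
    assert (Gc : forall x, continuous (G 0%nat) x).
    { intros x. destruct m; auto. eapply is_derive_continuous, G1; lia. }
    exists (fun k => match k with O => fun x => g 0 + RInt (G 0%nat) 0 x | S k' => G k' end).
    split; [|split].
    + intros [|k] x Hk. now apply is_derive_RInt_cont. apply G1; lia.
    + auto.
    + intros x Hx.
      assert (E := derive_zero_eq (fun y => g 0 + RInt (G 0%nat) 0 y - g y) (-1) 1 x 0).
      spec E. { intros z Hz.
        eapply is_derive_val. apply deriv_minus. now apply is_derive_RInt_cont.
        now apply derivative_on_is_derive with (dg := dg). rewrite G3; lra. }
      specialize (E Hx ltac:(lra)). cbv beta in E. rewrite RInt_self in E. lra.
Qed.

(** The smoothness conditions hold on all of R with named derivatives, whereas sign and structure
    conditions are kept on [-1,1], where alone they survive the extension. *)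
Record regular_data (a a1 a2 c c1 c2 f f1 f2 b : R -> R) (gamma : R) : Prop := {
  rd_a : forall x, is_derive a x (a1 x);
  rd_a1 : forall x, is_derive a1 x (a2 x);
  rd_a2 : forall x, continuous a2 x;
  rd_c : forall x, is_derive c x (c1 x);
  rd_c1 : forall x, is_derive c1 x (c2 x);
  rd_c2 : forall x, continuous c2 x;
  rd_f : forall x, is_derive f x (f1 x);
  rd_f1 : forall x, is_derive f1 x (f2 x);
  rd_f2 : forall x, continuous f2 x;
  rd_b : forall x, continuous b x;
  rd_ab : forall x, cI x -> a x = - x * b x;
  rd_b_pos : forall x, cI x -> 0 < b x;
  rd_c_nonneg : forall x, cI x -> 0 <= c x;
  rd_c0 : 0 < c 0;
  rd_gamma : 0 < gamma;
  rd_coercive : forall x, cI x -> gamma <= c x - / 2 * a1 x }.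

Arguments rd_a {a a1 a2 c c1 c2 f f1 f2 b gamma} _ _.
Arguments rd_a1 {a a1 a2 c c1 c2 f f1 f2 b gamma} _ _.
Arguments rd_c {a a1 a2 c c1 c2 f f1 f2 b gamma} _ _.
Arguments rd_f {a a1 a2 c c1 c2 f f1 f2 b gamma} _ _.
Arguments rd_b {a a1 a2 c c1 c2 f f1 f2 b gamma} _ _.
Arguments rd_ab {a a1 a2 c c1 c2 f f1 f2 b gamma} _ _ _.
Arguments rd_b_pos {a a1 a2 c c1 c2 f f1 f2 b gamma} _ _ _.
Arguments rd_c_nonneg {a a1 a2 c c1 c2 f f1 f2 b gamma} _ _ _.
Arguments rd_c0 {a a1 a2 c c1 c2 f f1 f2 b gamma} _.
Arguments rd_gamma {a a1 a2 c c1 c2 f f1 f2 b gamma} _.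
Arguments rd_coercive {a a1 a2 c c1 c2 f f1 f2 b gamma} _ _ _.

(** The difference quotient of -x b(x) at 0 is -b(h), so continuity of b is enough. *)
Lemma rd_a1_0 {a a1 a2 c c1 c2 f f1 f2 b gamma} :
  regular_data a a1 a2 c c1 c2 f f1 f2 b gamma -> a1 0 = - b 0.
Proof.
  intros D.
  assert (H : is_derive a 0 (- b 0)).
  { apply (is_derive_ext_loc (fun x => - x * b x)).
    - generalize (locally_interval (-1) 1 0 ltac:(lra)). apply filter_imp. intros x Hx.
      symmetry; apply (rd_ab D); unfold cI; lra.
    - assert (Hb := rd_b D 0).
      apply is_derive_Reals. intros e He.
      destruct (proj1 (filterlim_locally _ _) Hb (mkposreal _ He)) as [d Hd].
      exists d. intros h Hh Hhd.
      replace ((- (0 + h) * b (0 + h) - - 0 * b 0) / h - - b 0) with (- (b (0 + h) - b 0))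
        by (field; auto).
      rewrite Rabs_Ropp. apply Hd.
      unfold ball; simpl; unfold AbsRing_ball, abs, minus, plus, opp; simpl.
      now replace (0 + h + - 0) with h by ring. }
  rewrite <- (is_derive_unique _ _ _ H).
  symmetry; apply is_derive_unique, (rd_a D).
Qed.

Lemma admissible_data_regular a da c f gamma :
  admissible_data 2 a da c f gamma ->
  exists a' a1 a2 c' c1 c2 f' f1 f2 b,
    regular_data a' a1 a2 c' c1 c2 f' f1 f2 b gamma /\ da 0 = a1 0 /\
    forall x, -1 < x < 1 -> a x = a' x /\ c x = c' x /\ f x = f' x.
Proof.
  intros [Ha [Hc [Hf [Hda [[b [Hb Hab]] [Hc0 [Hc00 [Hg Hco]]]]]]]].
  destruct (class_C_extension 2 a Ha) as [A [A1 [A2 A3]]].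
  destruct (class_C_extension 2 c Hc) as [C [C1 [C2 C3]]].
  destruct (class_C_extension 2 f Hf) as [F [F1 [F2 F3]]].
  assert (Ea : forall x, -1 < x < 1 -> da x = A 1%nat x).
  { apply (is_derive_unique_on a (A 0%nat)).
    - intros; symmetry; auto.
    - intros; now apply derivative_on_is_derive.
    - intros; apply A1; lia. }
  exists (A 0%nat), (A 1%nat), (A 2%nat), (C 0%nat), (C 1%nat), (C 2%nat),
    (F 0%nat), (F 1%nat), (F 2%nat), (fun x => b (clamp x)).
  assert (CA0 : forall x, continuous (A 0%nat) x) by (intros; eapply is_derive_continuous, A1; lia).
  assert (CA1 : forall x, continuous (A 1%nat) x) by (intros; eapply is_derive_continuous, A1; lia).
  assert (CC0 : forall x, continuous (C 0%nat) x) by (intros; eapply is_derive_continuous, C1; lia).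
  assert (Cb := continuous_clamp b Hb).
  split; [|split].
  - constructor; auto; try (intros; first [apply A1 | apply C1 | apply F1]; lia).
    + apply closed_eq; auto. intros; cont.
      intros x Hx. rewrite A3 by auto. rewrite clamp_id by (unfold cI; lra).
      apply Hab; unfold cI; lra.
    + intros x Hx. apply Hab, clamp_cI.
    + apply (closed_le (fun _ => 0)); auto. intros; apply cont_const.
      intros x Hx. rewrite C3 by auto. apply Hc0; unfold cI; lra.
    + rewrite C3; auto; lra.
    + apply (closed_le (fun _ => gamma) (fun x => C 0%nat x - / 2 * A 1%nat x)).
      intros; apply cont_const. intros; cont.
      intros x Hx. rewrite C3, <- Ea by auto. apply Hco; unfold cI; lra.
  - apply Ea; lra.
  - intros x Hx. rewrite A3, C3, F3; auto.
Qed.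

(** Variation of constants: exp B is the homogeneous solution, where B' = a/eps and B(0) = 0. *)
Lemma linear_ode_solution (eps w0 : R) (a g : R -> R) :
  (forall x, continuous a x) -> (forall x, continuous g x) -> 0 < eps ->
  exists W, W 0 = w0 /\ forall x, is_derive W x ((a x * W x + g x) / eps).
Proof.
  intros Ha Hg He.
  pose (B := fun x => (0 + RInt a 0 x) / eps).
  assert (HB : forall x, is_derive B x (a x / eps)).
  { intros x. unfold B. apply deriv_div. now apply is_derive_RInt_cont. }
  assert (CB : forall x, continuous B x) by (intros; eapply is_derive_continuous, HB).
  assert (Cg : forall x, continuous (fun y => g y * exp (- B y) / eps) x) by (intros; cont).
  exists (fun x => exp (B x) * (w0 + RInt (fun y => g y * exp (- B y) / eps) 0 x)).
  split.
  - unfold B. rewrite !RInt_self.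
    replace ((0 + 0) / eps) with 0 by (field; lra). rewrite exp_0; ring.
  - intros x. eapply is_derive_val.
    + apply deriv_mult. apply deriv_exp, HB. now apply is_derive_RInt_cont.
    + cbv beta. replace (exp (B x) * (g x * exp (- B x) / eps)) with (g x / eps).
      field; lra.
      rewrite exp_Ropp. pose proof (exp_pos (B x)). field; repeat split; lra.
Qed.

Lemma linear_ode_unique (eps : R) (a g w W : R -> R) :
  (forall x, continuous a x) -> 0 < eps ->
  (forall x, -1 < x < 1 -> is_derive w x ((a x * w x + g x) / eps)) ->
  (forall x, -1 < x < 1 -> is_derive W x ((a x * W x + g x) / eps)) ->
  w 0 = W 0 -> forall x, -1 < x < 1 -> w x = W x.
Proof.
  intros Ha He Hw HW E x Hx.
  pose (B := fun x => (0 + RInt a 0 x) / eps).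
  assert (HB : forall x, is_derive B x (a x / eps)).
  { intros y. unfold B. apply deriv_div. now apply is_derive_RInt_cont. }
  assert (G := derive_zero_eq (fun y => (w y - W y) * exp (- B y)) (-1) 1 x 0).
  spec G. { intros z Hz. eapply is_derive_val. deriv; auto. simpl. field; lra. }
  specialize (G Hx ltac:(lra)). cbv beta in G. rewrite E, Rminus_diag, Rmult_0_l in G.
  apply Rmult_integral in G. destruct G as [G|G]. lra.
  pose proof (exp_pos (- B x)); lra.
Qed.

(** The equation and its first two derivatives are recorded up to the end points, each solved for
    its highest term: in this form they are first-order equations for u', u'' and u'''. *)
Record regular_solution (eps : R) (a a1 a2 c c1 c2 f f1 f2 u u1 u2 u3 u4 : R -> R) : Prop := {
  rs_u : forall x, is_derive u x (u1 x);
  rs_u1 : forall x, is_derive u1 x (u2 x);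
  rs_u2 : forall x, is_derive u2 x (u3 x);
  rs_u3 : forall x, is_derive u3 x (u4 x);
  rs_l : u (-1) = 0;
  rs_r : u 1 = 0;
  rs_eq : forall x, cI x -> eps * u2 x = a x * u1 x + c x * u x - f x;
  rs_eq1 : forall x, cI x ->
    eps * u3 x = a1 x * u1 x + a x * u2 x + c1 x * u x + c x * u1 x - f1 x;
  rs_eq2 : forall x, cI x ->
    eps * u4 x = a2 x * u1 x + 2 * a1 x * u2 x + a x * u3 x
                 + c2 x * u x + 2 * c1 x * u1 x + c x * u2 x - f2 x }.

(* The antiderivative of the global solution W of [eps W' = a W + c u - f], with u
   extended by constants, is an extension of u of class C^2; with it in place of u
   the same construction gains two more derivatives. *)
Lemma bvp_solution_regular a a1 a2 c c1 c2 f f1 f2 b gamma a' c' f' eps u :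
  regular_data a a1 a2 c c1 c2 f f1 f2 b gamma ->
  (forall x, -1 < x < 1 -> a' x = a x /\ c' x = c x /\ f' x = f x) ->
  0 < eps -> bvp_solution eps a' c' f' u ->
  exists U U1 U2 U3 U4,
    regular_solution eps a a1 a2 c c1 c2 f f1 f2 U U1 U2 U3 U4 /\
    forall x, cI x -> u x = U x.
Proof.
  intros D E He [Hu [Hul [Hur Hode]]].
  destruct D as [Da Da1 Ca2 Dc Dc1 Cc2 Df Df1 Cf2 _ _ _ _ _ _ _].
  assert (Ca : forall x, continuous a x) by (intros; cont).
  assert (Cc : forall x, continuous c x) by (intros; cont).
  assert (Cf : forall x, continuous f x) by (intros; cont).
  assert (Du : forall x, -1 < x < 1 -> is_derive u x (Derive u x)).
  { intros x Hx. apply Derive_correct. now apply Hode. }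
  assert (Du1 : forall x, -1 < x < 1 -> is_derive (Derive u) x
            ((a x * Derive u x + (c x * u x - f x)) / eps)).
  { intros x Hx. destruct (Hode x Hx) as [_ [H1 H2]].
    destruct (E x Hx) as [E1 [E2 E3]]. rewrite E1, E2, E3 in H2.
    apply Derive_correct in H1. eapply is_derive_val. exact H1.
    change (Derive_n u 2 x) with (Derive (Derive u) x) in H2.
    apply Rmult_eq_reg_l with eps; [|lra]. field_simplify; lra. }
  assert (Step : forall v, (forall x, continuous v x) -> (forall x, cI x -> v x = u x) ->
    exists U U1, (forall x, is_derive U x (U1 x)) /\
     (forall x, is_derive U1 x ((a x * U1 x + (c x * v x - f x)) / eps)) /\
     (forall x, cI x -> U x = u x)).
  { intros v Cv Ev.
    destruct (linear_ode_solution eps (Derive u 0) a (fun x => c x * v x - f x)) as [W [W0 HW]]; auto.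
    intros; cont.
    assert (EW : forall x, -1 < x < 1 -> Derive u x = W x).
    { apply (linear_ode_unique eps a (fun x => c x * v x - f x)); auto.
      intros x Hx. rewrite Ev; auto. unfold cI; lra. }
    assert (CW : forall x, continuous W x) by (intros; eapply is_derive_continuous, HW).
    assert (DU := is_derive_RInt_cont W (u 0) CW).
    exists (fun x => u 0 + RInt W 0 x), W. split; [exact DU|split; [exact HW|]].
    assert (G : forall x, cI x -> u 0 + RInt W 0 x = u (clamp x)).
    { apply closed_eq.
      - intros x. eapply is_derive_continuous, DU.
      - now apply continuous_clamp.
      - intros x Hx. rewrite clamp_id by (unfold cI; lra).
        assert (G := derive_zero_eq (fun y => u 0 + RInt W 0 y - u y) (-1) 1 x 0).
        spec G. { intros z Hz.
          eapply is_derive_val. apply deriv_minus. apply DU. apply Du; auto.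
          rewrite EW; auto; lra. }
        specialize (G Hx ltac:(lra)). cbv beta in G. rewrite RInt_self in G. lra. }
    intros x Hx. rewrite G; auto. now rewrite clamp_id. }
  destruct (Step (fun x => u (clamp x))) as [V [V1 [DV [DV1 EV]]]].
  { now apply continuous_clamp. } { intros x Hx; now rewrite clamp_id. }
  assert (CV : forall x, continuous V x) by (intros; cont).
  destruct (Step V CV EV) as [U [U1 [DU [DU1 EU]]]].
  pose (V2 := fun x => (a x * V1 x + (c x * u (clamp x) - f x)) / eps).
  pose (U2 := fun x => (a x * U1 x + (c x * V x - f x)) / eps).
  pose (U3 := fun x => (a1 x * U1 x + a x * U2 x + (c1 x * V x + c x * V1 x - f1 x)) / eps).
  pose (U4 := fun x => (a2 x * U1 x + a1 x * U2 x + (a1 x * U2 x + a x * U3 x)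
      + ((c2 x * V x + c1 x * V1 x) + (c1 x * V1 x + c x * V2 x) - f2 x)) / eps).
  assert (DU2 : forall x, is_derive U2 x (U3 x)).
  { intros x. unfold U2. eapply is_derive_val. deriv. reflexivity. }
  assert (E0 : forall x, cI x -> V x = U x) by (intros; rewrite EU, EV; auto).
  assert (CU1 : forall x, continuous U1 x) by (intros; eapply is_derive_continuous, DU1).
  assert (CV1 : forall x, continuous V1 x) by (intros; eapply is_derive_continuous, DV1).
  assert (E1 : forall x, cI x -> V1 x = U1 x).
  { apply closed_eq; auto. apply (is_derive_unique_on V U); auto.
    intros; apply E0; unfold cI; lra. }
  assert (E2 : forall x, cI x -> V2 x = U2 x).
  { intros x Hx. unfold V2, U2. rewrite clamp_id, E1, EV; auto. }
  exists U, U1, U2, U3, U4. split.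
  - constructor; auto.
    + intros x. unfold U3, U4. eapply is_derive_val.
      deriv; try apply DU1; try apply DU2; try apply DV1. unfold V2, U2. reflexivity.
    + rewrite EU; auto. unfold cI; lra.
    + rewrite EU; auto. unfold cI; lra.
    + intros x Hx. unfold U2. rewrite E0 by auto. field; lra.
    + intros x Hx. unfold U3. rewrite E0, E1 by auto. field; lra.
    + intros x Hx. unfold U4. rewrite E0, E1, E2 by auto. field; lra.
  - intros; rewrite EU; auto.
Qed.

(** * Maximum principle and boundedness of the solution *)

Lemma MVT_open (f df : R -> R) (x y : R) :
  x < y -> (forall z, x <= z <= y -> is_derive f z (df z)) ->
  exists z, x < z < y /\ f y - f x = df z * (y - x).
Proof.
  intros Hxy Hd.
  destruct (MVT_cor2 f df x y Hxy) as [z [E Hz]].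
  - intros z Hz. apply is_derive_Reals; auto.
  - now exists z.
Qed.

Lemma MVT_abs (f df : R -> R) (M x : R) :
  cI x -> (forall z, cI z -> is_derive f z (df z)) -> (forall z, cI z -> Rabs (df z) <= M) ->
  Rabs (f x - f 0) <= M * Rabs x.
Proof.
  intros [H1 H2] Hd HM.
  destruct (Rle_dec 0 x).
  - destruct (MVT_closed f df 0 x) as [z [Hz E]]; auto.
    { intros; apply Hd; unfold cI; lra. }
    rewrite E, Rminus_0_r, Rabs_mult. apply Rmult_le_compat_r. apply Rabs_pos.
    apply HM; unfold cI; lra.
  - destruct (MVT_closed f df x 0) as [z [Hz E]]; try lra.
    { intros; apply Hd; unfold cI; lra. }
    rewrite Rabs_minus_sym, E, Rminus_0_l, Rabs_mult, Rabs_Ropp.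
    apply Rmult_le_compat_r. apply Rabs_pos.
    apply HM; unfold cI; lra.
Qed.

Lemma derive_sign_right (f : R -> R) (x l : R) :
  is_derive f x l -> l < 0 -> exists d, 0 < d /\ forall h, 0 < h < d -> f (x + h) < f x.
Proof.
  intros H Hl. apply is_derive_Reals in H.
  destruct (H (- l) ltac:(lra)) as [d Hd]. exists d. split. apply cond_pos.
  intros h Hh. specialize (Hd h ltac:(lra)).
  rewrite (Rabs_pos_eq h) in Hd by lra. specialize (Hd ltac:(lra)).
  apply Rabs_def2 in Hd.
  assert ((f (x + h) - f x) / h < 0) by lra.
  assert (E : f (x + h) - f x = (f (x + h) - f x) / h * h) by (field; lra).
  assert ((f (x + h) - f x) / h * h < 0) by nra. lra.
Qed.

Lemma derive_sign_left (f : R -> R) (x l : R) :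
  is_derive f x l -> 0 < l -> exists d, 0 < d /\ forall h, 0 < h < d -> f (x - h) < f x.
Proof.
  intros H Hl. apply is_derive_Reals in H.
  destruct (H l ltac:(lra)) as [d Hd]. exists d. split. apply cond_pos.
  intros h Hh. specialize (Hd (- h) ltac:(lra)).
  rewrite Rabs_Ropp, (Rabs_pos_eq h) in Hd by lra. specialize (Hd ltac:(lra)).
  apply Rabs_def2 in Hd. unfold Rminus.
  assert (0 < (f (x + - h) - f x) / - h) by lra.
  assert (E : f (x + - h) - f x = - ((f (x + - h) - f x) / - h * h)) by (field; lra).
  assert (0 < (f (x + - h) - f x) / - h * h) by nra. lra.
Qed.

(** At a negative interior minimum z' = 0 and z'' >= 0, so the operator would be non-positive there.
    Because the differential inequality is strict, c >= 0 suffices. *)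
Lemma maximum_principle (eps l r : R) (a c z z1 z2 : R -> R) :
  l < r -> 0 < eps ->
  (forall x, l <= x <= r -> is_derive z x (z1 x)) ->
  (forall x, l <= x <= r -> is_derive z1 x (z2 x)) ->
  (forall x, l <= x <= r -> 0 <= c x) ->
  (forall x, l < x < r -> 0 < - eps * z2 x + a x * z1 x + c x * z x) ->
  0 <= z l -> 0 <= z r -> forall x, l <= x <= r -> 0 <= z x.
Proof.
  intros Hlr He D1 D2 Hc HL Hl Hr x Hx.
  destruct (continuity_ab_min z l r) as [m [Hm Hm']]. lra.
  { intros y Hy. apply continuous_pt. eapply is_derive_continuous; auto. }
  destruct (Rle_dec 0 (z m)) as [H|H].
  { specialize (Hm x Hx). lra. }
  exfalso.
  assert (l < m) by (destruct (Rle_lt_or_eq_dec l m); [lra|auto|subst; lra]).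
  assert (m < r) by (destruct (Rle_lt_or_eq_dec m r); [lra|auto|subst; lra]).
  assert (Z1 : z1 m = 0).
  { destruct (Rtotal_order (z1 m) 0) as [G|[G|G]]; auto; exfalso.
    - destruct (derive_sign_right z m (z1 m) (D1 m Hm') G) as [d [Hd Hd']].
      pose (h := Rmin (d / 2) ((r - m) / 2)).
      pose proof (Rmin_l (d/2) ((r-m)/2)); pose proof (Rmin_r (d/2) ((r-m)/2)).
      assert (0 < h) by (apply Rmin_pos; lra). fold h in H2, H3.
      specialize (Hd' h ltac:(lra)). specialize (Hm (m + h) ltac:(lra)). lra.
    - destruct (derive_sign_left z m (z1 m) (D1 m Hm') G) as [d [Hd Hd']].
      pose (h := Rmin (d / 2) ((m - l) / 2)).
      pose proof (Rmin_l (d/2) ((m-l)/2)); pose proof (Rmin_r (d/2) ((m-l)/2)).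
      assert (0 < h) by (apply Rmin_pos; lra). fold h in H2, H3.
      specialize (Hd' h ltac:(lra)). specialize (Hm (m - h) ltac:(lra)). lra. }
  assert (Z2 : 0 <= z2 m).
  { destruct (Rle_dec 0 (z2 m)) as [G|G]; auto; exfalso.
    destruct (derive_sign_right z1 m (z2 m) (D2 m Hm') ltac:(lra)) as [d [Hd Hd']].
    pose (h := Rmin (d / 2) ((r - m) / 2)).
    pose proof (Rmin_l (d/2) ((r-m)/2)); pose proof (Rmin_r (d/2) ((r-m)/2)).
    assert (0 < h) by (apply Rmin_pos; lra). fold h in H2, H3.
    destruct (MVT_open z z1 m (m + h)) as [y [Hy E]]. lra.
    { intros y Hy; apply D1; lra. }
    specialize (Hd' (y - m) ltac:(lra)). replace (m + (y - m)) with y in Hd' by ring.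
    specialize (Hm (m + h) ltac:(lra)).
    assert (z1 y * (m + h - m) < 0) by nra. lra. }
  specialize (HL m ltac:(lra)). rewrite Z1 in HL. specialize (Hc m Hm'). nra.
Qed.

Section Data.
Context {a a1 a2 c c1 c2 f f1 f2 b : R -> R} {gamma : R}.
Context (D : regular_data a a1 a2 c c1 c2 f f1 f2 b gamma).

Lemma b_bounds : exists b0 b1, 0 < b0 /\ b0 <= b1 /\ forall x, cI x -> b0 <= b x <= b1.
Proof.
  destruct (continuity_ab_min b (-1) 1) as [m [Hm Hm']]. lra.
  { intros; apply continuous_pt, (rd_b D). }
  destruct (continuity_ab_maj b (-1) 1) as [M [HM HM']]. lra.
  { intros; apply continuous_pt, (rd_b D). }
  exists (b m), (b M). repeat split; auto.
  apply (rd_b_pos D); auto.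
Qed.

(** Comparison with a multiple of 2 - x^2, which the operator maps to 2 eps + 2 x^2 b + c (2 - x^2)
    >= 2 x^2 b + c. The last expression is bounded below although c may vanish: c(0) > 0 at the
    turning point, and b > 0 away from it. *)
Lemma solution_bounded :
  exists M, 0 < M /\ forall eps u u1 u2 u3 u4, 0 < eps ->
    regular_solution eps a a1 a2 c c1 c2 f f1 f2 u u1 u2 u3 u4 ->
    forall x, cI x -> Rabs (u x) <= M.
Proof.
  destruct D as [Da Da1 Ca2 Dc Dc1 Cc2 Df Df1 Cf2 Cb Hab Hb Hc Hc0 _ _].
  destruct (continuity_ab_min (fun x => 2 * (x * x) * b x + c x) (-1) 1) as [m [Hm Hm']]. lra.
  { intros; apply continuous_pt. cont. }
  assert (exists k, 0 < k /\ forall x, cI x -> k <= 2 * (x * x) * b x + c x) as [k [Hk Hkm]].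
  { exists (2 * (m * m) * b m + c m). split; [|apply Hm].
    specialize (Hb m Hm'). specialize (Hc m Hm').
    destruct (Req_dec m 0) as [->|Hn]. lra. assert (0 < m * m) by nra. nra. }
  clear m Hm Hm'.
  destruct (continuous_bounded f (-1) 1) as [F [HF HF']]. lra. { intros; cont. }
  exists (F / k * 2). assert (0 < F / k) by now apply Rdiv_lt_0_compat. split. lra.
  intros eps u u1 u2 u3 u4 He [Du Du1 _ _ Hl Hr Heq _ _].
  assert (G : forall e, e = 1 \/ e = -1 -> forall x, cI x ->
     0 <= F / k * (2 - x * x) + e * u x).
  { intros e Hes.
    apply (maximum_principle eps (-1) 1 a c _
             (fun x => F / k * (- 2 * x) + e * u1 x) (fun x => F / k * (- 2) + e * u2 x));
      auto; try lra.
    - intros x Hx. eapply is_derive_val. deriv. simpl; field; lra.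
    - intros x Hx. eapply is_derive_val. deriv. simpl; field; lra.
    - intros x Hx. assert (Hx' : cI x) by (unfold cI; lra).
      specialize (Heq x Hx'). specialize (Hkm x Hx'). specialize (HF' x Hx').
      specialize (Hab x Hx'). specialize (Hc x Hx').
      replace (- eps * (F / k * -2 + e * u2 x) + a x * (F / k * (-2 * x) + e * u1 x) +
        c x * (F / k * (2 - x * x) + e * u x)) with
       (F / k * (2 * eps + (2 * (x * x) * b x + c x) + c x * (1 - x * x))
        + e * (- (eps * u2 x) + a x * u1 x + c x * u x)) by (rewrite Hab; ring).
      rewrite Heq. replace (- (a x * u1 x + c x * u x - f x) + a x * u1 x + c x * u x) with (f x) by ring.
      assert (0 <= c x * (1 - x * x)) by (apply Rmult_le_pos; [lra|clear - Hx; nra]).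
      assert (F / k * (2 * eps + k) <=
        F / k * (2 * eps + (2 * (x * x) * b x + c x) + c x * (1 - x * x))).
      { apply Rmult_le_compat_l; lra. }
      assert (F / k * (2 * eps + k) = F + F / k * (2 * eps)) by (field; lra).
      assert (0 < F / k * (2 * eps)) by (apply Rmult_lt_0_compat; lra).
      apply Rabs_le_between in HF'. destruct Hes; subst e; lra.
    - rewrite Hl. nra.
    - rewrite Hr. nra. }
  intros x Hx. pose proof (G 1 (or_introl eq_refl) x Hx). pose proof (G (-1) (or_intror eq_refl) x Hx).
  assert (F / k * (2 - x * x) <= F / k * 2). { apply Rmult_le_compat_l. lra. nra. }
  apply Rabs_le. lra.
Qed.
End Data.

(** * The barrier near the turning point *)

Lemma Rpower_pos x y : 0 < Rpower x y.
Proof. apply exp_pos. Qed.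

Lemma Rpower_minus x y z : Rpower x (y - z) = Rpower x y / Rpower x z.
Proof. unfold Rminus, Rdiv. now rewrite Rpower_plus, Rpower_Ropp. Qed.

Lemma Rpower_add1 x y : 0 < x -> Rpower x (y + 1) = Rpower x y * x.
Proof. intros H. rewrite Rpower_plus, Rpower_1; auto. Qed.

Lemma Rpower_sub1 x y : 0 < x -> Rpower x (y - 1) = Rpower x y / x.
Proof. intros H. rewrite Rpower_minus, Rpower_1; auto. Qed.

Lemma deriv_Rpower (p : R -> R) (al x dp : R) :
  is_derive p x dp -> 0 < p x ->
  is_derive (fun y => Rpower (p y) al) x (dp * (al * Rpower (p x) (al - 1))).
Proof.
  intros Hp Hx. apply (deriv_comp (fun y => Rpower y al)); auto.
  apply is_derive_Reals. now apply derivable_pt_lim_power.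
Qed.

Lemma Rpower_half_pow p n : 0 < p -> Rpower p (INR n / 2) = sqrt p ^ n.
Proof.
  intros H. unfold Rdiv. rewrite Rmult_comm, <- Rpower_mult, Rpower_sqrt by auto.
  apply Rpower_pow. now apply sqrt_lt_R0.
Qed.

Lemma barrier_power (keps al x : R) : 0 < keps ->
  is_derive (fun y => Rpower (keps + y * y) al) x (2 * al * x * Rpower (keps + x * x) (al - 1)) /\
  is_derive (fun y => 2 * al * y * Rpower (keps + y * y) (al - 1)) x
    (2 * al * Rpower (keps + x * x) (al - 1)
     + 4 * al * (al - 1) * (x * x) * Rpower (keps + x * x) (al - 1 - 1)).
Proof.
  intros Hk. assert (Hp : 0 < keps + x * x) by nra.
  assert (H : is_derive (fun y => keps + y * y) x (2 * x)).
  { eapply is_derive_val. deriv. simpl; ring. }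
  split.
  - eapply is_derive_val. apply (deriv_Rpower (fun y => keps + y * y)); eauto. simpl; ring.
  - eapply is_derive_val. apply deriv_mult. deriv. apply (deriv_Rpower (fun y => keps + y * y)); eauto.
    simpl; ring.
Qed.

(* The left-hand side is the differential operator applied to [p^al]. *)
Lemma barrier_operator (eps k al x b c P p : R) :
  p = k * eps + x * x -> 0 < p ->
  - eps * (2 * al * (P / p) + 4 * al * (al - 1) * (x * x) * (P / p / p))
    + - x * b * (2 * al * x * (P / p)) + c * P
  = P * (c - 2 * al * b + 2 * al * (eps / p) * (b * k - 1 - 2 * (al - 1) * (x * x / p))).
Proof.
  intros E Hp.
  assert (E' : x * x = p - k * eps) by lra.
  replace (- x * b * (2 * al * x * (P / p))) with (- (x * x) * b * (2 * al * (P / p))) by (field; lra).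
  rewrite E'. field. lra.
Qed.

(** To be read with Pa = p^al, Pb = p^be, e = eps/p, y = x^2/p, and [k] the kappa in p: the operator
    applied to p^al - A p^be is at least p^be. The factor c - 2 al b may vanish at the turning
    point, and its negative part costs at most C Pb. Replacing al by be in the correction gains A (2
    be - 2 al) b Pb >= (C + 1) Pb, which fixes A. The eps-terms of the correction are absorbed by
    those of Pa, since 2 be A Pb <= al Pa. *)
Lemma barrier_lower (c b k e y al be Pa Pb A x C b0 : R) :
  0 < al -> al < be -> (be = 1 / 2 \/ be = 1) -> 2 <= b * k -> 0 < b0 <= b -> 0 < e -> 0 <= y <= 1 ->
  0 < Pa -> 0 < Pb -> 0 < A -> 0 < k -> 0 <= x -> 0 < C ->
  2 * be * A * Pb <= al * Pa -> x * Pa <= Pb -> - C * x <= c - 2 * al * b ->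
  A * (2 * be - 2 * al) * b0 = C + 1 ->
  Pb <= Pa * (c - 2 * al * b + 2 * al * e * (b * k - 1 - 2 * (al - 1) * y))
     - A * (Pb * (c - 2 * be * b + 2 * be * e * (b * k - 1 - 2 * (be - 1) * y))).
Proof.
  intros Hal Hab Hbe Hbk Hb He Hy HPa HPb HA Hk Hx HC HAP HxP Hc EA.
  assert (Hbe1 : 1 / 2 <= be <= 1) by (destruct Hbe; lra).
  assert (al < 1) by lra.
  (* b k >= 2 and al < 1 give the lower bound; the upper bound holds because -1 - 2 (be - 1) y <= 0
     for be = 1/2 and be = 1. *)
  assert (G1 : b * k / 2 <= b * k - 1 - 2 * (al - 1) * y) by nra.
  assert (G2 : b * k - 1 - 2 * (be - 1) * y <= b * k) by nra.
  assert (T1 : Pa * (al * e * (b * k)) <= Pa * (2 * al * e * (b * k - 1 - 2 * (al - 1) * y))).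
  { apply Rmult_le_compat_l. lra. replace (al * e * (b * k)) with (2 * al * e * (b * k / 2)) by field.
    apply Rmult_le_compat_l; auto. nra. }
  assert (T2 : A * Pb * (2 * be * e * (b * k - 1 - 2 * (be - 1) * y)) <= A * Pb * (2 * be * e * (b * k))).
  { apply Rmult_le_compat_l. nra. apply Rmult_le_compat_l; auto. nra. }
  assert (T3 : A * Pb * (2 * be * e * (b * k)) <= Pa * (al * e * (b * k))).
  { replace (A * Pb * (2 * be * e * (b * k))) with (2 * be * A * Pb * (e * (b * k))) by ring.
    replace (Pa * (al * e * (b * k))) with (al * Pa * (e * (b * k))) by ring.
    apply Rmult_le_compat_r; auto. nra. }
  assert (Hphi : 0 <= Pa - A * Pb <= Pa).
  { assert (0 < A * Pb) by nra. assert (A * Pb <= 2 * be * A * Pb) by nra.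
    assert (al * Pa <= Pa) by nra. lra. }
  assert (T4 : - C * Pb <= (c - 2 * al * b) * (Pa - A * Pb)).
  { apply Rle_trans with (- C * x * (Pa - A * Pb)); [|apply Rmult_le_compat_r; lra].
    assert (x * (Pa - A * Pb) <= Pb) by nra. nra. }
  assert (T5 : (C + 1) * Pb <= A * Pb * (2 * be - 2 * al) * b).
  { rewrite <- EA. replace (A * (2 * be - 2 * al) * b0 * Pb) with (A * Pb * (2 * be - 2 * al) * b0) by ring.
    apply Rmult_le_compat_l; [|lra]. apply Rmult_le_pos; [|lra]. nra. }
  lra.
Qed.

Section Data.
Context {a a1 a2 c c1 c2 f f1 f2 b : R -> R} {gamma : R}.
Context (D : regular_data a a1 a2 c c1 c2 f f1 f2 b gamma).

(** b is only known to be continuous, so its Lipschitz bound at 0 comes from b(x) = -a'(z) with z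
    between 0 and x. *)
Lemma near_zero (lambda : R) : 0 < lambda -> lambda * b 0 <= c 0 ->
  exists C, 0 < C /\ forall x, cI x -> - C * Rabs x <= c x - lambda * b x.
Proof.
  intros Hl Hl0. pose proof (rd_a1_0 D) as E0.
  destruct D as [Da Da1 Ca2 Dc Dc1 Cc2 _ _ _ Cb Hab _ _ _ _ _].
  destruct (continuous_bounded a2 (-1) 1) as [Ma [HMa HMa']]. lra. { intros; cont. }
  destruct (continuous_bounded c1 (-1) 1) as [Mc [HMc HMc']]. lra. { intros; cont. }
  exists (Mc + lambda * Ma). split. nra.
  intros x Hx.
  assert (Hc : Rabs (c x - c 0) <= Mc * Rabs x) by (apply (MVT_abs c c1); auto).
  assert (Hb : b x <= b 0 + Ma * Rabs x).
  { destruct (Req_dec x 0) as [->|Hn]. rewrite Rabs_R0; lra.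
    assert (exists z, cI z /\ Rabs z <= Rabs x /\ b x = - a1 z) as [z [Hz [Hzx Ez]]].
    { pose proof (Hab x Hx) as Ex. pose proof (Hab 0 ltac:(unfold cI; lra)) as E.
      rewrite Ropp_0, Rmult_0_l in E. destruct Hx.
      destruct (Rle_dec 0 x).
      - destruct (MVT_closed a a1 0 x) as [z [Hz Ez]]; auto. exists z.
        split; [unfold cI; lra|]. split. rewrite !Rabs_pos_eq; lra.
        rewrite E, Ex in Ez. apply Rmult_eq_reg_l with x; auto. lra.
      - destruct (MVT_closed a a1 x 0) as [z [Hz Ez]]; auto; try lra. exists z.
        split; [unfold cI; lra|]. split. rewrite !Rabs_left1; lra.
        rewrite E, Ex in Ez. apply Rmult_eq_reg_l with x; auto. lra. }
    assert (H : Rabs (a1 z - a1 0) <= Ma * Rabs z) by (apply (MVT_abs a1 a2); auto).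
    apply Rabs_le_between in H. rewrite Ez. nra. }
  apply Rabs_le_between in Hc. pose proof (Rabs_pos x). nra.
Qed.

(** The barrier serves only for |x| <= r0 and eps <= e0, where the correction A p^be is at most half
    of p^al. Elsewhere sqrt eps + |x| is bounded below and |v| <= Mv is enough. *)
Lemma layer_bound (lambda Mg Mv : R) (n : nat) :
  0 < lambda -> lambda * b 0 <= c 0 -> n = 1%nat \/ n = 2%nat ->
  INR n - 1 < lambda < INR n -> 0 < Mg -> 0 < Mv ->
  exists M, 0 < M /\ forall eps v v1 v2 g, 0 < eps ->
    (forall x, is_derive v x (v1 x)) -> (forall x, is_derive v1 x (v2 x)) ->
    (forall x, cI x -> eps * v2 x = a x * v1 x + c x * v x - g x) ->
    (forall x, cI x -> Rabs (g x) <= Mg * Rabs x ^ n) ->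
    (forall x, cI x -> Rabs (v x) <= Mv) ->
    forall x, cI x -> Rabs (v x) <= M * Rpower (sqrt eps + Rabs x) lambda.
Proof.
  intros Hl Hl0 Hn Hln HMg HMv.
  destruct (near_zero lambda Hl Hl0) as [C [HC HC']].
  destruct (b_bounds D) as [b0 [b1 [Hb0 [_ Hb]]]].
  set (al := lambda / 2). set (be := INR n / 2). set (th := INR n - lambda).
  assert (Hbe : be = 1 / 2 \/ be = 1).
  { unfold be; destruct Hn; subst n; simpl; [left|right]; field. }
  (* Since th = 2 be - 2 al, A th b0 = C + 1 pays for the loss C of [near_zero]; k is chosen for b k
     >= 2. *)
  set (A := (C + 1) / (th * b0)). set (k := Rmax 1 (2 / b0)).
  assert (Hth : 0 < th < 1) by (unfold th; lra).
  assert (HA : 0 < A) by (apply Rdiv_lt_0_compat; [lra|nra]).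
  assert (Hk : 1 <= k) by apply Rmax_l.
  assert (Hkb : 2 <= b0 * k).
  { pose proof (Rmax_r 1 (2 / b0)) as H. fold k in H.
    apply Rmult_le_compat_l with (r := b0) in H; [|lra].
    replace (b0 * (2 / b0)) with 2 in H by (field; lra). auto. }
  set (q := al / (2 * be * A)). assert (Hal : 0 < al) by (unfold al; lra).
  assert (Hbe0 : 1 / 2 <= be) by (destruct Hbe; lra).
  assert (Hq : 0 < q) by (apply Rdiv_lt_0_compat; nra).
  (* p <= P0 gives p^(th/2) <= q; as be - al = th/2, this is 2 be A p^be <= al p^al. *)
  set (P0 := Rmin 1 (Rpower q (2 / th))).
  assert (HP0 : 0 < P0 <= 1).
  { split. apply Rmin_pos; [lra|apply Rpower_pos]. apply Rmin_l. }
  assert (HP0q : forall p, 0 < p <= P0 -> Rpower p (th / 2) <= q).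
  { intros p Hp. apply Rle_trans with (Rpower (Rpower q (2 / th)) (th / 2)).
    - apply Rle_Rpower_l. lra. split. lra. apply Rle_trans with P0. lra. apply Rmin_r.
    - rewrite Rpower_mult. replace (2 / th * (th / 2)) with 1 by (field; lra).
      rewrite Rpower_1; lra. }
  (* eps <= e0 and |x| <= r0 contribute at most P0/2 each to p = k eps + x^2. *)
  set (e0 := P0 / (2 * k)). assert (He0 : 0 < e0) by (apply Rdiv_lt_0_compat; lra).
  set (r0 := sqrt (P0 / 2)).
  assert (Hr0 : 0 < r0) by (apply sqrt_lt_R0; lra).
  assert (Er0 : r0 * r0 = P0 / 2) by (apply sqrt_sqrt; lra).
  assert (Hr01 : r0 < 1) by nra.
  set (m0 := Rpower (P0 / 2) al / 2).
  assert (Hm0 : 0 < m0) by (pose proof (Rpower_pos (P0 / 2) al); unfold m0; lra).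
  (* [Mg + 1] strictly dominates the right-hand side g; [Mv / m0] dominates v at both ends of
     [-r0, r0], where the barrier is at least m0. *)
  set (DD := Mg + 1 + Mv / m0). assert (HMm : 0 < Mv / m0) by now apply Rdiv_lt_0_compat.
  set (rm := Rmin r0 (sqrt e0)). assert (Hrm : 0 < rm) by (apply Rmin_pos; auto; now apply sqrt_lt_R0).
  exists (DD * Rpower k al + Mv / Rpower rm lambda).
  assert (HDk : 0 < DD * Rpower k al).
  { apply Rmult_lt_0_compat. unfold DD; lra. apply Rpower_pos. }
  assert (HMr : 0 < Mv / Rpower rm lambda) by (apply Rdiv_lt_0_compat; auto; apply Rpower_pos).
  split. lra.
  intros eps v v1 v2 g He Dv Dv1 Heq Hg Hv x Hx.
  assert (Hse : 0 < sqrt eps) by now apply sqrt_lt_R0.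
  pose proof (Rabs_pos x) as Hax.
  assert (Hrp := Rpower_pos (sqrt eps + Rabs x) lambda).
  assert (Far : rm <= sqrt eps + Rabs x ->
    Rabs (v x) <= (DD * Rpower k al + Mv / Rpower rm lambda) * Rpower (sqrt eps + Rabs x) lambda).
  { intros Hfar. apply Rle_trans with (Mv / Rpower rm lambda * Rpower (sqrt eps + Rabs x) lambda).
    - apply Rle_trans with Mv. auto.
      assert (Rpower rm lambda <= Rpower (sqrt eps + Rabs x) lambda) by (apply Rle_Rpower_l; lra).
      replace Mv with (Mv / Rpower rm lambda * Rpower rm lambda) at 1
        by (field; apply Rgt_not_eq, Rpower_pos).
      apply Rmult_le_compat_l; lra.
    - apply Rmult_le_compat_r; lra. }
  destruct (Rle_dec eps e0) as [Hee|Hee].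
  2:{ apply Far. apply Rle_trans with (sqrt e0). apply Rmin_r.
      assert (sqrt e0 <= sqrt eps) by (apply sqrt_le_1; lra). lra. }
  destruct (Rle_dec (Rabs x) r0) as [Hxr|Hxr].
  2:{ apply Far. apply Rle_trans with r0. apply Rmin_l. lra. }
  clear Far.
  assert (Hke : 0 < k * eps <= P0 / 2).
  { split. nra. apply Rle_trans with (k * e0). apply Rmult_le_compat_l; lra.
    unfold e0. right; field; lra. }
  set (phi := fun y => Rpower (k * eps + y * y) al - A * Rpower (k * eps + y * y) be).
  assert (Small : forall y, - r0 <= y <= r0 ->
     0 < k * eps + y * y <= P0 /\
     2 * be * A * Rpower (k * eps + y * y) be <= al * Rpower (k * eps + y * y) al).
  { intros y Hy. assert (Hp : 0 < k * eps + y * y <= P0) by nra. split. auto.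
    replace be with (th / 2 + al) at 2 by (unfold th, al, be; field).
    rewrite Rpower_plus.
    apply Rle_trans with (2 * be * A * (q * Rpower (k * eps + y * y) al)).
    - apply Rmult_le_compat_l. nra. apply Rmult_le_compat_r. left; apply Rpower_pos. auto.
    - right. unfold q. field. lra. }
  assert (Hphi : forall y, - r0 <= y <= r0 ->
     Rpower (k * eps + y * y) al / 2 <= phi y <= Rpower (k * eps + y * y) al).
  { intros y Hy. destruct (Small y Hy) as [_ H]. unfold phi.
    pose proof (Rpower_pos (k * eps + y * y) al) as Q1. pose proof (Rpower_pos (k * eps + y * y) be) as Q2.
    assert (al < be) by (unfold al, be; lra).
    assert (0 < A * Rpower (k * eps + y * y) be) by nra. split; [|lra].
    assert (2 * be * A * Rpower (k * eps + y * y) be <= be * Rpower (k * eps + y * y) al) by nra.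
    assert (2 * (A * Rpower (k * eps + y * y) be) <= Rpower (k * eps + y * y) al) by nra.
    lra. }
  assert (Main : forall s, s = 1 \/ s = -1 -> forall y, - r0 <= y <= r0 -> 0 <= DD * phi y + s * v y).
  { intros s Hs.
    assert (Bd : forall y, y = r0 \/ y = - r0 -> 0 <= DD * phi y + s * v y).
    { intros y Hy. assert (Hyr : - r0 <= y <= r0) by (destruct Hy; subst; lra).
      assert (Hy2 : y * y = P0 / 2) by (destruct Hy; subst; lra).
      destruct (Hphi y Hyr) as [H _].
      assert (m0 <= phi y).
      { eapply Rle_trans; [|exact H]. unfold m0. apply Rmult_le_compat_r. lra.
        apply Rle_Rpower_l; lra. }
      assert (Mv <= DD * phi y).
      { apply Rle_trans with (Mv / m0 * m0). right; field; lra.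
        apply Rmult_le_compat; unfold DD; lra. }
      assert (Hvy : Rabs (v y) <= Mv) by (apply Hv; unfold cI; lra).
      apply Rabs_le_between in Hvy. destruct Hs; subst s; lra. }
    apply (maximum_principle eps (- r0) r0 a c _
      (fun y => DD * (2 * al * y * Rpower (k * eps + y * y) (al - 1)
                - A * (2 * be * y * Rpower (k * eps + y * y) (be - 1))) + s * v1 y)
      (fun y => DD * ((2 * al * Rpower (k * eps + y * y) (al - 1)
     + 4 * al * (al - 1) * (y * y) * Rpower (k * eps + y * y) (al - 1 - 1)) -
       A * (2 * be * Rpower (k * eps + y * y) (be - 1)
     + 4 * be * (be - 1) * (y * y) * Rpower (k * eps + y * y) (be - 1 - 1))) + s * v2 y)); auto; try lra.
    - intros y Hy. unfold phi.
      destruct (barrier_power (k * eps) al y (proj1 Hke)) as [Q1 _].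
      destruct (barrier_power (k * eps) be y (proj1 Hke)) as [Q2 _].
      eapply is_derive_val.
      apply deriv_plus; [|apply deriv_mult; [apply deriv_const|apply Dv]]. apply deriv_mult. apply deriv_const.
      apply deriv_minus. exact Q1. apply deriv_mult. apply deriv_const. exact Q2.
      simpl; ring.
    - intros y Hy.
      destruct (barrier_power (k * eps) al y (proj1 Hke)) as [_ Q1].
      destruct (barrier_power (k * eps) be y (proj1 Hke)) as [_ Q2].
      eapply is_derive_val.
      apply deriv_plus; [|apply deriv_mult; [apply deriv_const|apply Dv1]]. apply deriv_mult. apply deriv_const.
      apply deriv_minus. exact Q1. apply deriv_mult. apply deriv_const. exact Q2.
      simpl; ring.
    - intros y Hy. apply (rd_c_nonneg D). unfold cI; lra.
    - intros y Hy. assert (Hyc : cI y) by (unfold cI; lra).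
      destruct (Small y ltac:(lra)) as [Hp HAP].
      assert (Hyy : 0 <= y * y) by apply Rle_0_sqr.
      set (p := k * eps + y * y) in *.
      assert (Low : Rpower p be <=
        - eps * ((2 * al * Rpower p (al - 1) + 4 * al * (al - 1) * (y * y) * Rpower p (al - 1 - 1))
        - A * (2 * be * Rpower p (be - 1) + 4 * be * (be - 1) * (y * y) * Rpower p (be - 1 - 1)))
        + a y * (2 * al * y * Rpower p (al - 1) - A * (2 * be * y * Rpower p (be - 1)))
        + c y * phi y).
      { rewrite !Rpower_sub1 by lra. unfold phi. fold p.
        set (Pa := Rpower p al). set (Pb := Rpower p be).
        rewrite (rd_ab D y Hyc).
        pose proof (barrier_operator eps k al y (b y) (c y) Pa p eq_refl (proj1 Hp)) as B1.
        pose proof (barrier_operator eps k be y (b y) (c y) Pb p eq_refl (proj1 Hp)) as B2.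
        match goal with |- _ <= ?R => replace R with
          (Pa * (c y - 2 * al * b y + 2 * al * (eps / p) * (b y * k - 1 - 2 * (al - 1) * (y * y / p)))
           - A * (Pb * (c y - 2 * be * b y + 2 * be * (eps / p) * (b y * k - 1 - 2 * (be - 1) * (y * y / p)))))
          by (rewrite <- B1, <- B2; ring) end.
        specialize (Hb y Hyc).
        apply (barrier_lower _ _ _ _ _ al be Pa Pb A (Rabs y) C b0); auto; try lra.
        - unfold al, be; lra.
        - apply Rle_trans with (b0 * k). lra. apply Rmult_le_compat_r; lra.
        - apply Rdiv_lt_0_compat; lra.
        - split. apply Rmult_le_pos. exact Hyy. left; apply Rinv_0_lt_compat; lra.
          apply (Rmult_le_reg_r p). lra. replace (y * y / p * p) with (y * y) by (field; lra).
          unfold p; lra.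
        - apply Rpower_pos.
        - apply Rpower_pos.
        - apply Rabs_pos.
        (* Here n - lambda < 1 enters: |y| p^al <= p^(1/2 + al), and 1/2 + al >= be with p <= 1. *)
        - assert (Rabs y <= Rpower p (/ 2)).
          { rewrite Rpower_sqrt by lra. rewrite <- sqrt_Rsqr_abs. apply sqrt_le_1; unfold Rsqr, p; lra. }
          apply Rle_trans with (Rpower p (/ 2) * Pa). apply Rmult_le_compat_r; auto. left; apply Rpower_pos.
          unfold Pa, Pb. rewrite <- Rpower_plus.
          replace (/ 2 + al) with (be + (1 - th) / 2) by (unfold th, al, be; field).
          rewrite Rpower_plus. rewrite <- (Rmult_1_r (Rpower p be)) at 2.
          apply Rmult_le_compat_l. left; apply Rpower_pos.
          replace 1 with (Rpower 1 ((1 - th) / 2)) at 2.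
          apply Rle_Rpower_l; lra. unfold Rpower. rewrite ln_1, Rmult_0_r. apply exp_0.
        - replace (2 * al) with lambda by (unfold al; field). auto.
        - replace (2 * be - 2 * al) with th by (unfold th, al, be; field). unfold A. field. lra. }
      assert (Hgy : Rabs (g y) <= Mg * Rpower p be).
      { eapply Rle_trans. apply Hg; auto. apply Rmult_le_compat_l. lra.
        unfold be. rewrite Rpower_half_pow by lra. apply pow_incr. split. apply Rabs_pos.
        rewrite <- sqrt_Rsqr_abs. apply sqrt_le_1; unfold Rsqr, p; lra. }
      specialize (Heq y Hyc). apply Rabs_le_between in Hgy.
      pose proof (Rpower_pos p be) as Hpb.
      match type of Low with _ <= ?L =>
        match goal with |- 0 < ?G => replace G with (DD * L + s * g y);
          [assert (DD * Rpower p be <= DD * L) by (apply Rmult_le_compat_l; [unfold DD; lra|exact Low])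
          | replace (g y) with (a y * v1 y + c y * v y - eps * v2 y) by lra; ring] end end.
      assert ((Mg + 1) * Rpower p be <= DD * Rpower p be).
      { apply Rmult_le_compat_r. lra. unfold DD. lra. }
      destruct Hs; subst s; lra. }
  assert (Hxr' : - r0 <= x <= r0) by now apply Rabs_le_between.
  pose proof (Main 1 (or_introl eq_refl) x Hxr') as M1.
  pose proof (Main (-1) (or_intror eq_refl) x Hxr') as M2.
  destruct (Hphi x Hxr') as [_ H].
  apply Rle_trans with (DD * Rpower k al * Rpower (sqrt eps + Rabs x) lambda);
    [|apply Rmult_le_compat_r; lra].
  apply Rle_trans with (DD * phi x). apply Rabs_le; lra.
  rewrite Rmult_assoc. apply Rmult_le_compat_l. unfold DD; lra.
  eapply Rle_trans. exact H.
  (* p <= k r^2 for r = sqrt eps + |x|, hence p^al <= k^al r^lambda. *)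
  replace lambda with (2 * al) by (unfold al; field).
  rewrite <- Rpower_mult. rewrite Rpower_mult_distr; [|lra|apply Rpower_pos].
  apply Rle_Rpower_l. lra. split. nra.
  replace (Rpower (sqrt eps + Rabs x) 2) with ((sqrt eps + Rabs x) ^ 2).
  2:{ rewrite <- Rpower_pow by lra. now simpl. }
  assert (Es : sqrt eps * sqrt eps = eps) by (apply sqrt_sqrt; lra).
  assert (Ex : Rabs x * Rabs x = x * x) by (rewrite <- Rabs_mult; apply Rabs_pos_eq; nra).
  rewrite <- Ex. simpl. rewrite Rmult_1_r.
  replace ((sqrt eps + Rabs x) * (sqrt eps + Rabs x)) with (eps + 2 * (sqrt eps * Rabs x) + Rabs x * Rabs x)
   by (rewrite <- Es at 1; ring).
  assert (0 <= sqrt eps * Rabs x) by nra. nra.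
Qed.
End Data.

(** * First-order comparison for the derivatives *)

Lemma exp_monotone x y : x <= y -> exp x <= exp y.
Proof. intros [H| ->]. left; now apply exp_increasing. lra. Qed.

Lemma Rpower_antitone x y mu : mu <= 0 -> 0 < x <= y -> Rpower y mu <= Rpower x mu.
Proof.
  intros Hm Hx. replace mu with (- (- mu)) by ring. rewrite !(Rpower_Ropp _ (- mu)).
  apply Rinv_le_contravar. apply Rpower_pos. apply Rle_Rpower_l; lra.
Qed.

Lemma Rpower_comparable s r K mu : 0 < s <= r -> r <= K * s -> 1 <= K -> -3 <= mu <= 3 ->
  Rpower r mu <= K ^ 3 * Rpower s mu /\ Rpower s mu <= K ^ 3 * Rpower r mu.
Proof.
  intros Hs Hr HK Hmu.
  assert (HK3 : 1 <= K ^ 3) by (apply pow_R1_Rle; lra).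
  assert (HKm : forall m, m <= 3 -> Rpower K m <= K ^ 3).
  { intros m Hm. rewrite <- Rpower_pow by lra. apply Rle_Rpower; simpl; lra. }
  pose proof (Rpower_pos r mu). pose proof (Rpower_pos s mu).
  destruct (Rle_dec 0 mu) as [H1|H1].
  - assert (Rpower s mu <= Rpower r mu) by (apply Rle_Rpower_l; lra). split; [|nra].
    apply Rle_trans with (Rpower (K * s) mu). apply Rle_Rpower_l; lra.
    rewrite <- Rpower_mult_distr by lra. apply Rmult_le_compat_r; auto. lra. apply HKm; lra.
  - assert (Rpower r mu <= Rpower s mu) by (apply Rpower_antitone; lra). split; [nra|].
    assert (E : Rpower s mu = Rpower K (- mu) * Rpower (K * s) mu).
    { rewrite <- Rpower_mult_distr by lra. rewrite <- Rmult_assoc, <- Rpower_plus.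
      rewrite Rplus_opp_l, Rpower_O by lra. ring. }
    rewrite E. apply Rmult_le_compat; try (left; apply Rpower_pos).
    apply HKm; lra. apply Rpower_antitone; lra.
Qed.

(** The base sqrt eps + |x| never exceeds 2 and the exponents compared differ by at most 4, hence
    16. *)
Lemma Rpower_lower_exponent r m1 m2 : 0 < r <= 2 -> m2 <= m1 <= m2 + 4 -> Rpower r m1 <= 16 * Rpower r m2.
Proof.
  intros Hr Hm. replace m1 with ((m1 - m2) + m2) by ring. rewrite Rpower_plus.
  apply Rmult_le_compat_r. left; apply Rpower_pos.
  apply Rle_trans with (Rpower 2 (m1 - m2)). apply Rle_Rpower_l; lra.
  apply Rle_trans with (Rpower 2 (INR 4)). apply Rle_Rpower; simpl; lra.
  rewrite Rpower_pow; simpl; lra.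
Qed.

(** z exp(-B/eps) with B' = a is non-decreasing, so one initial value at the left end controls the
    whole interval. *)
Lemma first_order_comparison (eps x0 x1 : R) (a z dz : R -> R) :
  0 < eps -> (forall x, continuous a x) -> (forall x, x0 <= x <= x1 -> is_derive z x (dz x)) ->
  (forall x, x0 <= x <= x1 -> 0 <= eps * dz x - a x * z x) -> 0 <= z x0 ->
  forall x, x0 <= x <= x1 -> 0 <= z x.
Proof.
  intros He Ca Dz H Hz x Hx.
  assert (DB := is_derive_RInt_cont a 0 Ca).
  set (B := fun y => 0 + RInt a 0 y) in *.
  destruct (MVT_closed (fun y => z y * exp (- (B y / eps)))
     (fun y => (eps * dz y - a y * z y) / eps * exp (- (B y / eps))) x0 x) as [y [Hy E]]. lra.
  { intros y Hy. eapply is_derive_val. apply deriv_mult. apply Dz; lra. apply deriv_exp, deriv_opp, deriv_div, DB.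
    simpl. field. lra. }
  assert (0 <= (eps * dz y - a y * z y) / eps * exp (- (B y / eps)) * (x - x0)).
  { apply Rmult_le_pos; [|lra]. apply Rmult_le_pos; [|left; apply exp_pos].
    apply Rmult_le_pos. apply H; lra. left; now apply Rinv_0_lt_compat. }
  pose proof (exp_pos (- (B x / eps))). pose proof (exp_pos (- (B x0 / eps))).
  assert (0 <= z x0 * exp (- (B x0 / eps))) by nra.
  apply Rmult_le_reg_r with (exp (- (B x / eps))); auto. lra.
Qed.

(** Multiples of r^mu, r = sqrt eps + x, are supersolutions for x >= k sqrt eps. There x >= r/2, so
    -a r >= (b0/2) r^2, while a negative mu costs at most 3 eps <= (b0/4) r^2, by r >= (1 + k) sqrt
    eps and the threshold 12/b0. The surplus (b0/4) r^(mu+1) absorbs G. In the constant, M' covers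
    the starting point and 4 M / b0 the source. *)
Lemma outer_bound (eps k mu b0 M M' : R) (a b w dw G : R -> R) :
  0 < eps -> 1 <= k -> 12 / b0 <= (1 + k) ^ 2 -> 0 < b0 -> -3 <= mu -> 0 <= M -> 0 <= M' ->
  k * sqrt eps <= 1 ->
  (forall x, continuous a x) -> (forall x, 0 <= x <= 1 -> a x = - x * b x /\ b0 <= b x) ->
  (forall x, is_derive w x (dw x)) ->
  (forall x, 0 <= x <= 1 -> eps * dw x = a x * w x + G x) ->
  (forall x, 0 <= x <= 1 -> Rabs (G x) <= M * Rpower (sqrt eps + x) (mu + 1)) ->
  Rabs (w (k * sqrt eps)) <= M' * Rpower (sqrt eps + k * sqrt eps) mu ->
  forall x, k * sqrt eps <= x <= 1 -> Rabs (w x) <= (M' + 4 * M / b0) * Rpower (sqrt eps + x) mu.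
Proof.
  intros He Hk Hkb Hb0 Hmu HM HM' Hk1 Ca Hab Dw Heq HG Hw0.
  assert (Hs : 0 < sqrt eps) by now apply sqrt_lt_R0.
  assert (Es : sqrt eps * sqrt eps = eps) by (apply sqrt_sqrt; lra).
  set (s := sqrt eps) in *. set (D := M' + 4 * M / b0).
  assert (HMb : 0 <= 4 * M / b0) by (apply Rmult_le_pos; [lra|left; now apply Rinv_0_lt_compat]).
  assert (Main : forall e, e = 1 \/ e = -1 -> forall x, k * s <= x <= 1 ->
     0 <= D * Rpower (s + x) mu + e * w x).
  { intros e Hes.
    apply (first_order_comparison eps _ _ a _ (fun x => D * (mu * Rpower (s + x) (mu - 1)) + e * dw x)); auto.
    - intros x Hx. eapply is_derive_val. apply deriv_plus. apply deriv_mult. apply deriv_const.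
      apply (deriv_Rpower (fun x => s + x)). deriv. simpl. nra. apply deriv_mult. apply deriv_const. apply Dw.
      simpl; ring.
    - intros x Hx. assert (Hx01 : 0 <= x <= 1) by nra. assert (Hsx : s <= x) by nra.
      destruct (Hab x Hx01) as [Ea Hb]. specialize (Heq x Hx01). specialize (HG x Hx01).
      assert (Key : b0 / 4 * Rpower (s + x) (mu + 1) <=
         eps * (mu * Rpower (s + x) (mu - 1)) - a x * Rpower (s + x) mu).
      { rewrite Ea. set (P := Rpower (s + x) (mu - 1)).
        assert (HP : 0 < P) by apply Rpower_pos.
        assert (E0 : Rpower (s + x) mu = P * (s + x)).
        { unfold P. rewrite <- Rpower_add1 by lra. f_equal; ring. }
        rewrite Rpower_add1 by lra. rewrite E0.
        replace (eps * (mu * P) - - x * b x * (P * (s + x))) with (P * (eps * mu + x * b x * (s + x))) by ring.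
        replace (b0 / 4 * (P * (s + x) * (s + x))) with (P * (b0 / 4 * ((s + x) * (s + x)))) by ring.
        apply Rmult_le_compat_l. lra.
        assert (12 * (s * s) <= b0 * ((s + x) * (s + x))).
        { apply Rle_trans with (b0 * ((1 + k) ^ 2 * (s * s))).
          - replace (12 * (s * s)) with (b0 * (12 / b0 * (s * s))) by (field; lra).
            apply Rmult_le_compat_l. lra. apply Rmult_le_compat_r; nra.
          - apply Rmult_le_compat_l. lra.
            replace ((1 + k) ^ 2 * (s * s)) with (((1 + k) * s) * ((1 + k) * s)) by ring.
            apply Rmult_le_compat; nra. }
        assert (b0 / 2 * ((s + x) * (s + x)) <= x * b x * (s + x)).
        { replace (b0 / 2 * ((s + x) * (s + x))) with ((s + x) / 2 * b0 * (s + x)) by field.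
          apply Rmult_le_compat_r. lra. apply Rmult_le_compat; lra. }
        assert (- (3 * (s * s)) <= eps * mu) by (rewrite <- Es; nra). lra. }
      replace (eps * (D * (mu * Rpower (s + x) (mu - 1)) + e * dw x) - a x * (D * Rpower (s + x) mu + e * w x))
       with (D * (eps * (mu * Rpower (s + x) (mu - 1)) - a x * Rpower (s + x) mu) + e * G x)
       by (replace (G x) with (eps * dw x - a x * w x) by lra; ring).
      assert (M * Rpower (s + x) (mu + 1) <= D * (b0 / 4 * Rpower (s + x) (mu + 1))).
      { rewrite <- Rmult_assoc. apply Rmult_le_compat_r. left; apply Rpower_pos.
        unfold D. replace ((M' + 4 * M / b0) * (b0 / 4)) with (M' * (b0 / 4) + M) by (field; lra). nra. }
      assert (D * (b0 / 4 * Rpower (s + x) (mu + 1)) <=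
        D * (eps * (mu * Rpower (s + x) (mu - 1)) - a x * Rpower (s + x) mu)).
      { apply Rmult_le_compat_l. unfold D; lra. auto. }
      apply Rabs_le_between in HG. destruct Hes; subst e; lra.
    - assert (Hq : M' * Rpower (s + k * s) mu <= D * Rpower (s + k * s) mu).
      { apply Rmult_le_compat_r. left; apply Rpower_pos. unfold D; lra. }
      apply Rabs_le_between in Hw0. destruct Hes; subst e; lra. }
  intros x Hx. pose proof (Main 1 (or_introl eq_refl) x Hx).
  pose proof (Main (-1) (or_intror eq_refl) x Hx). apply Rabs_le. lra.
Qed.

Section Data.
Context {a a1 a2 c c1 c2 f f1 f2 b : R -> R} {gamma : R}.
Context (D : regular_data a a1 a2 c c1 c2 f f1 f2 b gamma).

(** A bound for |x| <= k sqrt eps supplies the starting values for [outer_bound] on both sides. On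
    the left the reflection x -> -x turns a into -a(-x) = -x b(-x), which has the required form. *)
Lemma propagate (eps k mu b0 M : R) (w dw G : R -> R) :
  0 < eps -> 1 <= k -> 12 / b0 <= (1 + k) ^ 2 -> 0 < b0 -> -3 <= mu -> 0 <= M ->
  (forall x, cI x -> b0 <= b x) ->
  (forall x, is_derive w x (dw x)) ->
  (forall x, cI x -> eps * dw x = a x * w x + G x) ->
  (forall x, cI x -> Rabs (G x) <= M * Rpower (sqrt eps + Rabs x) (mu + 1)) ->
  (forall x, cI x -> Rabs x <= k * sqrt eps -> Rabs (w x) <= M * Rpower (sqrt eps + Rabs x) mu) ->
  forall x, cI x -> Rabs (w x) <= (M + 4 * M / b0) * Rpower (sqrt eps + Rabs x) mu.
Proof.
  intros He Hk Hkb Hb0 Hmu HM Hb Dw Heq HG Hin x Hx.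
  assert (HMb : 0 <= 4 * M / b0) by (apply Rmult_le_pos; [lra|left; now apply Rinv_0_lt_compat]).
  destruct (Rle_dec (Rabs x) (k * sqrt eps)) as [H|H].
  { eapply Rle_trans. now apply Hin. apply Rmult_le_compat_r. left; apply Rpower_pos. lra. }
  assert (Hs : 0 < sqrt eps) by now apply sqrt_lt_R0.
  pose proof (rd_a D) as Da. pose proof (rd_ab D) as Hab.
  assert (Hks : 0 <= k * sqrt eps) by nra. destruct Hx as [Hx1 Hx2].
  destruct (Rle_dec 0 x) as [Hx0|Hx0].
  - rewrite (Rabs_pos_eq x) in * by lra.
    apply (outer_bound eps k mu b0 M M a b w dw G); auto; try lra.
    + intros y. cont.
    + intros y Hy. split; [apply Hab|apply Hb]; unfold cI; lra.
    + intros y Hy; apply Heq; unfold cI; lra.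
    + intros y Hy. rewrite <- (Rabs_pos_eq y) at 2 by lra. apply HG; unfold cI; lra.
    + rewrite <- (Rabs_pos_eq (k * sqrt eps)) at 2 by lra. apply Hin. unfold cI; lra.
      rewrite Rabs_pos_eq; lra.
  - rewrite (Rabs_left1 x) in * by lra.
    replace (w x) with (w (- - x)) by (f_equal; ring).
    apply (outer_bound eps k mu b0 M M (fun y => - a (- y)) (fun y => b (- y)) (fun y => w (- y))
             (fun y => - dw (- y)) (fun y => - G (- y))); auto; try lra.
    + intros y. apply cont_opp. eapply is_derive_continuous. apply (deriv_comp a Ropp).
      apply Da. apply (deriv_opp (fun y => y)), deriv_id.
    + intros y Hy. split; [|apply Hb; unfold cI; lra]. rewrite Hab by (unfold cI; lra). ring.
    + intros y. eapply is_derive_val. apply (deriv_comp w Ropp). apply Dw. apply (deriv_opp (fun y => y)), deriv_id. simpl; ring.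
    + intros y Hy. specialize (Heq (- y) ltac:(unfold cI; lra)). lra.
    + intros y Hy. rewrite Rabs_Ropp. rewrite <- (Rabs_pos_eq y) at 2 by lra. rewrite <- (Rabs_Ropp y).
      apply HG; unfold cI; lra.
    + rewrite <- (Rabs_pos_eq (k * sqrt eps)) at 2 by lra. rewrite <- (Rabs_Ropp (k * sqrt eps)).
      apply Hin. unfold cI; lra. rewrite Rabs_Ropp, Rabs_pos_eq; lra.
Qed.

(** For |x| <= k sqrt eps one has r^2 <= (1 + k)^2 eps, so solving the equation for the derivative
    and dividing by eps costs exactly two powers of r. *)
Lemma inner_step (eps k mu b1 M x : R) (w dw G : R -> R) :
  0 < eps -> 1 <= k -> 0 <= M -> cI x -> 0 <= b x <= b1 ->
  eps * dw x = a x * w x + G x ->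
  Rabs (G x) <= M * Rpower (sqrt eps + Rabs x) (mu + 1) ->
  Rabs (w x) <= M * Rpower (sqrt eps + Rabs x) mu ->
  Rabs x <= k * sqrt eps ->
  Rabs (dw x) <= (1 + k) ^ 2 * (1 + b1) * M * Rpower (sqrt eps + Rabs x) (mu - 1).
Proof.
  intros He Hk HM Hx Hb Heq HG Hw Hxk.
  pose proof (rd_ab D x Hx) as Ea.
  assert (Hs : 0 < sqrt eps) by now apply sqrt_lt_R0.
  assert (Es : sqrt eps * sqrt eps = eps) by (apply sqrt_sqrt; lra).
  pose proof (Rabs_pos x) as Hax. set (s := sqrt eps) in *. set (r := s + Rabs x) in *.
  assert (Hr : 0 < r) by (unfold r; lra).
  set (P := Rpower r (mu - 1)) in *. assert (HP : 0 < P) by apply Rpower_pos.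
  assert (E0 : Rpower r mu = P * r).
  { unfold P. rewrite <- Rpower_add1 by lra. f_equal; ring. }
  rewrite Rpower_add1 in HG by lra. rewrite E0 in HG, Hw.
  assert (H : eps * Rabs (dw x) <= (1 + b1) * M * P * (r * r)).
  { rewrite <- (Rabs_pos_eq eps) by lra. rewrite <- Rabs_mult, Heq, Ea.
    eapply Rle_trans. apply Rabs_triang. rewrite !Rabs_mult, Rabs_Ropp, (Rabs_pos_eq (b x)) by lra.
    assert (Rabs x * b x * Rabs (w x) <= r * b1 * (M * (P * r))).
    { apply Rmult_le_compat; auto. apply Rmult_le_pos; lra. apply Rabs_pos.
      apply Rmult_le_compat; try lra. unfold r; lra. }
    lra. }
  assert (Hrr : r * r <= (1 + k) ^ 2 * eps).
  { rewrite <- Es. replace ((1 + k) ^ 2 * (s * s)) with (((1 + k) * s) * ((1 + k) * s)) by ring.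
    unfold r. apply Rmult_le_compat; nra. }
  apply Rmult_le_reg_l with eps; auto. eapply Rle_trans. exact H.
  replace (eps * ((1 + k) ^ 2 * (1 + b1) * M * P)) with ((1 + b1) * M * P * ((1 + k) ^ 2 * eps)) by ring.
  apply Rmult_le_compat_l; auto. repeat apply Rmult_le_pos; lra.
Qed.

(* In the inner region the mean value theorem provides a point where the derivative
   has the right size; the integrating factor stays between 1 and a constant there. *)
Lemma inner_first_derivative (eps k la b1 M : R) (v v1 v2 G : R -> R) :
  0 < eps <= 1 -> 1 <= k -> 0 <= la <= 2 -> 0 <= M -> (forall x, cI x -> 0 <= b x <= b1) ->
  (forall x, is_derive v x (v1 x)) -> (forall x, is_derive v1 x (v2 x)) ->
  (forall x, cI x -> eps * v2 x = a x * v1 x + G x) ->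
  (forall x, cI x -> Rabs (G x) <= M * Rpower (sqrt eps + Rabs x) la) ->
  (forall x, cI x -> Rabs (v x) <= M * Rpower (sqrt eps + Rabs x) la) ->
  forall x, cI x -> Rabs x <= k * sqrt eps ->
    Rabs (v1 x) <= (2 + 2 * k) * exp (b1 * k ^ 2) * (1 + k) ^ 6 * M * Rpower (sqrt eps + Rabs x) (la - 1).
Proof.
  intros He Hk Hla HM Hb Dv Dv1 Heq HG Hv.
  pose proof (rd_ab D) as Ea. pose proof (rd_a D) as Da.
  assert (Hs : 0 < sqrt eps) by now apply sqrt_lt_R0.
  assert (Es : sqrt eps * sqrt eps = eps) by (apply sqrt_sqrt; lra).
  assert (Hs1 : sqrt eps <= 1) by (rewrite <- sqrt_1; apply sqrt_le_1; lra).
  set (s := sqrt eps) in *. set (Q := (1 + k) ^ 3).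
  assert (HQ : 1 <= Q) by (apply pow_R1_Rle; lra).
  assert (Cmp : forall x, Rabs x <= k * s -> forall mu, -3 <= mu <= 3 ->
    Rpower (s + Rabs x) mu <= Q * Rpower s mu /\ Rpower s mu <= Q * Rpower (s + Rabs x) mu).
  { intros x Hx mu Hmu. apply Rpower_comparable; auto; pose proof (Rabs_pos x); nra. }
  (* Long enough (rho >= sqrt eps) for the mean value of v' to be O(r^la / sqrt eps), and still
     inside [-1,1]. *)
  set (rho := Rmin (k * s) 1).
  assert (Hrho : s <= rho) by (unfold rho; apply Rmin_glb; nra).
  assert (Hrho1 : rho <= k * s) by apply Rmin_l. assert (Hrho2 : rho <= 1) by apply Rmin_r.
  set (P := Rpower s la). assert (HP : 0 < P) by apply Rpower_pos.
  assert (Hin : forall y, - rho <= y <= rho -> Rabs (v y) <= M * Q * P /\ Rabs (G y) <= M * Q * P).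
  { intros y Hy. assert (Hyc : cI y) by (unfold cI; lra).
    assert (Hyk : Rabs y <= k * s) by (apply Rabs_le; lra).
    destruct (Cmp y Hyk la ltac:(lra)) as [H _].
    assert (M * Rpower (s + Rabs y) la <= M * Q * P) by (rewrite Rmult_assoc; apply Rmult_le_compat_l; auto).
    split; eapply Rle_trans; eauto. }
  intros x Hx Hxk.
  assert (Hxr : - rho <= x <= rho).
  { apply Rabs_le_between. unfold rho. apply Rmin_glb; auto. apply Rabs_le; auto. }
  destruct (MVT_closed v v1 0 rho) as [xi [Hxi Exi]]; auto. lra.
  assert (Cc : forall x, continuous a x) by (intros; cont).
  assert (DB := is_derive_RInt_cont a 0 Cc).
  set (B := fun y => 0 + RInt a 0 y) in *.
  assert (B0 : B 0 = 0) by (unfold B; rewrite RInt_self; ring).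
  set (EE := exp (b1 * k ^ 2)).
  (* B is the integral of a from 0, hence 0 <= -B <= b1 (k sqrt eps)^2, and division by eps leaves a
     constant. *)
  assert (HB : forall y, - rho <= y <= rho -> 1 <= exp (- (B y / eps)) <= EE).
  { intros y Hy. assert (HBy : 0 <= - B y <= b1 * (k * s * (k * s))).
    { assert (exists z, - rho <= z <= rho /\ B y = a z * y /\ 0 <= z * y) as [z [Hz [E Hzy]]].
      { destruct (Rle_dec 0 y).
        - destruct (MVT_closed B a 0 y) as [z [Hz E]]; auto. exists z. split; [|split]; [lra|lra|nra].
        - destruct (MVT_closed B a y 0) as [z [Hz E]]; auto; try lra. exists z. split; [|split]; [lra|lra|nra]. }
      assert (Hzc : cI z) by (unfold cI; lra).
      rewrite E, (Ea z Hzc). specialize (Hb z Hzc). replace (- (- z * b z * y)) with (b z * (z * y)) by ring.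
      assert (z * y <= k * s * (k * s)).
      { apply Rle_trans with (Rabs (z * y)). apply Rle_abs. rewrite Rabs_mult.
        apply Rmult_le_compat; try apply Rabs_pos; apply Rabs_le; lra. }
      split. nra. apply Rmult_le_compat; lra. }
    assert (HBe : 0 <= - (B y / eps) <= b1 * k ^ 2).
    { replace (- (B y / eps)) with (- B y * / eps) by (field; lra).
      assert (0 < / eps) by (apply Rinv_0_lt_compat; lra). split. nra.
      apply Rmult_le_reg_r with eps. lra.
      replace (- B y * / eps * eps) with (- B y) by (field; lra). rewrite <- Es. nra. }
    split. rewrite <- exp_0. apply exp_monotone; lra. apply exp_monotone; lra. }
  assert (HEE : 1 <= EE) by (destruct (HB 0 ltac:(lra)); lra).
  set (E := fun y => v1 y * exp (- (B y / eps))).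
  assert (DE : forall y, is_derive E y ((eps * v2 y - a y * v1 y) / eps * exp (- (B y / eps)))).
  { intros y. unfold E. eapply is_derive_val. apply deriv_mult. apply Dv1. apply deriv_exp, deriv_opp, deriv_div, DB.
    simpl. field. lra. }
  assert (Hxi1 : Rabs (v1 xi) <= 2 * (M * Q * P) / s).
  { destruct (Hin 0 ltac:(lra)) as [H0 _]. destruct (Hin rho ltac:(lra)) as [H1 _].
    assert (Rabs (v1 xi) * rho <= 2 * (M * Q * P)).
    { rewrite <- (Rabs_pos_eq rho) by lra. rewrite <- Rabs_mult.
      replace (v1 xi * rho) with (v rho - v 0) by lra.
      unfold Rminus. eapply Rle_trans. apply Rabs_triang. rewrite Rabs_Ropp. lra. }
    apply Rmult_le_reg_r with s; auto. unfold Rdiv. rewrite Rmult_assoc, Rinv_l, Rmult_1_r by lra.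
    pose proof (Rabs_pos (v1 xi)). nra. }
  assert (HEd : Rabs (E x - E xi) <= 2 * k * (M * Q * P) / s * EE).
  { assert (Gen : forall y z, - rho <= y <= rho -> - rho <= z <= rho -> y <= z ->
      Rabs (E z - E y) <= 2 * k * (M * Q * P) / s * EE).
    { intros y z Hy Hz Hyz. destruct (MVT_closed E _ y z Hyz (fun t _ => DE t)) as [t [Ht Et]].
      rewrite Et. assert (Htc : cI t) by (unfold cI; lra).
      rewrite (Heq t Htc). replace (a t * v1 t + G t - a t * v1 t) with (G t) by ring.
      unfold Rdiv at 1. rewrite !Rabs_mult.
      rewrite (Rabs_pos_eq (exp _)) by (left; apply exp_pos).
      rewrite (Rabs_pos_eq (/ eps)) by (left; apply Rinv_0_lt_compat; lra).
      rewrite (Rabs_pos_eq (z - y)) by lra.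
      destruct (Hin t ltac:(lra)) as [_ H1]. destruct (HB t ltac:(lra)) as [H2 H3].
      apply Rle_trans with (M * Q * P * / eps * EE * (2 * k * s)).
      2:{ rewrite <- Es. right. field. lra. }
      apply Rmult_le_compat; try lra.
      - apply Rmult_le_pos; [|lra]. apply Rmult_le_pos. apply Rabs_pos. left; apply Rinv_0_lt_compat; lra.
      - apply Rmult_le_compat; try lra.
        + apply Rmult_le_pos. apply Rabs_pos. left; apply Rinv_0_lt_compat; lra.
        + apply Rmult_le_compat_r; auto. left; apply Rinv_0_lt_compat; lra. }
    destruct (Rle_dec xi x). apply Gen; lra. rewrite Rabs_minus_sym. apply Gen; lra. }
  assert (HEx : Rabs (v1 x) <= Rabs (E x)).
  { unfold E. rewrite Rabs_mult, (Rabs_pos_eq (exp _)) by (left; apply exp_pos).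
    destruct (HB x ltac:(lra)). pose proof (Rabs_pos (v1 x)). nra. }
  assert (HExi : Rabs (E xi) <= 2 * (M * Q * P) / s * EE).
  { unfold E. rewrite Rabs_mult, (Rabs_pos_eq (exp _)) by (left; apply exp_pos).
    destruct (HB xi ltac:(lra)). apply Rmult_le_compat; auto. apply Rabs_pos. left; apply exp_pos. }
  assert (Tri : Rabs (E x) <= Rabs (E xi) + Rabs (E x - E xi)).
  { replace (E x) with (E xi + (E x - E xi)) at 1 by ring. apply Rabs_triang. }
  apply Rle_trans with ((2 + 2 * k) * EE * Q * M * (P / s)).
  - unfold Rdiv in *. lra.
  - replace (P / s) with (Rpower s (la - 1)) by (unfold P; now rewrite Rpower_sub1).
    destruct (Cmp x Hxk (la - 1) ltac:(lra)) as [_ H].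
    apply Rle_trans with ((2 + 2 * k) * EE * Q * M * (Q * Rpower (s + Rabs x) (la - 1))).
    + apply Rmult_le_compat_l; auto. repeat apply Rmult_le_pos; lra.
    + right. unfold Q. ring.
Qed.
End Data.

(** * Weighted bounds for the solution and its first three derivatives *)

Lemma MVT_zero (f df : R -> R) (x : R) :
  cI x -> (forall z, is_derive f z (df z)) ->
  exists z, cI z /\ Rabs z <= Rabs x /\ f x - f 0 = df z * x.
Proof.
  intros [H1 H2] Hd. destruct (Rle_dec 0 x).
  - destruct (MVT_closed f df 0 x) as [z [Hz E]]; auto. exists z.
    split; [unfold cI; lra|]. split. rewrite !Rabs_pos_eq; lra. lra.
  - destruct (MVT_closed f df x 0) as [z [Hz E]]; auto; try lra. exists z.
    split; [unfold cI; lra|]. split. rewrite !Rabs_left1; lra. lra.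
Qed.

Section Data.
Context {a a1 a2 c c1 c2 f f1 f2 b : R -> R} {gamma : R}.
Context (D : regular_data a a1 a2 c c1 c2 f f1 f2 b gamma).

Lemma data_bounds : exists K, 1 <= K /\ forall x, cI x ->
  Rabs (a1 x) <= K /\ Rabs (a2 x) <= K /\ Rabs (c x) <= K /\ Rabs (c1 x) <= K /\ Rabs (c2 x) <= K.
Proof.
  destruct D as [Da Da1 Ca2 Dc Dc1 Cc2 Df Df1 Cf2 Cb _ _ _ _ _ _].
  destruct (continuous_bounded a1 (-1) 1) as [M1 [H1 H1']]. lra. { intros; cont. }
  destruct (continuous_bounded a2 (-1) 1) as [M2 [H2 H2']]. lra. { intros; cont. }
  destruct (continuous_bounded c (-1) 1) as [M3 [H3 H3']]. lra. { intros; cont. }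
  destruct (continuous_bounded c1 (-1) 1) as [M4 [H4 H4']]. lra. { intros; cont. }
  destruct (continuous_bounded c2 (-1) 1) as [M5 [H5 H5']]. lra. { intros; cont. }
  exists (1 + M1 + M2 + M3 + M4 + M5). split. lra.
  intros x Hx. specialize (H1' x Hx). specialize (H2' x Hx). specialize (H3' x Hx).
  specialize (H4' x Hx). specialize (H5' x Hx). lra.
Qed.

(** The equation differentiated i - 1 times is a first-order equation for v^(i) whose source
    consists of lower derivatives and g^(i-1) and is O(r^(lambda-i+1)), as [propagate] requires.
    Inside, [inner_step] reads off v'' and v''' from the preceding equation; no such equation yields
    v', which needs [inner_first_derivative]. *)
Lemma derivative_bounds (lambda Mg Mv : R) (n : nat) :
  0 < lambda -> lambda * b 0 <= c 0 -> n = 1%nat \/ n = 2%nat ->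
  INR n - 1 < lambda < INR n -> 0 < Mg -> 0 < Mv ->
  exists M, 0 < M /\ forall eps v v1 v2 v3 v4 g g1 g2, 0 < eps <= 1 ->
    (forall x, is_derive v x (v1 x)) -> (forall x, is_derive v1 x (v2 x)) ->
    (forall x, is_derive v2 x (v3 x)) -> (forall x, is_derive v3 x (v4 x)) ->
    (forall x, cI x -> eps * v2 x = a x * v1 x + c x * v x - g x) ->
    (forall x, cI x ->
      eps * v3 x = a1 x * v1 x + a x * v2 x + c1 x * v x + c x * v1 x - g1 x) ->
    (forall x, cI x ->
      eps * v4 x = a2 x * v1 x + 2 * a1 x * v2 x + a x * v3 x
                   + c2 x * v x + 2 * c1 x * v1 x + c x * v2 x - g2 x) ->
    (forall x, cI x -> Rabs (g x) <= Mg * Rabs x ^ n) ->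
    (forall x, cI x -> Rabs (g1 x) <= Mg * Rabs x ^ (n - 1)) ->
    (forall x, cI x -> Rabs (g2 x) <= Mg) ->
    (forall x, cI x -> Rabs (v x) <= Mv) ->
    forall x, cI x ->
      Rabs (v x) <= M * Rpower (sqrt eps + Rabs x) lambda /\
      Rabs (v1 x) <= M * Rpower (sqrt eps + Rabs x) (lambda - 1) /\
      Rabs (v2 x) <= M * Rpower (sqrt eps + Rabs x) (lambda - 2) /\
      Rabs (v3 x) <= M * Rpower (sqrt eps + Rabs x) (lambda - 3).
Proof.
  intros Hl Hl0 Hn Hln HMg HMv.
  destruct (layer_bound D lambda Mg Mv n) as [M0 [HM0 L0]]; auto.
  destruct (b_bounds D) as [b0 [b1 [Hb0 [Hb01 Hb]]]].
  destruct data_bounds as [K [HK HKd]].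
  assert (Hn2 : INR n <= 2) by (destruct Hn; subst; simpl; lra).
  assert (Hn1 : 1 <= INR n) by (destruct Hn; subst; simpl; lra).
  (* Any k with (1 + k)^2 >= 12/b0 meets the threshold of [outer_bound]. *)
  set (k := 1 + 12 / b0). assert (Hkb : 0 < 12 / b0) by (apply Rdiv_lt_0_compat; lra).
  assert (Hk : 1 <= k) by (unfold k; lra).
  assert (Hk12 : 12 / b0 <= (1 + k) ^ 2) by (unfold k; nra).
  set (M1 := K * M0 + 16 * Mg + M0). assert (HM1 : 0 < M1) by (unfold M1; nra).
  set (M2 := (2 + 2 * k) * exp (b1 * k ^ 2) * (1 + k) ^ 6 * M1 + M1).
  assert (HM12 : M1 <= M2).
  { assert (0 <= (2 + 2 * k) * exp (b1 * k ^ 2) * (1 + k) ^ 6 * M1); [|unfold M2; lra].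
    repeat apply Rmult_le_pos; try (left; apply exp_pos); try apply pow_le; lra. }
  set (M3 := M2 + 4 * M2 / b0).
  assert (HM23 : M2 <= M3).
  { assert (0 <= 4 * M2 / b0); [|unfold M3; lra].
    apply Rmult_le_pos; [lra|left; now apply Rinv_0_lt_compat]. }
  set (M4 := 2 * K * M3 + 16 * K * M0 + 16 * Mg + M3).
  assert (HM4 : M3 <= M4) by (unfold M4; nra).
  set (M4' := (1 + k) ^ 2 * (1 + b1) * M3 + M4).
  assert (Gr : forall M, 0 <= M -> 0 <= (1 + k) ^ 2 * (1 + b1) * M).
  { intros M HM. repeat apply Rmult_le_pos; try lra; apply pow_le; lra. }
  assert (HM4' : M4 <= M4') by (pose proof (Gr M3 ltac:(lra)); unfold M4'; lra).
  set (M5 := M4' + 4 * M4' / b0).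
  assert (HM5 : M4' <= M5).
  { assert (0 <= 4 * M4' / b0); [|unfold M5; lra].
    apply Rmult_le_pos; [lra|left; now apply Rinv_0_lt_compat]. }
  set (M6 := 3 * K * M5 + 16 * (3 * K * M3) + 16 * K * M0 + 16 * Mg + M5).
  assert (HM6 : M5 <= M6) by (unfold M6; nra).
  set (M6' := (1 + k) ^ 2 * (1 + b1) * M6 + M6).
  assert (HM6' : M6 <= M6') by (pose proof (Gr M6 ltac:(lra)); unfold M6'; lra).
  set (M7 := M6' + 4 * M6' / b0).
  assert (HM7 : M6' <= M7).
  { assert (0 <= 4 * M6' / b0); [|unfold M7; lra].
    apply Rmult_le_pos; [lra|left; now apply Rinv_0_lt_compat]. }
  (* The constants increase along the chain, so the last one serves all four orders. *)
  exists M7. split. lra.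
  intros eps v v1 v2 v3 v4 g g1 g2 He Dv Dv1 Dv2 Dv3 Eq0 Eq1 Eq2 Hg Hg1 Hg2 Hv.
  assert (V0 := L0 eps v v1 v2 g (proj1 He) Dv Dv1 Eq0 Hg Hv).
  assert (Hs : 0 < sqrt eps) by (apply sqrt_lt_R0; lra).
  assert (Hs1 : sqrt eps <= 1) by (rewrite <- sqrt_1; apply sqrt_le_1; lra).
  assert (Hr : forall x, cI x -> 0 < sqrt eps + Rabs x <= 2).
  { intros x Hx. pose proof (Rabs_pos x). assert (Rabs x <= 1) by now apply Rabs_le. lra. }
  assert (Hlow : forall x m1 m2, cI x -> m2 <= m1 <= m2 + 4 ->
    Rpower (sqrt eps + Rabs x) m1 <= 16 * Rpower (sqrt eps + Rabs x) m2).
  { intros; apply Rpower_lower_exponent; auto. }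
  assert (Hpn : forall x m mu, cI x -> mu <= INR m <= mu + 4 ->
    Rabs x ^ m <= 16 * Rpower (sqrt eps + Rabs x) mu).
  { intros x m mu Hx Hm. eapply Rle_trans; [|apply Hlow; eauto].
    rewrite Rpower_pow by (apply Hr; auto). apply pow_incr. pose proof (Rabs_pos x). lra. }
  assert (En1 : INR (n - 1) = INR n - 1) by (destruct Hn; subst; simpl; ring).
  assert (Mul : forall x y A B, Rabs x <= A -> Rabs y <= B -> Rabs (x * y) <= A * B).
  { intros x y A B HA HB. rewrite Rabs_mult. apply Rmult_le_compat; auto; apply Rabs_pos. }
  assert (Tr : forall x y A B, Rabs x <= A -> Rabs y <= B -> Rabs (x + y) <= A + B).
  { intros x y A B HA HB. eapply Rle_trans. apply Rabs_triang. lra. }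
  assert (Tm : forall x y A B, Rabs x <= A -> Rabs y <= B -> Rabs (x - y) <= A + B).
  { intros x y A B HA HB. apply Tr; auto. now rewrite Rabs_Ropp. }
  assert (G0 : forall x, cI x -> Rabs (c x * v x - g x) <= M1 * Rpower (sqrt eps + Rabs x) lambda).
  { intros x Hx. destruct (HKd x Hx) as [_ [_ [Kc _]]].
    pose proof (Hpn x n lambda Hx ltac:(lra)) as Hp.
    eapply Rle_trans. apply Tm. apply Mul; [exact Kc|apply V0; auto]. apply Hg; auto.
    apply Rle_trans with (K * (M0 * Rpower (sqrt eps + Rabs x) lambda)
      + Mg * (16 * Rpower (sqrt eps + Rabs x) lambda)).
    apply Rplus_le_compat_l, Rmult_le_compat_l; lra.
    pose proof (Rpower_pos (sqrt eps + Rabs x) lambda). unfold M1. nra. }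
  assert (V1i : forall x, cI x -> Rabs x <= k * sqrt eps ->
     Rabs (v1 x) <= M2 * Rpower (sqrt eps + Rabs x) (lambda - 1)).
  { intros x Hx Hxk. eapply Rle_trans.
    apply (inner_first_derivative D eps k lambda b1 M1 v v1 v2 (fun x => c x * v x - g x)); auto; try lra.
    - intros y Hy; specialize (Hb y Hy); lra.
    - intros y Hy. rewrite Eq0; auto. ring.
    - intros y Hy. eapply Rle_trans. apply V0; auto. apply Rmult_le_compat_r.
      left; apply Rpower_pos. unfold M1. nra.
    - apply Rmult_le_compat_r. left; apply Rpower_pos. unfold M2; lra. }
  assert (V1 : forall x, cI x -> Rabs (v1 x) <= M3 * Rpower (sqrt eps + Rabs x) (lambda - 1)).
  { unfold M3. apply (propagate D eps k (lambda - 1) b0 M2 v1 v2 (fun x => c x * v x - g x)); auto; try lra.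
    - apply Hb.
    - intros y Hy. rewrite Eq0; auto. ring.
    - intros y Hy. replace (lambda - 1 + 1) with lambda by ring. eapply Rle_trans. apply G0; auto.
      apply Rmult_le_compat_r. left; apply Rpower_pos. lra. }
  assert (V2i : forall x, cI x -> Rabs x <= k * sqrt eps ->
     Rabs (v2 x) <= M4' * Rpower (sqrt eps + Rabs x) (lambda - 2)).
  { intros x Hx Hxk. eapply Rle_trans.
    apply (inner_step D eps k (lambda - 1) b1 M3 x v1 v2 (fun x => c x * v x - g x)); auto; try lra.
    - specialize (Hb x Hx); lra.
    - rewrite Eq0; auto. ring.
    - replace (lambda - 1 + 1) with lambda by ring. eapply Rle_trans. apply G0; auto.
      apply Rmult_le_compat_r. left; apply Rpower_pos. lra.
    - replace (lambda - 1 - 1) with (lambda - 2) by ring.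
      apply Rmult_le_compat_r. left; apply Rpower_pos. unfold M4'; lra. }
  assert (G1 : forall x, cI x -> Rabs (a1 x * v1 x + c1 x * v x + c x * v1 x - g1 x)
      <= M4 * Rpower (sqrt eps + Rabs x) (lambda - 1)).
  { intros x Hx. destruct (HKd x Hx) as [Ka1 [_ [Kc [Kc1 _]]]].
    pose proof (Hpn x (n - 1)%nat (lambda - 1) Hx ltac:(rewrite En1; lra)) as Hp.
    pose proof (Hlow x lambda (lambda - 1) Hx ltac:(lra)) as Hq.
    pose proof (Rpower_pos (sqrt eps + Rabs x) (lambda - 1)).
    eapply Rle_trans. apply Tm. apply Tr. apply Tr.
    apply Mul; [exact Ka1|apply V1; auto]. apply Mul; [exact Kc1|apply V0; auto].
    apply Mul; [exact Kc|apply V1; auto]. apply Hg1; auto.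
    assert (K * (M0 * Rpower (sqrt eps + Rabs x) lambda) <= K * (M0 * (16 * Rpower (sqrt eps + Rabs x) (lambda - 1)))).
    { apply Rmult_le_compat_l. lra. apply Rmult_le_compat_l; lra. }
    assert (Mg * Rabs x ^ (n - 1) <= Mg * (16 * Rpower (sqrt eps + Rabs x) (lambda - 1))).
    { apply Rmult_le_compat_l; lra. }
    assert (0 <= M3 * Rpower (sqrt eps + Rabs x) (lambda - 1)) by (apply Rmult_le_pos; lra).
    unfold M4. lra. }
  assert (V2 : forall x, cI x -> Rabs (v2 x) <= M5 * Rpower (sqrt eps + Rabs x) (lambda - 2)).
  { unfold M5. apply (propagate D eps k (lambda - 2) b0 M4' v2 v3
      (fun x => a1 x * v1 x + c1 x * v x + c x * v1 x - g1 x)); auto; try lra.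
    - apply Hb.
    - intros y Hy. rewrite Eq1; auto. ring.
    - intros y Hy. replace (lambda - 2 + 1) with (lambda - 1) by ring. eapply Rle_trans. apply G1; auto.
      apply Rmult_le_compat_r. left; apply Rpower_pos. lra. }
  assert (V3i : forall x, cI x -> Rabs x <= k * sqrt eps ->
     Rabs (v3 x) <= M6' * Rpower (sqrt eps + Rabs x) (lambda - 3)).
  { intros x Hx Hxk. eapply Rle_trans.
    apply (inner_step D eps k (lambda - 2) b1 M6 x v2 v3
      (fun x => a1 x * v1 x + c1 x * v x + c x * v1 x - g1 x)); auto; try lra.
    - specialize (Hb x Hx); lra.
    - rewrite Eq1; auto. ring.
    - replace (lambda - 2 + 1) with (lambda - 1) by ring. eapply Rle_trans. apply G1; auto.
      apply Rmult_le_compat_r. left; apply Rpower_pos. lra.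
    - eapply Rle_trans. apply V2; auto. apply Rmult_le_compat_r. left; apply Rpower_pos. lra.
    - replace (lambda - 2 - 1) with (lambda - 3) by ring.
      apply Rmult_le_compat_r. left; apply Rpower_pos. unfold M6'; lra. }
  assert (G2 : forall x, cI x -> Rabs (a2 x * v1 x + 2 * (a1 x * v2 x) + c2 x * v x
        + 2 * (c1 x * v1 x) + c x * v2 x - g2 x)
      <= M6 * Rpower (sqrt eps + Rabs x) (lambda - 2)).
  { intros x Hx. destruct (HKd x Hx) as [Ka1 [Ka2 [Kc [Kc1 Kc2]]]].
    pose proof (Hpn x 0%nat (lambda - 2) Hx ltac:(simpl; lra)) as Hp.
    pose proof (Hlow x lambda (lambda - 2) Hx ltac:(lra)) as Hq.
    pose proof (Hlow x (lambda - 1) (lambda - 2) Hx ltac:(lra)) as Hq1.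
    pose proof (Rpower_pos (sqrt eps + Rabs x) (lambda - 2)).
    assert (T2 : Rabs 2 <= 2) by (rewrite Rabs_pos_eq; lra).
    eapply Rle_trans. apply Tm. apply Tr. apply Tr. apply Tr. apply Tr.
    apply Mul; [exact Ka2|apply V1; auto]. apply Mul; [exact T2|]. apply Mul; [exact Ka1|apply V2; auto].
    apply Mul; [exact Kc2|apply V0; auto].
    apply Mul; [exact T2|]. apply Mul; [exact Kc1|apply V1; auto].
    apply Mul; [exact Kc|apply V2; auto]. apply Hg2; auto.
    assert (K * (M0 * Rpower (sqrt eps + Rabs x) lambda) <= K * (M0 * (16 * Rpower (sqrt eps + Rabs x) (lambda - 2)))).
    { apply Rmult_le_compat_l. lra. apply Rmult_le_compat_l; lra. }
    assert (K * (M3 * Rpower (sqrt eps + Rabs x) (lambda - 1)) <= K * (M3 * (16 * Rpower (sqrt eps + Rabs x) (lambda - 2)))).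
    { apply Rmult_le_compat_l. lra. apply Rmult_le_compat_l; lra. }
    assert (Mg * 1 <= Mg * (16 * Rpower (sqrt eps + Rabs x) (lambda - 2))).
    { apply Rmult_le_compat_l; simpl in Hp; lra. }
    assert (0 <= M5 * Rpower (sqrt eps + Rabs x) (lambda - 2)) by (apply Rmult_le_pos; lra).
    unfold M6. lra. }
  assert (V3 : forall x, cI x -> Rabs (v3 x) <= M7 * Rpower (sqrt eps + Rabs x) (lambda - 3)).
  { unfold M7. apply (propagate D eps k (lambda - 3) b0 M6' v3 v4
      (fun x => a2 x * v1 x + 2 * (a1 x * v2 x) + c2 x * v x + 2 * (c1 x * v1 x) + c x * v2 x - g2 x)); auto; try lra.
    - apply Hb.
    - intros y Hy. rewrite Eq2; auto. ring.
    - intros y Hy. replace (lambda - 3 + 1) with (lambda - 2) by ring. eapply Rle_trans. apply G2; auto.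
      apply Rmult_le_compat_r. left; apply Rpower_pos. lra. }
  intros x Hx. repeat split; auto.
  - eapply Rle_trans. apply V0; auto. apply Rmult_le_compat_r. left; apply Rpower_pos.
    assert (M0 <= M1) by (unfold M1; nra). lra.
  - eapply Rle_trans. apply V1; auto. apply Rmult_le_compat_r. left; apply Rpower_pos. lra.
  - eapply Rle_trans. apply V2; auto. apply Rmult_le_compat_r. left; apply Rpower_pos. lra.
Qed.

(* Subtracting the Taylor polynomial [q0 + q1 x] of the reduced solution makes the
   right-hand side vanish to order n > lambda at the turning point; for n = 2 this needs
   [c 0 <> b 0], which holds because lambda > 1. *)
Lemma flattening (lambda : R) (n : nat) :
  lambda * b 0 <= c 0 -> (n = 1%nat \/ n = 2%nat /\ 1 < lambda) ->
  exists q0 q1 Mg, 0 < Mg /\ forall x, cI x ->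
    Rabs (f x - (a x * q1 + c x * (q0 + q1 * x))) <= Mg * Rabs x ^ n /\
    Rabs (f1 x - (a1 x * q1 + c1 x * (q0 + q1 * x) + c x * q1)) <= Mg * Rabs x ^ (n - 1) /\
    Rabs (f2 x - (a2 x * q1 + c2 x * (q0 + q1 * x) + 2 * c1 x * q1)) <= Mg.
Proof.
  intros Hl0 Hn. pose proof (rd_a1_0 D) as E0.
  assert (Hc0 := rd_c0 D).
  assert (Hb0 : 0 < b 0) by (apply (rd_b_pos D); unfold cI; lra).
  assert (Ha0 : a 0 = 0) by (rewrite (rd_ab D) by (unfold cI; lra); ring).
  set (q0 := f 0 / c 0).
  assert (exists q1, n = 2%nat -> f1 0 - (a1 0 * q1 + c1 0 * q0 + c 0 * q1) = 0) as [q1 Hq1].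
  { destruct Hn as [Hn|[Hn Hl]]. exists 0; intros; lia.
    exists ((f1 0 - c1 0 * q0) / (c 0 - b 0)). intros _. rewrite E0. field. nra. }
  exists q0, q1.
  set (g := fun x => f x - (a x * q1 + c x * (q0 + q1 * x))).
  set (g1 := fun x => f1 x - (a1 x * q1 + c1 x * (q0 + q1 * x) + c x * q1)).
  set (g2 := fun x => f2 x - (a2 x * q1 + c2 x * (q0 + q1 * x) + 2 * c1 x * q1)).
  destruct D as [Da Da1 Ca2 Dc Dc1 Cc2 Df Df1 Cf2 _ _ _ _ _ _ _].
  assert (Dg : forall x, is_derive g x (g1 x)).
  { intros x. unfold g, g1. eapply is_derive_val. deriv. simpl. ring. }
  assert (Dg1 : forall x, is_derive g1 x (g2 x)).
  { intros x. unfold g1, g2. eapply is_derive_val. deriv. simpl. ring. }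
  destruct (continuous_bounded g1 (-1) 1) as [M1 [HM1 B1]]. lra. { intros; cont. }
  destruct (continuous_bounded g2 (-1) 1) as [M2 [HM2 B2]]. lra. { intros; unfold g2; cont. }
  assert (Eg : g 0 = 0).
  { unfold g. rewrite Ha0. unfold q0. field. lra. }
  exists (M1 + M2). split. lra. intros x Hx. pose proof (Rabs_pos x) as Hax.
  change (Rabs (g x) <= (M1 + M2) * Rabs x ^ n /\ Rabs (g1 x) <= (M1 + M2) * Rabs x ^ (n - 1) /\ Rabs (g2 x) <= M1 + M2).
  assert (Hg2 : Rabs (g2 x) <= M1 + M2) by (specialize (B2 x Hx); lra).
  destruct (MVT_zero g g1 x Hx Dg) as [z [Hz [Hzx Ez]]]. rewrite Eg, Rminus_0_r in Ez.
  destruct Hn as [->|[-> _]].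
  - simpl. split; [|split]; auto.
    + rewrite Ez, Rabs_mult, Rmult_1_r. apply Rmult_le_compat_r; auto. specialize (B1 z Hz). lra.
    + specialize (B1 x Hx). lra.
  - assert (Hg1 : forall y, cI y -> Rabs (g1 y) <= (M1 + M2) * Rabs y).
    { intros y Hy. destruct (MVT_zero g1 g2 y Hy Dg1) as [t [Ht [Hty Et]]].
      assert (E1 : g1 0 = 0).
      { unfold g1. replace (q0 + q1 * 0) with q0 by ring. apply Hq1; reflexivity. }
      rewrite E1, Rminus_0_r in Et. rewrite Et, Rabs_mult.
      apply Rmult_le_compat_r. apply Rabs_pos. specialize (B2 t Ht). lra. }
    simpl. split; [|split]; auto.
    + rewrite Ez, Rabs_mult, Rmult_1_r, <- Rmult_assoc. apply Rmult_le_compat_r; auto.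
      eapply Rle_trans. apply Hg1; auto. apply Rmult_le_compat_l; lra.
    + rewrite Rmult_1_r. auto.
Qed.

(** The bounds in powers of r = sqrt eps + |x| are traded for the weights consumed on the cells:
    integer powers of |x|, for points away from the turning point, and the power eps^(1 - lambda/2),
    for the innermost interval. The subtracted polynomial affects only u and u'. *)
Lemma a_priori_bounds (lambda : R) :
  0 < lambda < 2 -> lambda * b 0 <= c 0 -> (lambda = 1 -> b 0 < c 0) ->
  exists M, 1 <= M /\ forall eps u u1 u2 u3 u4, 0 < eps <= 1 ->
    regular_solution eps a a1 a2 c c1 c2 f f1 f2 u u1 u2 u3 u4 ->
    forall x, cI x ->
      Rabs (u x) <= M /\ Rabs x * Rabs (u1 x) <= M /\
      Rabs x ^ 2 * Rabs (u2 x) <= M /\ sqrt eps * Rabs x * Rabs (u2 x) <= M /\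
      Rabs x ^ 3 * Rabs (u3 x) <= M /\
      Rpower eps (1 - lambda / 2) * Rabs (u2 x) <= M /\
      Rpower eps (1 - lambda / 2) * (Rabs x * Rabs (u3 x)) <= M.
Proof.
  intros Hl Hl0 Hl1.
  assert (Hb0 : 0 < b 0) by (apply (rd_b_pos D); unfold cI; lra).
  (* The exponent must avoid the integer 1. For lambda = 1, b(0) < c(0) leaves room above 1; the cap
     3/2 keeps it below 2. *)
  assert (exists l, lambda <= l < 2 /\ l <> 1 /\ l * b 0 <= c 0) as [l [Hll [Hln1 Hlb]]].
  { destruct (Req_dec lambda 1) as [E|E].
    - specialize (Hl1 E). exists (Rmin (c 0 / b 0) (3 / 2)).
      assert (1 < c 0 / b 0).
      { apply Rmult_lt_reg_r with (b 0); auto. unfold Rdiv. rewrite Rmult_assoc, Rinv_l; lra. }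
      pose proof (Rmin_l (c 0 / b 0) (3/2)) as R1. pose proof (Rmin_r (c 0 / b 0) (3/2)).
      assert (1 < Rmin (c 0 / b 0) (3 / 2)) by (apply Rmin_glb_lt; lra).
      repeat split; try lra.
      apply Rmult_le_compat_r with (r := b 0) in R1; [|lra].
      replace (c 0 / b 0 * b 0) with (c 0) in R1 by (field; lra). auto.
    - exists lambda. repeat split; auto; lra. }
  assert (exists n, (n = 1%nat \/ n = 2%nat) /\ INR n - 1 < l < INR n /\
     (n = 1%nat \/ n = 2%nat /\ 1 < l)) as [n [Hn [Hnl Hn']]].
  { destruct (Rle_dec l 1).
    - exists 1%nat. simpl. repeat split; auto; lra.
    - exists 2%nat. simpl. split; [auto|split;[lra|right; split; auto; lra]]. }
  destruct (flattening l n Hlb Hn') as [q0 [q1 [Mg [HMg Hg]]]].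
  destruct (solution_bounded D) as [Mu [HMu Hu]].
  set (Mv := Mu + Rabs q0 + Rabs q1).
  pose proof (Rabs_pos q0) as Hq0. pose proof (Rabs_pos q1) as Hq1.
  destruct (derivative_bounds l Mg Mv n) as [M [HM HB]]; auto; try lra. unfold Mv; lra.
  exists (1 + Mu + Rabs q1 + 16 * M). split. lra.
  intros eps u u1 u2 u3 u4 He S x Hx.
  pose proof (Hu eps u u1 u2 u3 u4 (proj1 He) S) as Bu.
  destruct S as [Du Du1 Du2 Du3 _ _ E0 E1 E2].
  destruct (HB eps (fun x => u x - (q0 + q1 * x)) (fun x => u1 x - q1) u2 u3 u4
     (fun x => f x - (a x * q1 + c x * (q0 + q1 * x)))
     (fun x => f1 x - (a1 x * q1 + c1 x * (q0 + q1 * x) + c x * q1))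
     (fun x => f2 x - (a2 x * q1 + c2 x * (q0 + q1 * x) + 2 * c1 x * q1)) He) with (x := x)
    as [V0 [V1 [V2 V3]]]; auto; try (intros y Hy; now apply Hg).
  { intros y. eapply is_derive_val. deriv. simpl; ring. }
  { intros y. eapply is_derive_val. deriv. simpl; ring. }
  { intros y Hy. cbv beta; rewrite E0 by auto; ring. }
  { intros y Hy. cbv beta; rewrite E1 by auto; ring. }
  { intros y Hy. cbv beta; rewrite E2 by auto; ring. }
  { intros y Hy. unfold Mv, Rminus. eapply Rle_trans. apply Rabs_triang.
    rewrite Rabs_Ropp. specialize (Bu y Hy).
    assert (Rabs (q0 + q1 * y) <= Rabs q0 + Rabs q1); [|lra].
    eapply Rle_trans. apply Rabs_triang. rewrite Rabs_mult.
    assert (Rabs y <= 1) by now apply Rabs_le. nra. }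
  assert (Hs : 0 < sqrt eps) by (apply sqrt_lt_R0; lra).
  assert (Es : sqrt eps * sqrt eps = eps) by (apply sqrt_sqrt; lra).
  assert (Hs1 : sqrt eps <= 1) by (rewrite <- sqrt_1; apply sqrt_le_1; lra).
  assert (Hx1 : Rabs x <= 1) by now apply Rabs_le. pose proof (Rabs_pos x) as Hx0.
  assert (Eom : Rpower eps (1 - lambda / 2) = Rpower (sqrt eps) (2 - lambda)).
  { rewrite <- Es at 1. rewrite <- Rpower_mult_distr, <- Rpower_plus by auto. f_equal. field. }
  set (s := sqrt eps) in *. set (r := s + Rabs x) in *.
  assert (Hr : 0 < r <= 2) by (unfold r; lra).
  assert (Hrl : Rpower r l <= 16).
  { pose proof (Rpower_lower_exponent r l 0 Hr ltac:(lra)) as H. rewrite Rpower_O in H; lra. }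
  assert (F1 : Rpower r l = Rpower r (l - 1) * r) by (rewrite <- Rpower_add1 by lra; f_equal; ring).
  assert (F2 : Rpower r (l - 1) = Rpower r (l - 2) * r) by (rewrite <- Rpower_add1 by lra; f_equal; ring).
  assert (F3 : Rpower r (l - 2) = Rpower r (l - 3) * r) by (rewrite <- Rpower_add1 by lra; f_equal; ring).
  assert (P2 := Rpower_pos r (l - 2)). assert (P3 := Rpower_pos r (l - 3)). assert (P1 := Rpower_pos r (l - 1)).
  (* eps^(1 - lambda/2) = (sqrt eps)^(2 - lambda), and sqrt eps <= r, l >= lambda leave (sqrt
     eps)^(l - lambda) <= 1. *)
  assert (Hom : Rpower eps (1 - lambda / 2) * Rpower r (l - 2) <= 1).
  { rewrite Eom. apply Rle_trans with (Rpower s (2 - lambda) * Rpower s (l - 2)).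
    - apply Rmult_le_compat_l. left; apply Rpower_pos. apply Rpower_antitone. lra. unfold r; lra.
    - rewrite <- Rpower_plus. replace (2 - lambda + (l - 2)) with (l - lambda) by ring.
      apply Rle_trans with (Rpower 1 (l - lambda)). apply Rle_Rpower_l; lra.
      right. unfold Rpower. rewrite ln_1, Rmult_0_r. apply exp_0. }
  pose proof (Rpower_pos eps (1 - lambda / 2)) as Hom0.
  pose proof (Rabs_pos (u2 x)) as A2. pose proof (Rabs_pos (u3 x)) as A3.
  assert (Hx2 : Rabs x <= r) by (unfold r; lra). assert (Hsr : s <= r) by (unfold r; lra).
  assert (MR : M * Rpower r l <= 16 * M) by (rewrite (Rmult_comm 16); apply Rmult_le_compat_l; lra).
  assert (W2 : r * r * Rabs (u2 x) <= 16 * M).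
  { apply Rle_trans with (r * r * (M * Rpower r (l - 2))). apply Rmult_le_compat_l; nra.
    eapply Rle_trans; [|exact MR]. right. rewrite F1, F2. ring. }
  split; [|split; [|split; [|split; [|split; [|split]]]]].
  - specialize (Bu x Hx). lra.
  - assert (Rabs (u1 x) <= Rabs (u1 x - q1) + Rabs q1).
    { replace (u1 x) with (u1 x - q1 + q1) at 1 by ring. apply Rabs_triang. }
    apply Rle_trans with (r * (M * Rpower r (l - 1)) + 1 * Rabs q1).
    + apply Rle_trans with (Rabs x * Rabs (u1 x - q1) + Rabs x * Rabs q1). nra.
      apply Rplus_le_compat. apply Rmult_le_compat; auto. apply Rabs_pos. apply Rmult_le_compat_r; lra.
    + replace (r * (M * Rpower r (l - 1))) with (M * Rpower r l) by (rewrite F1; ring). lra.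
  - apply Rle_trans with (r * r * Rabs (u2 x)); [|lra]. apply Rmult_le_compat_r; auto. nra.
  - apply Rle_trans with (r * r * Rabs (u2 x)); [|lra]. apply Rmult_le_compat_r; auto. nra.
  - apply Rle_trans with (r ^ 3 * (M * Rpower r (l - 3))).
    + apply Rmult_le_compat; auto. apply pow_le; auto. apply pow_incr; lra.
    + replace (r ^ 3 * (M * Rpower r (l - 3))) with (M * Rpower r l) by (rewrite F1, F2, F3; ring). lra.
  - apply Rle_trans with (Rpower eps (1 - lambda / 2) * (M * Rpower r (l - 2))).
    apply Rmult_le_compat_l; lra. nra.
  - apply Rle_trans with (Rpower eps (1 - lambda / 2) * (r * (M * Rpower r (l - 3)))).
    apply Rmult_le_compat_l. lra. apply Rmult_le_compat; auto.
    replace (r * (M * Rpower r (l - 3))) with (M * Rpower r (l - 2)) by (rewrite F3; ring). nra.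
Qed.
End Data.

(** * Estimates on a single cell *)

Ltac real_eq := match goal with |- @eq _ ?x ?y => change (@eq R x y) end.

Lemma ex_RInt_cont (g : R -> R) (l r : R) : (forall x, continuous g x) -> ex_RInt g l r.
Proof. intros H. exists (RInt g l r). now apply RInt_cont_correct. Qed.

Lemma RInt_FTC (f df : R -> R) (l r : R) :
  (forall x, is_derive f x (df x)) -> (forall x, continuous df x) -> RInt df l r = f r - f l.
Proof.
  intros Hd Hc. apply is_RInt_unique. apply (is_RInt_derive f df l r); auto.
Qed.

Lemma RInt_add (f g : R -> R) (l r : R) :
  (forall x, continuous f x) -> (forall x, continuous g x) ->
  RInt (fun y => f y + g y) l r = RInt f l r + RInt g l r.
Proof. intros Hf Hg. apply (RInt_plus f g); now apply ex_RInt_cont. Qed.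

Lemma RInt_sub (f g : R -> R) (l r : R) :
  (forall x, continuous f x) -> (forall x, continuous g x) ->
  RInt (fun y => f y - g y) l r = RInt f l r - RInt g l r.
Proof. intros Hf Hg. apply (RInt_minus f g); now apply ex_RInt_cont. Qed.

Lemma RInt_mul (k : R) (f : R -> R) (l r : R) :
  (forall x, continuous f x) -> RInt (fun y => k * f y) l r = k * RInt f l r.
Proof. intros Hf. apply (RInt_scal f l r k); now apply ex_RInt_cont. Qed.

Lemma RInt_cst (k l r : R) : RInt (fun _ => k) l r = k * (r - l).
Proof. rewrite RInt_const. unfold scal; simpl; unfold mult; simpl. ring. Qed.

Lemma RInt_bound (g : R -> R) (l r B : R) :
  l <= r -> (forall x, continuous g x) -> (forall x, l <= x <= r -> Rabs (g x) <= B) ->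
  Rabs (RInt g l r) <= (r - l) * B.
Proof. intros Hlr Hc H. apply abs_RInt_le_const; auto. now apply ex_RInt_cont. Qed.

Lemma RInt_mono (f g : R -> R) (l r : R) :
  l <= r -> (forall x, continuous f x) -> (forall x, continuous g x) ->
  (forall x, l < x < r -> f x <= g x) -> RInt f l r <= RInt g l r.
Proof. intros; apply RInt_le; auto; now apply ex_RInt_cont. Qed.

(** [X] is the root mean square on the cell. With A the midpoint value, X^2 = A^2 + (q h)^2 / 12;
    thus |q h| <= 4 X, and values are at most |A| + |q h|/2 <= 3 X. *)
Lemma affine_size (l r p q : R) : l < r ->
  exists X, 0 <= X /\ (r - l) * X ^ 2 = RInt (fun y => (p + q * y) ^ 2) l r /\
    Rabs q * (r - l) <= 4 * X /\ forall y, l <= y <= r -> Rabs (p + q * y) <= 3 * X.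
Proof.
  intros Hlr. set (h := r - l). set (A := p + q * ((l + r) / 2)).
  assert (E : RInt (fun y => (p + q * y) ^ 2) l r = h * (A ^ 2 + (q * h) ^ 2 / 12)).
  { rewrite (RInt_FTC (fun y => y * (p * p) + y * y * (p * q) + y * y * y * (q * q / 3)) _ l r).
    - real_eq. unfold A, h. field.
    - intros x. eapply is_derive_val. deriv. simpl. field.
    - intros x. cont. }
  set (S := A ^ 2 + (q * h) ^ 2 / 12). pose proof (pow2_ge_0 A) as HA. pose proof (pow2_ge_0 (q * h)) as Hq.
  assert (HS : 0 <= S) by (unfold S; lra).
  assert (Eq : Rabs q * h = Rabs (q * h)) by (rewrite Rabs_mult, (Rabs_pos_eq h); unfold h; lra).
  exists (sqrt S). assert (Es : sqrt S ^ 2 = S) by (simpl; rewrite Rmult_1_r; now apply sqrt_sqrt).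
  pose proof (sqrt_pos S) as Hs.
  assert (B1 : Rabs A <= sqrt S).
  { rewrite <- (Rabs_pos_eq (sqrt S)) by auto. apply Rsqr_le_abs_0. unfold Rsqr. unfold S in Es at 2. nra. }
  assert (B2 : Rabs (q * h) <= 4 * sqrt S).
  { rewrite <- (Rabs_pos_eq (4 * sqrt S)) by lra. apply Rsqr_le_abs_0. unfold Rsqr. unfold S in Es at 2. nra. }
  split; [auto|split; [rewrite Es, E; reflexivity|split; [lra|]]].
  intros y Hy. replace (p + q * y) with (A + q * (y - (l + r) / 2)) by (unfold A; ring).
  eapply Rle_trans. apply Rabs_triang. rewrite Rabs_mult.
  assert (Rabs (y - (l + r) / 2) <= h / 2) by (apply Rabs_le; unfold h; lra).
  pose proof (Rabs_pos q). nra.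
Qed.

(** The slope Q is a value of u' in the cell; integrating the derivative bound from the node l gives
    the other estimate. *)
Lemma interpolation_bound (u u1 u2 : R -> R) (l r P Q M2 : R) :
  l < r -> (forall x, is_derive u x (u1 x)) -> (forall x, is_derive u1 x (u2 x)) ->
  P + Q * l = u l -> P + Q * r = u r -> (forall y, l <= y <= r -> Rabs (u2 y) <= M2) ->
  forall y, l <= y <= r ->
    Rabs (P + Q * y - u y) <= (r - l) ^ 2 * M2 /\ Rabs (Q - u1 y) <= (r - l) * M2.
Proof.
  intros Hlr Du Du1 Hl Hr HM y Hy.
  assert (D1 : forall t, l <= t <= r -> Rabs (Q - u1 t) <= (r - l) * M2).
  { destruct (MVT_closed u u1 l r) as [z [Hz Ez]]; auto; try lra.
    assert (EQ : Q = u1 z).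
    { apply Rmult_eq_reg_r with (r - l); lra. }
    assert (Gen : forall s t, l <= s <= r -> l <= t <= r -> s <= t -> Rabs (u1 t - u1 s) <= (r - l) * M2).
    { intros s t Hs Ht Hst. destruct (MVT_closed u1 u2 s t) as [w [Hw Ew]]; auto.
      rewrite Ew, Rabs_mult, (Rabs_pos_eq (t - s)) by lra. specialize (HM w ltac:(lra)).
      pose proof (Rabs_pos (u2 w)). rewrite Rmult_comm. apply Rmult_le_compat; lra. }
    intros t Ht. rewrite EQ. destruct (Rle_dec z t).
    rewrite Rabs_minus_sym. apply Gen; lra. apply Gen; lra. }
  split; auto.
  destruct (MVT_closed (fun t => P + Q * t - u t) (fun t => Q - u1 t) l y) as [w [Hw Ew]]. lra.
  { intros t Ht. eapply is_derive_val. deriv. simpl; ring. }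
  replace (P + Q * y - u y) with ((Q - u1 w) * (y - l)) by lra.
  rewrite Rabs_mult, (Rabs_pos_eq (y - l)) by lra. specialize (D1 w ltac:(lra)).
  replace ((r - l) ^ 2 * M2) with ((r - l) * M2 * (r - l)) by ring.
  apply Rmult_le_compat; try lra. apply Rabs_pos.
Qed.

(* The error of the trapezoidal rule is corrected by its first Euler-Maclaurin term;
   the remainder comes from a cubic kernel which vanishes at both end points. *)
Lemma trapezoid_correction (u u1 u2 u3 : R -> R) (l r P Q M3 : R) :
  l < r -> (forall x, is_derive u x (u1 x)) -> (forall x, is_derive u1 x (u2 x)) ->
  (forall x, is_derive u2 x (u3 x)) -> (forall x, continuous u3 x) ->
  P + Q * l = u l -> P + Q * r = u r -> (forall y, l <= y <= r -> Rabs (u3 y) <= M3) ->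
  Rabs (RInt (fun y => P + Q * y - u y) l r - (r - l) ^ 2 / 12 * (u1 r - u1 l)) <= (r - l) ^ 4 * M3.
Proof.
  intros Hlr Du Du1 Du2 Cu3 Hl Hr HM. set (h := r - l).
  assert (Cu : forall x, continuous u x) by (intros; cont).
  (* [kap] is the kernel of the trapezoidal rule minus its mean h^2/12, which is why its
     antiderivative [Ker] can vanish at both ends. *)
  set (kap := fun x => (x - l) * (r - x) / 2 - h * h / 12).
  set (Ker := fun x => - ((x - l) * (r - x) * (l + r - 2 * x)) / 12).
  assert (DK : forall x, is_derive Ker x (kap x)).
  { intros x. unfold Ker, kap. eapply is_derive_val. deriv. simpl. unfold h. field. }
  assert (Dk : forall x, is_derive kap x ((l + r) / 2 - x)).
  { intros x. unfold kap. eapply is_derive_val. deriv. simpl. field. }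
  assert (E : RInt (fun y => P + Q * y - u y) l r - h ^ 2 / 12 * (u1 r - u1 l)
              = - RInt (fun y => Ker y * u3 y) l r).
  { assert (F : RInt (fun y => (P + Q * y - u y) + Ker y * u3 y) l r =
       RInt (fun y => P + Q * y - u y) l r + RInt (fun y => Ker y * u3 y) l r).
    { apply RInt_add; intros; cont. }
    (* The primitive comes from integrating Ker u''' by parts three times: Ker' = kap, kap' = (l +
       r)/2 - y, kap'' = -1. *)
    rewrite (RInt_FTC (fun y => (P * y + Q * (y * y / 2)) + Ker y * u2 y - kap y * u1 y + ((l + r) / 2 - y) * u y) _ l r) in F.
    - assert (K1 : Ker l = 0) by (unfold Ker; field). assert (K2 : Ker r = 0) by (unfold Ker; field).
      assert (K3 : kap l = - h * h / 12) by (unfold kap; field).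
      assert (K4 : kap r = - h * h / 12) by (unfold kap; field).
      cbv beta in F. rewrite K1, K2, K3, K4, <- Hl, <- Hr in F.
      replace (RInt (fun y => P + Q * y - u y) l r) with
        (RInt (fun y => P + Q * y - u y) l r + RInt (fun y => Ker y * u3 y) l r
          - RInt (fun y => Ker y * u3 y) l r) by ring.
      rewrite <- F. unfold h. field.
    - intros x. eapply is_derive_val. deriv. simpl. field.
    - intros x. cont. }
  rewrite E, Rabs_Ropp.
  replace (h ^ 4 * M3) with ((r - l) * (h ^ 3 * M3)) by (unfold h; ring).
  apply RInt_bound. lra. intros; cont.
  intros x Hx. rewrite Rabs_mult. apply Rmult_le_compat; auto; try apply Rabs_pos.
  unfold Ker, Rdiv. rewrite Rabs_mult, Rabs_Ropp, !Rabs_mult, (Rabs_pos_eq (/ 12)) by lra.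
  rewrite (Rabs_pos_eq (x - l)), (Rabs_pos_eq (r - x)) by lra.
  assert (Rabs (l + r - 2 * x) <= h) by (apply Rabs_le; unfold h; lra).
  assert ((x - l) * (r - x) <= h * h) by (unfold h; apply Rmult_le_compat; lra).
  assert ((x - l) * (r - x) * Rabs (l + r - 2 * x) <= h * h * h).
  { apply Rmult_le_compat; auto. apply Rmult_le_pos; lra. apply Rabs_pos. }
  simpl. assert (0 <= h) by (unfold h; lra). assert (0 <= h * h * h) by (repeat apply Rmult_le_pos; auto). lra.
Qed.

Lemma interpolant_bound (u : R -> R) (l r P Q M y : R) :
  l < r -> P + Q * l = u l -> P + Q * r = u r -> Rabs (u l) <= M -> Rabs (u r) <= M ->
  l <= y <= r -> Rabs (P + Q * y) <= M.
Proof.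
  intros Hlr HPl HPr Hul Hur Hy. rewrite <- HPl in Hul. rewrite <- HPr in Hur.
  apply Rabs_le_between in Hul. apply Rabs_le_between in Hur. apply Rabs_le.
  destruct (Rle_dec 0 Q); split; nra.
Qed.

Section Cell.
Context (a a1 c u u1 u2 u3 : R -> R) (K l r P Q p q rho : R).
Context (Hlr : l < r).
Context (Da : forall x, is_derive a x (a1 x)).
Context (Ca1 : forall x, continuous a1 x).
Context (Cc : forall x, continuous c x).
Context (Du : forall x, is_derive u x (u1 x)).
Context (Du1 : forall x, is_derive u1 x (u2 x)).
Context (Du2 : forall x, is_derive u2 x (u3 x)).
Context (Cu3 : forall x, continuous u3 x).
Context (HPl : P + Q * l = u l).
Context (HPr : P + Q * r = u r).
Context (HK : 0 <= K).
Context (Hrho : 0 <= rho).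
Context (Hcoef : forall y, l <= y <= r ->
  Rabs (a y) <= K * rho /\ Rabs (a1 y) <= K /\ Rabs (c y) <= K).

Let h := r - l.
Let chi y := p + q * y.
Let eta y := P + Q * y - u y.
Let Phi y := a y * u2 y * chi y.

(** Integration by parts moves the derivative off eta, and freezing a at the midpoint m leaves -q
    a(m) times the integral of eta, that is -q a(m) h^2/12 (u'(r) - u'(l)) up to the error T of
    [trapezoid_correction]. Writing Phi(r) - Phi(l) as the integral of Phi' produces the same term
    with the opposite sign, so only the remainders I1, I2, T, I3 and I4 survive. *)
Lemma supercloseness (X M2 M3 : R) :
  Rabs q * h <= 4 * X -> (forall y, l <= y <= r -> Rabs (chi y) <= 3 * X) ->
  (forall y, l <= y <= r -> Rabs (u2 y) <= M2) ->
  (forall y, l <= y <= r -> Rabs (u3 y) <= M3) ->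
  Rabs (RInt (fun y => a y * (Q - u1 y) * chi y) l r + h ^ 2 / 12 * (Phi r - Phi l))
    <= 14 * K * (h * X) * (h ^ 2 * M2 + h ^ 2 * rho * M3).
Proof.
  intros Hq Hchi HM2 HM3.
  assert (Ca : forall x, continuous a x) by (intros; cont).
  assert (Cu : forall x, continuous u x) by (intros; cont).
  assert (Cu1 : forall x, continuous u1 x) by (intros; cont).
  assert (Cu2 : forall x, continuous u2 x) by (intros; cont).
  assert (Cchi : forall x, continuous chi x) by (intros; unfold chi; cont).
  assert (Ceta : forall x, continuous eta x) by (intros; unfold eta; cont).
  assert (Dchi : forall x, is_derive chi x q).
  { intros x; unfold chi. eapply is_derive_val. deriv. simpl; ring. }
  assert (Deta : forall x, is_derive eta x (Q - u1 x)).
  { intros x; unfold eta. eapply is_derive_val. deriv. simpl; ring. }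
  set (m := (l + r) / 2).
  pose proof (interpolation_bound u u1 u2 l r P Q M2 Hlr Du Du1 HPl HPr HM2) as HI.
  pose proof (trapezoid_correction u u1 u2 u3 l r P Q M3 Hlr Du Du1 Du2 Cu3 HPl HPr HM3) as HT.
  fold h in HI, HT. change (fun y => P + Q * y - u y) with eta in HT.
  assert (Hh : 0 < h) by (unfold h; lra).
  assert (HM20 : 0 <= M2) by (pose proof (Rabs_pos (u2 l)); specialize (HM2 l ltac:(lra)); lra).
  assert (HM30 : 0 <= M3) by (pose proof (Rabs_pos (u3 l)); specialize (HM3 l ltac:(lra)); lra).
  assert (HX : 0 <= X) by (pose proof (Rabs_pos (chi l)); specialize (Hchi l ltac:(lra)); lra).
  assert (Ham : forall y, l <= y <= r -> Rabs (a y - a m) <= K * h).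
  { assert (Gen : forall s t, l <= s <= r -> l <= t <= r -> s <= t -> Rabs (a t - a s) <= K * h).
    { intros s t Hs Ht Hst. destruct (MVT_closed a a1 s t) as [w [Hw Ew]]; auto.
      rewrite Ew, Rabs_mult, (Rabs_pos_eq (t - s)) by lra.
      destruct (Hcoef w ltac:(lra)) as [_ [H _]]. apply Rmult_le_compat; try lra. apply Rabs_pos. unfold h; lra. }
    intros y Hy. unfold m. destruct (Rle_dec ((l + r) / 2) y). apply Gen; lra.
    rewrite Rabs_minus_sym. apply Gen; lra. }
  set (I1 := RInt (fun y => a1 y * eta y * chi y) l r).
  set (I2 := RInt (fun y => (a y - a m) * eta y) l r).
  set (I3 := RInt (fun y => (a1 y * u2 y + a y * u3 y) * chi y) l r).
  set (I4 := RInt (fun y => (a y - a m) * u2 y) l r).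
  assert (Eq1 : RInt (fun y => a y * (Q - u1 y) * chi y) l r = - I1 - q * (a m * RInt eta l r + I2)).
  { assert (F : RInt (fun y => a y * (Q - u1 y) * chi y + (a1 y * eta y * chi y + q * (a m * eta y + (a y - a m) * eta y))) l r = 0).
    { rewrite (RInt_FTC (fun y => a y * eta y * chi y) _ l r).
      - real_eq. unfold eta. rewrite HPl, HPr. ring.
      - intros x. eapply is_derive_val. apply deriv_mult; [apply deriv_mult; [apply Da|apply Deta]|apply Dchi]. simpl; ring.
      - intros x. cont. }
    rewrite RInt_add in F by (intros; cont). rewrite RInt_add in F by (intros; cont).
    rewrite RInt_mul in F by (intros; cont). rewrite RInt_add in F by (intros; cont).
    rewrite RInt_mul in F by (intros; cont). unfold I1, I2. lra. }
  assert (Eq2 : Phi r - Phi l = I3 + q * (a m * (u1 r - u1 l) + I4)).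
  { rewrite <- (RInt_FTC u1 u2 l r) by auto.
    rewrite <- (RInt_FTC Phi (fun y => (a1 y * u2 y + a y * u3 y) * chi y + q * (a m * u2 y + (a y - a m) * u2 y)) l r).
    - rewrite RInt_add by (intros; cont). rewrite RInt_mul by (intros; cont).
      rewrite RInt_add by (intros; cont). rewrite RInt_mul by (intros; cont). reflexivity.
    - intros x. unfold Phi. eapply is_derive_val. apply deriv_mult; [apply deriv_mult; [apply Da|apply Du2]|apply Dchi]. simpl; ring.
    - intros x. cont. }
  set (T := RInt eta l r - h ^ 2 / 12 * (u1 r - u1 l)) in *.
  assert (E : RInt (fun y => a y * (Q - u1 y) * chi y) l r + h ^ 2 / 12 * (Phi r - Phi l)
     = - I1 - q * I2 - q * (a m * T) + h ^ 2 / 12 * (I3 + q * I4)).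
  { rewrite Eq1, Eq2. unfold T. ring. }
  rewrite E. clear E Eq1 Eq2.
  assert (B1 : Rabs I1 <= h * (K * (h ^ 2 * M2) * (3 * X))).
  { apply RInt_bound. lra. intros; cont. intros y Hy. rewrite !Rabs_mult.
    destruct (Hcoef y Hy) as [_ [H _]]. destruct (HI y Hy) as [H1 _]. specialize (Hchi y Hy).
    apply Rmult_le_compat; auto; try apply Rmult_le_pos; try apply Rabs_pos.
    apply Rmult_le_compat; auto; apply Rabs_pos. }
  assert (B2 : Rabs I2 <= h * (K * h * (h ^ 2 * M2))).
  { apply RInt_bound. lra. intros; cont. intros y Hy. rewrite !Rabs_mult.
    destruct (HI y Hy) as [H1 _]. specialize (Ham y Hy). apply Rmult_le_compat; auto; apply Rabs_pos. }
  assert (B3 : Rabs I3 <= h * ((K * M2 + K * rho * M3) * (3 * X))).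
  { apply RInt_bound. lra. intros; cont. intros y Hy. rewrite Rabs_mult.
    destruct (Hcoef y Hy) as [H0 [H _]]. specialize (Hchi y Hy). specialize (HM2 y Hy). specialize (HM3 y Hy).
    apply Rmult_le_compat; auto; try apply Rabs_pos.
    eapply Rle_trans. apply Rabs_triang. rewrite !Rabs_mult.
    apply Rplus_le_compat; apply Rmult_le_compat; auto; apply Rabs_pos. }
  assert (B4 : Rabs I4 <= h * (K * h * M2)).
  { apply RInt_bound. lra. intros; cont. intros y Hy. rewrite !Rabs_mult.
    specialize (Ham y Hy). apply Rmult_le_compat; auto; apply Rabs_pos. }
  assert (Bm : Rabs (a m) <= K * rho) by (apply Hcoef; unfold m; lra).
  assert (Hq0 := Rabs_pos q).
  assert (C2 : Rabs (q * I2) <= 4 * X * (K * h * (h ^ 2 * M2))).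
  { rewrite Rabs_mult. apply Rle_trans with (Rabs q * h * (K * h * (h ^ 2 * M2))).
    rewrite Rmult_assoc. apply Rmult_le_compat_l; auto.
    apply Rmult_le_compat_r; auto. repeat apply Rmult_le_pos; lra. }
  assert (C3 : Rabs (q * (a m * T)) <= 4 * X * (K * rho * (h ^ 3 * M3))).
  { rewrite !Rabs_mult. apply Rle_trans with (Rabs q * h * (K * rho * (h ^ 3 * M3))).
    - rewrite Rmult_assoc. apply Rmult_le_compat_l; auto.
      replace (h * (K * rho * (h ^ 3 * M3))) with (K * rho * (h ^ 4 * M3)) by ring.
      apply Rmult_le_compat; auto; apply Rabs_pos.
    - apply Rmult_le_compat_r; auto. repeat apply Rmult_le_pos; try lra. }
  assert (C4 : Rabs (q * I4) <= 4 * X * (K * h * M2)).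
  { rewrite Rabs_mult. apply Rle_trans with (Rabs q * h * (K * h * M2)).
    rewrite Rmult_assoc. apply Rmult_le_compat_l; auto.
    apply Rmult_le_compat_r; auto. repeat apply Rmult_le_pos; lra. }
  assert (C5 : Rabs (h ^ 2 / 12 * (I3 + q * I4)) <=
     h ^ 2 / 12 * (h * ((K * M2 + K * rho * M3) * (3 * X)) + 4 * X * (K * h * M2))).
  { rewrite Rabs_mult, (Rabs_pos_eq (h ^ 2 / 12)) by nra. apply Rmult_le_compat_l. nra.
    eapply Rle_trans. apply Rabs_triang. lra. }
  assert (Z1 : 0 <= K * (h * X) * (h ^ 2 * M2)) by (repeat apply Rmult_le_pos; nra).
  assert (Z2 : 0 <= K * (h * X) * (h ^ 2 * rho * M3)) by (repeat apply Rmult_le_pos; nra).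
  assert (Tri : forall x1 x2 x3 x4 y1 y2 y3 y4 : R, Rabs x1 <= y1 -> Rabs x2 <= y2 -> Rabs x3 <= y3 -> Rabs x4 <= y4 ->
     Rabs (- x1 - x2 - x3 + x4) <= y1 + y2 + y3 + y4).
  { intros x1 x2 x3 x4 y1 y2 y3 y4 G1 G2 G3 G4.
    apply Rabs_le_between in G1; apply Rabs_le_between in G2; apply Rabs_le_between in G3; apply Rabs_le_between in G4.
    apply Rabs_le. lra. }
  eapply Rle_trans. apply Tri; eauto.
  replace (14 * K * (h * X) * (h ^ 2 * M2 + h ^ 2 * rho * M3)) with
    (14 * (K * (h * X) * (h ^ 2 * M2)) + 14 * (K * (h * X) * (h ^ 2 * rho * M3))) by ring.
  set (z1 := K * (h * X) * (h ^ 2 * M2)) in *. set (z2 := K * (h * X) * (h ^ 2 * rho * M3)) in *.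
  match goal with |- ?L <= _ => replace L with ((3 + 4 + 3 / 12 + 4 / 12) * z1 + (4 + 3 / 12) * z2) by (unfold z1, z2; field) end.
  lra.
Qed.
End Cell.

(** * The bilinear form, the load and the consistency error on one cell *)

Lemma young (A B g : R) : 0 < g -> A * B <= g / 8 * B ^ 2 + 2 * A ^ 2 / g.
Proof.
  intros Hg. assert (0 <= (B * g - 4 * A) ^ 2 / (8 * g)).
  { apply Rmult_le_pos. apply pow2_ge_0. left; apply Rinv_0_lt_compat; lra. }
  replace ((B * g - 4 * A) ^ 2 / (8 * g)) with (g / 8 * B ^ 2 + 2 * A ^ 2 / g - A * B) in H by (field; lra).
  lra.
Qed.

(** The hypothesis w^2 <= e E stands in for a division by e; it is used with e = eps and E
    independent of eps. *)
Lemma abs_mul_young (w q e E : R) : 0 <= e -> 0 <= E -> w ^ 2 <= e * E ->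
  Rabs (w * q) <= / 2 * (e * q ^ 2) + / 2 * E.
Proof.
  intros He HE Hw.
  assert (0 <= e * q ^ 2) by (apply Rmult_le_pos; auto; apply pow2_ge_0).
  rewrite <- (Rabs_pos_eq (/ 2 * (e * q ^ 2) + / 2 * E)) by lra.
  apply Rsqr_le_abs_0. unfold Rsqr.
  pose proof (pow2_ge_0 (e * q ^ 2 - E)). pose proof (pow2_ge_0 q).
  assert (w ^ 2 * q ^ 2 <= e * E * q ^ 2) by (apply Rmult_le_compat_r; auto). nra.
Qed.

(** The share of one cell in [B_SD], for the trial function p' + q' y and the test function p + q y.
    Affine trial functions have no second derivative, so eps is absent from the stabilisation
    part. *)
Definition cell_form (eps delta : R) (a c : R -> R) (l r p' q' p q : R) : R :=
  RInt (fun y => eps * q' * q + a y * q' * (p + q * y) + c y * (p' + q' * y) * (p + q * y)) l r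
  + delta * RInt (fun y => (a y * q' + c y * (p' + q' * y)) * (a y * q)) l r.

Definition cell_load (delta : R) (a f : R -> R) (l r p q : R) : R :=
  RInt (fun y => f y * (p + q * y)) l r + delta * RInt (fun y => f y * (a y * q)) l r.

(** Consistency error of the interpolant P + Q y. The Galerkin part carries no eps-term, because eta
    vanishes at the nodes; in the stabilisation residual eps u'' remains, since the interpolant has
    nothing to cancel it. *)
Definition cell_error (eps delta : R) (a c u u1 u2 : R -> R) (l r P Q p q : R) : R :=
  RInt (fun y => (a y * (Q - u1 y) + c y * (P + Q * y - u y)) * (p + q * y)) l r
  + delta * RInt (fun y =>
      (eps * u2 y + (a y * (Q - u1 y) + c y * (P + Q * y - u y))) * (a y * q)) l r.

Section Cell.
Context (a a1 c u u1 u2 u3 : R -> R) (eps delta K l r P Q p q : R).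
Context (Hlr : l < r).
Context (Da : forall x, is_derive a x (a1 x)).
Context (Ca1 : forall x, continuous a1 x).
Context (Cc : forall x, continuous c x).
Context (Du : forall x, is_derive u x (u1 x)).
Context (Du1 : forall x, is_derive u1 x (u2 x)).
Context (Du2 : forall x, is_derive u2 x (u3 x)).
Context (Cu3 : forall x, continuous u3 x).
Context (HPl : P + Q * l = u l).
Context (HPr : P + Q * r = u r).
Context (Heps : 0 < eps).
Context (Hdelta : 0 <= delta).

Let h := r - l.
Let chi y := p + q * y.
Let Phi y := a y * u2 y * chi y.

(** f is eliminated through the equation. Since Q h = u(r) - u(l), integrating eps (u'' chi + Q q)
    leaves only nodal values, which telescope over the mesh. *)
Lemma cell_form_error (f : R -> R) :
  (forall x, continuous f x) -> (forall y, l <= y <= r -> eps * u2 y = a y * u1 y + c y * u y - f y) ->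
  cell_form eps delta a c l r P Q p q - cell_load delta a f l r p q
  = cell_error eps delta a c u u1 u2 l r P Q p q + eps * (u1 r * chi r - u1 l * chi l).
Proof.
  intros Cf Hf.
  assert (Ca : forall x, continuous a x) by (intros; cont).
  assert (Cu : forall x, continuous u x) by (intros; cont).
  assert (Cu1 : forall x, continuous u1 x) by (intros; cont).
  assert (Cu2 : forall x, continuous u2 x) by (intros; cont).
  unfold cell_form, cell_load, cell_error.
  assert (E1 : RInt (fun y => (a y * Q + c y * (P + Q * y)) * (a y * q)) l r - RInt (fun y => f y * (a y * q)) l r
     = RInt (fun y => (eps * u2 y + (a y * (Q - u1 y) + c y * (P + Q * y - u y))) * (a y * q)) l r).
  { rewrite <- RInt_sub by (intros; cont). apply RInt_ext. rewrite Rmin_left, Rmax_right by lra.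
    intros x Hx. rewrite (Hf x) by lra. real_eq. ring. }
  assert (E2 : RInt (fun y => eps * Q * q + a y * Q * (p + q * y) + c y * (P + Q * y) * (p + q * y)) l r
      - RInt (fun y => f y * (p + q * y)) l r
     = RInt (fun y => (a y * (Q - u1 y) + c y * (P + Q * y - u y)) * (p + q * y)) l r
       + eps * (u1 r * chi r - u1 l * chi l)).
  { rewrite <- RInt_sub by (intros; cont).
    assert (F : RInt (fun y => eps * (u2 y * chi y + Q * q)) l r = eps * (u1 r * chi r - u1 l * chi l)).
    { rewrite (RInt_FTC (fun y => eps * (u1 y * chi y - q * u y + Q * q * y)) _ l r).
      - real_eq. rewrite <- HPl, <- HPr. ring.
      - intros x. unfold chi. eapply is_derive_val. deriv. simpl. ring.
      - intros x. unfold chi. cont. }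
    rewrite <- F, <- RInt_add by (intros; unfold chi; cont). apply RInt_ext. rewrite Rmin_left, Rmax_right by lra.
    intros x Hx. replace (f x) with (a x * u1 x + c x * u x - eps * u2 x) by (rewrite (Hf x); lra).
    real_eq. unfold chi. ring. }
  rewrite <- E1. rewrite Rmult_minus_distr_l. lra.
Qed.

(** Up to nodal values, a chi' chi contributes -a' chi^2 / 2. Completing the square in delta (a q +
    c chi) a q costs delta c^2 chi^2 / 2 <= gamma chi^2 / 4, hence the factor 3/4, and keeps half of
    the stabilisation norm. *)
Lemma cell_coercive (gamma : R) :
  (forall y, l <= y <= r -> gamma <= c y - / 2 * a1 y) ->
  (forall y, l < y < r -> delta * c y ^ 2 <= gamma / 2) ->
  / 2 * (a r * chi r ^ 2 - a l * chi l ^ 2) + eps * q ^ 2 * h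
    + 3 / 4 * gamma * RInt (fun y => chi y ^ 2) l r + / 2 * delta * RInt (fun y => (a y * q) ^ 2) l r
  <= cell_form eps delta a c l r p q p q.
Proof.
  intros Hg Hd.
  assert (Ca : forall x, continuous a x) by (intros; cont).
  unfold cell_form.
  assert (F : RInt (fun y => / 2 * (a1 y * chi y ^ 2) + a y * q * chi y) l r
     = / 2 * (a r * chi r ^ 2 - a l * chi l ^ 2)).
  { rewrite (RInt_FTC (fun y => / 2 * (a y * (chi y * chi y))) _ l r).
    - real_eq. ring.
    - intros x. unfold chi. eapply is_derive_val. deriv. simpl. field.
    - intros x. unfold chi. cont. }
  rewrite <- F, <- (RInt_mul delta) by (intros; cont).
  rewrite <- (RInt_mul (/ 2 * delta)) by (intros; cont).
  rewrite <- (RInt_mul (3 / 4 * gamma)) by (intros; unfold chi; cont).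
  unfold h. rewrite <- (RInt_cst (eps * q ^ 2) l r).
  rewrite <- !RInt_add by (intros; unfold chi; cont).
  apply RInt_mono. lra. intros; unfold chi; cont. intros; cont.
  intros x Hx. specialize (Hg x ltac:(lra)). specialize (Hd x Hx). fold (chi x).
  set (X := chi x) in *. set (Z := a x * q).
  assert (G1 : gamma * X ^ 2 <= (c x - / 2 * a1 x) * X ^ 2) by (apply Rmult_le_compat_r; auto; apply pow2_ge_0).
  assert (G2 : delta * c x ^ 2 * X ^ 2 <= gamma / 2 * X ^ 2) by (apply Rmult_le_compat_r; auto; apply pow2_ge_0).
  assert (G3 : 0 <= delta * (Z + c x * X) ^ 2) by (apply Rmult_le_pos; auto; apply pow2_ge_0).
  replace (delta * ((Z + c x * X) * Z)) with
    (/ 2 * (delta * (Z + c x * X) ^ 2) + / 2 * delta * Z ^ 2 - / 2 * (delta * c x ^ 2 * X ^ 2)) by field.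
  replace (a x * q * X) with (Z * X) by (unfold Z; ring).
  replace (eps * q * q) with (eps * q ^ 2) by ring. lra.
Qed.

(** The part with eps u'' is charged to eps |chi'|^2, the remaining residual to delta |a chi'|^2. *)
Lemma stabilisation_error (B E : R) :
  0 <= E -> (forall y, l <= y <= r -> (delta * eps * u2 y * a y) ^ 2 <= eps * E) ->
  (forall y, l <= y <= r -> Rabs (a y * (Q - u1 y) + c y * (P + Q * y - u y)) <= B) ->
  Rabs (delta * RInt (fun y =>
      (eps * u2 y + (a y * (Q - u1 y) + c y * (P + Q * y - u y))) * (a y * q)) l r)
  <= / 2 * (eps * q ^ 2 * h) + / 4 * (delta * RInt (fun y => (a y * q) ^ 2) l r)
     + (/ 2 * E + delta * B ^ 2) * h.
Proof.
  intros HE HEy HB.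
  assert (Ca : forall x, continuous a x) by (intros; cont).
  assert (Cu : forall x, continuous u x) by (intros; cont).
  assert (Cu1 : forall x, continuous u1 x) by (intros; cont).
  assert (Cu2 : forall x, continuous u2 x) by (intros; cont).
  set (W := fun y => delta * ((eps * u2 y + (a y * (Q - u1 y) + c y * (P + Q * y - u y))) * (a y * q))).
  set (Z := fun y => (/ 2 * (eps * q ^ 2) + (/ 2 * E + delta * B ^ 2)) + / 4 * delta * (a y * q) ^ 2).
  assert (CW : forall x, continuous W x) by (intros; unfold W; cont).
  assert (CZ : forall x, continuous Z x) by (intros; unfold Z; cont).
  assert (Pt : forall y, l < y < r -> Rabs (W y) <= Z y).
  { intros y Hy. specialize (HEy y ltac:(lra)). specialize (HB y ltac:(lra)). unfold W, Z.
    set (Y := a y * (Q - u1 y) + c y * (P + Q * y - u y)) in *.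
    replace (delta * ((eps * u2 y + Y) * (a y * q))) with (delta * eps * u2 y * a y * q + delta * (Y * (a y * q))) by ring.
    eapply Rle_trans. apply Rabs_triang.
    pose proof (abs_mul_young _ q eps E ltac:(lra) HE HEy) as H1.
    assert (H2 : Rabs (delta * (Y * (a y * q))) <= delta * (B ^ 2 + / 4 * (a y * q) ^ 2)).
    { rewrite Rabs_mult, (Rabs_pos_eq delta) by auto. apply Rmult_le_compat_l; auto.
      assert (HY : Y ^ 2 <= B ^ 2).
      { rewrite <- (pow2_abs Y). apply pow_incr. split; auto. apply Rabs_pos. }
      pose proof (pow2_ge_0 (2 * Y - a y * q)). pose proof (pow2_ge_0 (2 * Y + a y * q)).
      apply Rabs_le. split; nra. }
    lra. }
  rewrite <- RInt_mul by (intros; cont). fold W.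
  replace (/ 2 * (eps * q ^ 2 * h) + / 4 * (delta * RInt (fun y => (a y * q) ^ 2) l r)
     + (/ 2 * E + delta * B ^ 2) * h) with (RInt Z l r).
  - apply Rle_trans with (RInt (fun y => Rabs (W y)) l r).
    + apply abs_RInt_le. lra. now apply ex_RInt_cont.
    + apply RInt_mono; auto. lra. intros; cont.
  - unfold Z. rewrite RInt_add, RInt_cst by (intros; cont). rewrite RInt_mul by (intros; cont).
    unfold h. real_eq. ring.
Qed.

Context (HK : 1 <= K).
Context (rho : R).
Context (Hhrho : h <= rho).
Context (Hrho : forall y, l <= y <= r -> Rabs y <= rho).
Context (Hcoef : forall y, l <= y <= r ->
  Rabs (a y) <= K * Rabs y /\ Rabs (a1 y) <= K /\ Rabs (c y) <= K).
Context (H M gamma : R).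
Context (HH : 0 < H <= 1).
Context (HM : 1 <= M).
Context (Hgamma : 0 < gamma).
Context (HdH : delta <= H).

(** The three size conditions serve eta, a eta' and the corrected trapezoidal rule in turn. The
    alternative rho <= h describes a cell at the turning point: there a = O(h) provides the missing
    power, and the integral and the nodal difference of Phi are bounded separately, without u'''. *)
Lemma smooth_cell (M2 M3 : R) :
  (forall y, l <= y <= r -> Rabs (u2 y) <= M2) ->
  (forall y, l <= y <= r -> Rabs (u3 y) <= M3) ->
  eps * delta <= h ^ 2 ->
  h ^ 2 * M2 <= M * H ^ 2 -> h * rho * M2 <= M * H -> (h ^ 2 * rho * M3 <= M * H ^ 2 \/ rho <= h) ->
  Rabs (cell_error eps delta a c u u1 u2 l r P Q p q + h ^ 2 / 12 * (Phi r - Phi l))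
  <= gamma / 8 * RInt (fun y => chi y ^ 2) l r + / 2 * (eps * q ^ 2 * h)
     + / 4 * (delta * RInt (fun y => (a y * q) ^ 2) l r)
     + (2 * (31 * K * M) ^ 2 / gamma + 5 * (K * M) ^ 2) * H ^ 3 * h.
Proof.
  intros HM2 HM3 Hed B1 B2 B3.
  assert (Ca : forall x, continuous a x) by (intros; cont).
  assert (Cu : forall x, continuous u x) by (intros; cont).
  assert (Cu1 : forall x, continuous u1 x) by (intros; cont).
  assert (Cu2 : forall x, continuous u2 x) by (intros; cont).
  assert (Hh : 0 < h) by (unfold h; lra).
  assert (HM20 : 0 <= M2) by (pose proof (Rabs_pos (u2 l)); specialize (HM2 l ltac:(lra)); lra).
  assert (HM30 : 0 <= M3) by (pose proof (Rabs_pos (u3 l)); specialize (HM3 l ltac:(lra)); lra).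
  assert (HKM : 0 < K * M) by nra.
  destruct (affine_size l r p q Hlr) as [X [HX [EX [HqX HchiX]]]]. fold h in EX, HqX.
  pose proof (interpolation_bound u u1 u2 l r P Q M2 Hlr Du Du1 HPl HPr HM2) as HI. fold h in HI.
  assert (Hcoef' : forall y, l <= y <= r -> Rabs (a y) <= K * rho /\ Rabs (a1 y) <= K /\ Rabs (c y) <= K).
  { intros y Hy. destruct (Hcoef y Hy) as [H1 H2]. split; auto. eapply Rle_trans. exact H1.
    apply Rmult_le_compat_l. lra. auto. }
  assert (S1 : Rabs (RInt (fun y => a y * (Q - u1 y) * chi y) l r + h ^ 2 / 12 * (Phi r - Phi l))
     <= 28 * (K * M) * H ^ 2 * (h * X)).
  { assert (HhX : 0 <= h * X) by nra. destruct B3 as [B3|B3].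
    - eapply Rle_trans.
      apply (supercloseness a a1 c u u1 u2 u3 K l r P Q p q rho Hlr Da Ca1 Du Du1 Du2 Cu3 HPl HPr
               ltac:(lra) ltac:(lra) Hcoef' X M2 M3); auto.
      fold h. replace (28 * (K * M) * H ^ 2 * (h * X)) with (14 * K * (h * X) * (M * H ^ 2 + M * H ^ 2)) by ring.
      apply Rmult_le_compat_l. repeat apply Rmult_le_pos; lra. lra.
    - assert (HP : forall z, l <= z <= r -> Rabs (Phi z) <= K * rho * M2 * (3 * X)).
      { intros z Hz. unfold Phi. rewrite !Rabs_mult. destruct (Hcoef' z Hz) as [G _].
        specialize (HM2 z Hz). specialize (HchiX z Hz).
        apply Rmult_le_compat; auto; try apply Rmult_le_pos; try apply Rabs_pos.
        apply Rmult_le_compat; auto; apply Rabs_pos. }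
      assert (Hr1 : h ^ 2 * rho * M2 <= h * (M * H ^ 2)).
      { replace (h ^ 2 * rho * M2) with (rho * (h ^ 2 * M2)) by ring. apply Rmult_le_compat; auto. lra.
        apply Rmult_le_pos; auto. apply pow_le; lra. }
      assert (G1 : Rabs (h ^ 2 / 12 * (Phi r - Phi l)) <= K * M * H ^ 2 * (h * X)).
      { rewrite Rabs_mult, (Rabs_pos_eq (h ^ 2 / 12)) by nra.
        pose proof (HP r ltac:(lra)) as P1. pose proof (HP l ltac:(lra)) as P2.
        assert (Rabs (Phi r - Phi l) <= 2 * (K * rho * M2 * (3 * X))).
        { eapply Rle_trans. apply Rabs_triang. rewrite Rabs_Ropp. lra. }
        apply Rle_trans with (h ^ 2 / 12 * (2 * (K * rho * M2 * (3 * X)))). apply Rmult_le_compat_l; nra.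
        replace (h ^ 2 / 12 * (2 * (K * rho * M2 * (3 * X)))) with (/ 2 * (K * X) * (h ^ 2 * rho * M2)) by field.
        replace (K * M * H ^ 2 * (h * X)) with (K * X * (h * (M * H ^ 2))) by ring.
        assert (0 <= K * X) by nra. assert (0 <= h * (M * H ^ 2)) by (repeat apply Rmult_le_pos; nra).
        apply Rmult_le_compat; auto; try lra. repeat apply Rmult_le_pos; lra. }
      assert (G2 : Rabs (RInt (fun y => a y * (Q - u1 y) * chi y) l r) <= h * (K * rho * (h * M2) * (3 * X))).
      { apply RInt_bound. lra. intros; unfold chi; cont. intros y Hy. rewrite !Rabs_mult.
        destruct (Hcoef' y Hy) as [G _]. destruct (HI y Hy) as [_ G3]. specialize (HchiX y Hy).
        apply Rmult_le_compat; auto; try apply Rmult_le_pos; try apply Rabs_pos.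
        apply Rmult_le_compat; auto; apply Rabs_pos. }
      replace (h * (K * rho * (h * M2) * (3 * X))) with (3 * (K * X) * (h ^ 2 * rho * M2)) in G2 by ring.
      assert (3 * (K * X) * (h ^ 2 * rho * M2) <= 3 * (K * X) * (h * (M * H ^ 2))).
      { apply Rmult_le_compat_l; nra. }
      assert (0 <= K * M * H ^ 2 * (h * X)) by (repeat apply Rmult_le_pos; nra).
      eapply Rle_trans. apply Rabs_triang. lra. }
  assert (S2 : Rabs (RInt (fun y => c y * (P + Q * y - u y) * chi y) l r) <= 3 * (K * M) * H ^ 2 * (h * X)).
  { replace (3 * (K * M) * H ^ 2 * (h * X)) with (h * (K * (M * H ^ 2) * (3 * X))) by ring.
    apply RInt_bound. lra. intros; unfold chi; cont. intros y Hy. rewrite !Rabs_mult.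
    destruct (Hcoef' y Hy) as [_ [_ G]]. destruct (HI y Hy) as [G3 _]. specialize (HchiX y Hy).
    apply Rmult_le_compat; auto; try apply Rmult_le_pos; try apply Rabs_pos.
    apply Rmult_le_compat; auto; try apply Rabs_pos. lra. }
  assert (HH2 : H ^ 2 <= H) by nra. assert (HH3 : 0 <= H ^ 3) by (apply pow_le; lra).
  assert (HH43 : (H ^ 2) ^ 2 <= H ^ 3).
  { replace ((H ^ 2) ^ 2) with (H * H ^ 3) by ring. nra. }
  assert (S3 := stabilisation_error (2 * (K * M) * H) ((K * M) ^ 2 * H ^ 3)).
  spec S3. { apply Rmult_le_pos; auto. apply pow2_ge_0. }
  spec S3.
  { intros y Hy. destruct (Hcoef' y Hy) as [G _]. specialize (HM2 y Hy).
    assert (G1 : Rabs (u2 y) * Rabs (a y) <= M2 * (K * rho)) by (apply Rmult_le_compat; auto; apply Rabs_pos).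
    (* Of the two factors delta, one combines with eps into h^2 and the other is at most H. *)
    replace ((delta * eps * u2 y * a y) ^ 2) with (eps * (eps * delta * (delta * (u2 y * a y) ^ 2))) by ring.
    apply Rmult_le_compat_l. lra.
    rewrite <- (pow2_abs (u2 y * a y)), Rabs_mult.
    assert (G2 : (Rabs (u2 y) * Rabs (a y)) ^ 2 <= (M2 * (K * rho)) ^ 2).
    { apply pow_incr. split; auto. apply Rmult_le_pos; apply Rabs_pos. }
    apply Rle_trans with (h ^ 2 * (H * (M2 * (K * rho)) ^ 2)).
    - apply Rmult_le_compat; [apply Rmult_le_pos; lra | apply Rmult_le_pos; [auto | apply pow2_ge_0] | auto |].
      apply Rmult_le_compat; auto. apply pow2_ge_0.
    - replace (h ^ 2 * (H * (M2 * (K * rho)) ^ 2)) with (K ^ 2 * H * (h * rho * M2) ^ 2) by ring.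
      replace ((K * M) ^ 2 * H ^ 3) with (K ^ 2 * H * (M * H) ^ 2) by ring.
      apply Rmult_le_compat_l. apply Rmult_le_pos. apply pow2_ge_0. lra.
      apply pow_incr. split; auto. repeat apply Rmult_le_pos; lra. }
  spec S3.
  { intros y Hy. destruct (Hcoef' y Hy) as [G [_ G']]. destruct (HI y Hy) as [I1 I2].
    eapply Rle_trans. apply Rabs_triang. rewrite !Rabs_mult.
    assert (Rabs (a y) * Rabs (Q - u1 y) <= K * rho * (h * M2)) by (apply Rmult_le_compat; auto; apply Rabs_pos).
    assert (Rabs (c y) * Rabs (P + Q * y - u y) <= K * (h ^ 2 * M2)) by (apply Rmult_le_compat; auto; apply Rabs_pos).
    assert (K * (h * rho * M2) <= K * (M * H)) by (apply Rmult_le_compat_l; lra).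
    assert (K * (h ^ 2 * M2) <= K * (M * H)) by (apply Rmult_le_compat_l; [lra|]; nra). lra. }
  assert (Split : RInt (fun y => (a y * (Q - u1 y) + c y * (P + Q * y - u y)) * (p + q * y)) l r
     = RInt (fun y => a y * (Q - u1 y) * chi y) l r + RInt (fun y => c y * (P + Q * y - u y) * chi y) l r).
  { rewrite <- RInt_add by (intros; unfold chi; cont). apply RInt_ext. intros; unfold chi; real_eq; ring. }
  unfold cell_error. rewrite Split. clear Split.
  set (I1 := RInt (fun y => a y * (Q - u1 y) * chi y) l r) in *.
  set (I2 := RInt (fun y => c y * (P + Q * y - u y) * chi y) l r) in *.
  match type of S3 with Rabs ?G <= _ => set (I3 := G) in * end.
  replace (I1 + I2 + I3 + h ^ 2 / 12 * (Phi r - Phi l)) with ((I1 + h ^ 2 / 12 * (Phi r - Phi l)) + I2 + I3) by ring.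
  (* 31 = 28 + 3 from S1 and S2. Young's inequality gives H^4, which is at most H^3. *)
  assert (Y := young (31 * K * M * H ^ 2) X gamma Hgamma).
  assert (Y' : 31 * K * M * H ^ 2 * X * h <= (gamma / 8 * X ^ 2 + 2 * (31 * K * M * H ^ 2) ^ 2 / gamma) * h).
  { apply Rmult_le_compat_r; lra. }
  assert (Y2 : 2 * (31 * K * M * H ^ 2) ^ 2 / gamma * h <= 2 * (31 * K * M) ^ 2 / gamma * H ^ 3 * h).
  { apply Rmult_le_compat_r. lra. replace (2 * (31 * K * M * H ^ 2) ^ 2 / gamma) with (2 * (31 * K * M) ^ 2 / gamma * (H ^ 2) ^ 2) by (field; lra).
    apply Rmult_le_compat_l; auto. apply Rmult_le_pos. pose proof (pow2_ge_0 (31 * K * M)); lra.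
    left; now apply Rinv_0_lt_compat. }
  assert (Y3 : (/ 2 * ((K * M) ^ 2 * H ^ 3) + delta * (2 * (K * M) * H) ^ 2) * h <= 5 * (K * M) ^ 2 * H ^ 3 * h).
  { apply Rmult_le_compat_r. lra. replace ((2 * (K * M) * H) ^ 2) with (4 * (K * M) ^ 2 * H ^ 2) by ring.
    assert (0 <= (K * M) ^ 2) by apply pow2_ge_0.
    assert (delta * (4 * (K * M) ^ 2 * H ^ 2) <= H * (4 * (K * M) ^ 2 * H ^ 2)).
    { apply Rmult_le_compat_r; auto. repeat apply Rmult_le_pos; nra. }
    replace (H * (4 * (K * M) ^ 2 * H ^ 2)) with (4 * ((K * M) ^ 2 * H ^ 3)) in H1 by ring.
    assert (0 <= (K * M) ^ 2 * H ^ 3) by (apply Rmult_le_pos; auto). lra. }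
  change (RInt (fun y => chi y ^ 2) l r) with (RInt (fun y => (p + q * y) ^ 2) l r). rewrite <- EX.
  eapply Rle_trans. apply Rabs_triang.
  assert (Rabs (I1 + h ^ 2 / 12 * (Phi r - Phi l) + I2) <= 31 * K * M * H ^ 2 * X * h).
  { eapply Rle_trans. apply Rabs_triang. lra. }
  lra.
Qed.

(** No power of H is gained: the weighted bounds make every term O(1) per unit length. This suffices
    on cells whose total length is O(H^3). *)
Lemma rough_cell :
  (forall y, l <= y <= r -> Rabs (u y) <= M /\ Rabs y * Rabs (u1 y) <= M /\
     Rabs y ^ 2 * Rabs (u2 y) <= M /\ sqrt eps * Rabs y * Rabs (u2 y) <= M) ->
  ((rho <= h /\ (l = 0 \/ r = 0)) \/ (forall y, l <= y <= r -> rho <= 10 * Rabs y)) ->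
  Rabs (cell_error eps delta a c u u1 u2 l r P Q p q + h ^ 2 / 12 * (Phi r - Phi l))
  <= gamma / 8 * RInt (fun y => chi y ^ 2) l r + / 2 * (eps * q ^ 2 * h)
     + / 4 * (delta * RInt (fun y => (a y * q) ^ 2) l r)
     + (2 * (44 * K * M) ^ 2 / gamma + 170 * (K * M) ^ 2) * h.
Proof.
  intros Hu Hgeo.
  assert (Ca : forall x, continuous a x) by (intros; cont).
  assert (Cu : forall x, continuous u x) by (intros; cont).
  assert (Cu1 : forall x, continuous u1 x) by (intros; cont).
  assert (Cu2 : forall x, continuous u2 x) by (intros; cont).
  assert (Hh : 0 < h) by (unfold h; lra).
  assert (HKM : 0 < K * M) by nra.
  destruct (affine_size l r p q Hlr) as [X [HX [EX [HqX HchiX]]]]. fold h in EX, HqX.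
  destruct (Hu l ltac:(lra)) as [Hul _]. destruct (Hu r ltac:(lra)) as [Hur _].
  (* On a cell touching 0 the nodal values bound h Q; elsewhere Q is a value of u' at a point
     comparable to rho. *)
  assert (HQ : rho * Rabs Q <= 10 * M).
  { destruct Hgeo as [[Hg _]|Hg].
    - apply Rle_trans with (h * Rabs Q). apply Rmult_le_compat_r; auto. apply Rabs_pos.
      rewrite <- (Rabs_pos_eq h) by lra. rewrite <- Rabs_mult.
      replace (h * Q) with (u r - u l) by (unfold h; lra).
      eapply Rle_trans. apply Rabs_triang. rewrite Rabs_Ropp. lra.
    - destruct (MVT_closed u u1 l r) as [z [Hz Ez]]; auto; try lra.
      assert (EQ : Q = u1 z) by (apply Rmult_eq_reg_r with (r - l); lra).
      specialize (Hg z Hz). destruct (Hu z Hz) as [_ [G _]]. rewrite EQ.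
      pose proof (Rabs_pos (u1 z)). apply Rle_trans with (10 * Rabs z * Rabs (u1 z)); [|lra].
      apply Rmult_le_compat_r; auto. }
  assert (Heta : forall y, l <= y <= r -> Rabs (P + Q * y - u y) <= 2 * M).
  { intros y Hy. destruct (Hu y Hy) as [G _].
    pose proof (interpolant_bound u l r P Q M y Hlr HPl HPr Hul Hur Hy) as B.
    unfold Rminus. eapply Rle_trans. apply Rabs_triang. rewrite Rabs_Ropp. lra. }
  assert (HY : forall y, l <= y <= r -> Rabs (a y * (Q - u1 y) + c y * (P + Q * y - u y)) <= 13 * (K * M)).
  { intros y Hy. destruct (Hu y Hy) as [_ [G _]]. destruct (Hcoef y Hy) as [G1 [_ G2]].
    specialize (Heta y Hy). specialize (Hrho y Hy).
    eapply Rle_trans. apply Rabs_triang. rewrite !Rabs_mult.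
    assert (Rabs (c y) * Rabs (P + Q * y - u y) <= K * (2 * M)) by (apply Rmult_le_compat; auto; apply Rabs_pos).
    assert (Rabs (a y) * Rabs (Q - u1 y) <= K * (11 * M)).
    { apply Rle_trans with (K * Rabs y * (Rabs Q + Rabs (u1 y))).
      - apply Rmult_le_compat; auto; try apply Rabs_pos. eapply Rle_trans. apply Rabs_triang. rewrite Rabs_Ropp. lra.
      - rewrite Rmult_assoc. apply Rmult_le_compat_l. lra. pose proof (Rabs_pos Q). nra. }
    lra. }
  assert (S1 : Rabs (RInt (fun y => (a y * (Q - u1 y) + c y * (P + Q * y - u y)) * (p + q * y)) l r)
      <= h * (13 * (K * M) * (3 * X))).
  { apply RInt_bound. lra. intros; cont. intros y Hy. rewrite Rabs_mult.
    specialize (HchiX y Hy). apply Rmult_le_compat; auto; apply Rabs_pos. }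
  assert (HPhi : forall z, z = l \/ z = r -> h * Rabs (Phi z) <= 10 * (K * M) * (3 * X)).
  { intros z Hz. assert (Hzc : l <= z <= r) by (destruct Hz; subst; lra).
    destruct (Hu z Hzc) as [_ [_ [G _]]]. destruct (Hcoef z Hzc) as [G1 _]. specialize (HchiX z Hzc).
    pose proof (Rabs_pos (u2 z)) as U0. pose proof (Rabs_pos z) as Z0.
    assert (G2 : h * (Rabs z * Rabs (u2 z)) <= 10 * M).
    { destruct (Req_dec z 0) as [E|E]. rewrite E, Rabs_R0; lra.
      assert (h <= 10 * Rabs z).
      { destruct Hgeo as [[Hg1 Hg2]|Hg]. 2: specialize (Hg z Hzc); lra.
        assert (h <= Rabs z); [|lra].
        unfold h. destruct Hz, Hg2; subst; try lra; unfold Rabs; destruct Rcase_abs; lra. }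
      apply Rle_trans with (10 * (Rabs z ^ 2 * Rabs (u2 z))); [|lra].
      replace (10 * (Rabs z ^ 2 * Rabs (u2 z))) with (10 * Rabs z * (Rabs z * Rabs (u2 z))) by ring.
      apply Rmult_le_compat_r; auto. apply Rmult_le_pos; auto. }
    unfold Phi. rewrite !Rabs_mult. fold (chi z) in HchiX.
    replace (h * (Rabs (a z) * Rabs (u2 z) * Rabs (chi z))) with (h * Rabs (a z) * Rabs (u2 z) * Rabs (chi z)) by ring.
    apply Rmult_le_compat; auto; try apply Rabs_pos.
    - repeat apply Rmult_le_pos; auto; try apply Rabs_pos; lra.
    - apply Rle_trans with (h * (K * Rabs z) * Rabs (u2 z)). apply Rmult_le_compat_r; auto. apply Rmult_le_compat_l; lra.
      replace (h * (K * Rabs z) * Rabs (u2 z)) with (K * (h * (Rabs z * Rabs (u2 z)))) by ring.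
      replace (10 * (K * M)) with (K * (10 * M)) by ring. apply Rmult_le_compat_l; lra. }
  assert (S2 : Rabs (h ^ 2 / 12 * (Phi r - Phi l)) <= 5 * (K * M) * X * h).
  { rewrite Rabs_mult, (Rabs_pos_eq (h ^ 2 / 12)) by nra.
    pose proof (HPhi l (or_introl eq_refl)). pose proof (HPhi r (or_intror eq_refl)).
    assert (Rabs (Phi r - Phi l) <= Rabs (Phi r) + Rabs (Phi l)).
    { eapply Rle_trans. apply Rabs_triang. rewrite Rabs_Ropp. lra. }
    apply Rle_trans with (h / 12 * (h * Rabs (Phi r) + h * Rabs (Phi l))). 
    - replace (h / 12 * (h * Rabs (Phi r) + h * Rabs (Phi l))) with (h ^ 2 / 12 * (Rabs (Phi r) + Rabs (Phi l))) by field.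
      apply Rmult_le_compat_l; auto. nra.
    - apply Rle_trans with (h / 12 * (10 * (K * M) * (3 * X) + 10 * (K * M) * (3 * X))).
      apply Rmult_le_compat_l; lra. right; field. }
  assert (S3 := stabilisation_error (13 * (K * M)) ((K * M) ^ 2)).
  spec S3. { apply pow2_ge_0. }
  spec S3.
  { intros y Hy. destruct (Hcoef y Hy) as [G _]. destruct (Hu y Hy) as [_ [_ [_ G1]]].
    assert (Es : eps = sqrt eps ^ 2) by (simpl; rewrite Rmult_1_r, sqrt_sqrt; lra).
    pose proof (sqrt_pos eps) as Hs.
    replace ((delta * eps * u2 y * a y) ^ 2) with (eps * (delta ^ 2 * (eps * (u2 y * a y) ^ 2))) by ring.
    apply Rmult_le_compat_l. lra. apply Rle_trans with (1 * (K * M) ^ 2); [|lra].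
    apply Rmult_le_compat; try apply pow2_ge_0; try nra.
    { apply Rmult_le_pos. lra. apply pow2_ge_0. }
    rewrite Es. rewrite <- Rpow_mult_distr. rewrite <- (pow2_abs (sqrt eps * (u2 y * a y))).
    apply pow_incr. split. apply Rabs_pos. rewrite !Rabs_mult, (Rabs_pos_eq (sqrt eps)) by auto.
    pose proof (Rabs_pos (u2 y)).
    apply Rle_trans with (sqrt eps * (Rabs (u2 y) * (K * Rabs y))).
    - apply Rmult_le_compat_l; auto. apply Rmult_le_compat_l; auto.
    - replace (sqrt eps * (Rabs (u2 y) * (K * Rabs y))) with (K * (sqrt eps * Rabs y * Rabs (u2 y))) by ring.
      apply Rmult_le_compat_l; lra. }
  spec S3. { exact HY. }
  unfold cell_error.
  match type of S3 with Rabs ?G <= _ => set (I3 := G) in * end.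
  match type of S1 with Rabs ?G <= _ => set (I1 := G) in * end.
  replace (I1 + I3 + h ^ 2 / 12 * (Phi r - Phi l)) with (I1 + h ^ 2 / 12 * (Phi r - Phi l) + I3) by ring.
  (* 44 = 39 + 5 from S1 and S2; 170 exceeds 1/2 + 13^2, as delta <= 1. *)
  assert (Y := young (44 * K * M) X gamma Hgamma).
  assert (Y' : 44 * K * M * X * h <= (gamma / 8 * X ^ 2 + 2 * (44 * K * M) ^ 2 / gamma) * h).
  { apply Rmult_le_compat_r; lra. }
  assert (Y3 : (/ 2 * (K * M) ^ 2 + delta * (13 * (K * M)) ^ 2) * h <= 170 * (K * M) ^ 2 * h).
  { apply Rmult_le_compat_r. lra. assert (0 <= (K * M) ^ 2) by apply pow2_ge_0. nra. }
  change (RInt (fun y => chi y ^ 2) l r) with (RInt (fun y => (p + q * y) ^ 2) l r). rewrite <- EX.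
  eapply Rle_trans. apply Rabs_triang.
  assert (Rabs (I1 + h ^ 2 / 12 * (Phi r - Phi l)) <= 44 * K * M * X * h).
  { eapply Rle_trans. apply Rabs_triang. lra. }
  lra.
Qed.
End Cell.

(** * Geometry of the mesh *)

Section Mesh.
Context (K N n : nat).
Context (Hn : (0 < n)%nat).
Context (HN : N = ((K + 1) * n)%nat).

Let bp := breakpoint K.
Let step k := (bp (S k) - bp k) / INR n.
Let hm := half_mesh K N.
Let H := INR (K + 1) / INR N.

Lemma block_size : (N / (K + 1))%nat = n.
Proof. subst N. rewrite Nat.mul_comm. apply Nat.div_mul. lia. Qed.

Lemma INR_n_pos : 0 < INR n.
Proof. now apply lt_0_INR. Qed.

Lemma mesh_ratio_eq : H = / INR n.
Proof.
  unfold H. subst N. rewrite mult_INR. field.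
  split; apply not_0_INR; lia.
Qed.

Lemma mesh_ratio_range : 0 < H <= 1.
Proof.
  rewrite mesh_ratio_eq. split. apply Rinv_0_lt_compat, INR_n_pos.
  rewrite <- Rinv_1. apply Rinv_le_contravar. lra. apply (le_INR 1); lia.
Qed.

Lemma breakpoint_pos k : (1 <= k)%nat -> 0 < bp k.
Proof.
  intros Hk. destruct k; [lia|]. unfold bp, breakpoint. apply Rinv_0_lt_compat, pow_lt; lra.
Qed.

Lemma breakpoint_succ k : (1 <= k <= K)%nat -> bp (S k) = 10 * bp k.
Proof.
  intros Hk. destruct k; [lia|]. unfold bp, breakpoint.
  replace (K - k)%nat with (S (K - S k)) by lia. simpl. field. apply pow_nonzero; lra.
Qed.

Lemma breakpoint_last : bp (S K) = 1.
Proof. unfold bp, breakpoint. rewrite Nat.sub_diag. simpl. field. Qed.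

Lemma breakpoint_le_1 k : (k <= S K)%nat -> bp k <= 1.
Proof.
  intros Hk. destruct k. simpl; lra. unfold bp, breakpoint.
  rewrite <- Rinv_1. apply Rinv_le_contravar. lra. apply pow_R1_Rle; lra.
Qed.

Lemma breakpoint_lt k : (k <= K)%nat -> bp k < bp (S k).
Proof.
  intros Hk. destruct k. apply breakpoint_pos; lia.
  rewrite (breakpoint_succ (S k)) by lia. pose proof (breakpoint_pos (S k) ltac:(lia)). lra.
Qed.

Lemma block_step_eq k : step k = (bp (S k) - bp k) * H.
Proof. unfold step. rewrite mesh_ratio_eq. reflexivity. Qed.

Lemma block_step_pos k : (k <= K)%nat -> 0 < step k.
Proof.
  intros Hk. rewrite block_step_eq. apply Rmult_lt_0_compat. pose proof (breakpoint_lt k Hk). lra. apply mesh_ratio_range.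
Qed.

Lemma half_mesh_block k m : (m < n)%nat -> hm (k * n + m) = bp k + INR m * step k.
Proof.
  intros Hm. unfold hm, half_mesh. rewrite block_size.
  replace ((k * n + m) / n)%nat with k.
  replace ((k * n + m) mod n)%nat with m. reflexivity.
  rewrite Nat.add_comm, Nat.Div0.mod_add, Nat.mod_small; auto.
  rewrite Nat.add_comm, Nat.div_add by lia. rewrite Nat.div_small; auto.
Qed.

(** At m = n the quotient already belongs to the next block; both formulas agree there because the
    blocks share that point. *)
Lemma half_mesh_block_le k m : (m <= n)%nat -> hm (k * n + m) = bp k + INR m * step k.
Proof.
  intros Hm. destruct (Nat.eq_dec m n) as [->|E]. 2: apply half_mesh_block; lia.
  replace (k * n + n)%nat with (S k * n + 0)%nat by lia. rewrite half_mesh_block by lia.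
  unfold step. simpl INR. pose proof INR_n_pos. field. lra.
Qed.

Lemma half_mesh_0 : hm 0 = 0.
Proof. replace 0%nat with (0 * n + 0)%nat by lia. rewrite half_mesh_block by lia. unfold bp; simpl. ring. Qed.

Lemma half_mesh_N : hm N = 1.
Proof.
  rewrite HN. replace ((K + 1) * n)%nat with (K * n + n)%nat by lia. rewrite half_mesh_block_le by lia.
  unfold step. rewrite breakpoint_last. pose proof INR_n_pos. field. lra.
Qed.

Lemma half_cell i : (i < N)%nat -> exists k m, (k <= K)%nat /\ (m < n)%nat /\ i = (k * n + m)%nat /\
  hm i = bp k + INR m * step k /\ hm (S i) = bp k + (INR m + 1) * step k.
Proof.
  intros Hi. exists (i / n)%nat, (i mod n)%nat.
  assert (E : i = (i / n * n + i mod n)%nat) by (rewrite Nat.mul_comm; apply Nat.div_mod; lia).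
  assert (Hm : (i mod n < n)%nat) by (apply Nat.mod_upper_bound; lia).
  assert (Hk : (i / n <= K)%nat).
  { apply Nat.lt_succ_r. apply Nat.Div0.div_lt_upper_bound. lia. }
  repeat split; auto.
  - rewrite E at 1. now apply half_mesh_block.
  - rewrite <- S_INR. replace (S i) with (i / n * n + S (i mod n))%nat by lia. apply half_mesh_block_le; lia.
Qed.

(** Outside the innermost block the breakpoints grow by the factor 10, so the step is 9 [bp k] H, at
    most 9 H times the left node. Inside it the step is the constant [bp 1] H, and comparability of
    the two nodes needs an exception for the cell starting at 0. *)
Lemma half_cell_geometry i : (i < N)%nat ->
  0 <= hm i < hm (S i) /\ hm (S i) <= 1 /\
  (hm i = 0 \/ hm (S i) <= 10 * hm i) /\
  ((hm (S i) - hm i = bp 1 * H /\ hm (S i) <= bp 1) \/ hm (S i) - hm i <= 9 * H * hm i).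
Proof.
  intros Hi. destruct (half_cell i Hi) as [k [m [Hk [Hm [_ [E1 E2]]]]]].
  pose proof (block_step_pos k Hk) as Hs. pose proof mesh_ratio_range as HH.
  assert (Hm0 : 0 <= INR m) by apply pos_INR.
  assert (Hm1 : INR m + 1 <= INR n) by (rewrite <- S_INR; apply le_INR; lia).
  assert (Hns : INR n * step k = bp (S k) - bp k) by (unfold step; field; pose proof INR_n_pos; lra).
  assert (Hup : hm (S i) <= bp (S k)) by (rewrite E2; nra).
  assert (Hb0 : 0 <= bp k) by (destruct k; [simpl; lra|left; apply breakpoint_pos; lia]).
  assert (Hms : 0 <= INR m * step k) by nra.
  split; [rewrite E1, E2; split; lra|]. split.
  { eapply Rle_trans. exact Hup. apply breakpoint_le_1; lia. }
  assert (Ed : hm (S i) - hm i = step k) by (rewrite E1, E2; ring).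
  destruct (Nat.eq_dec k 0) as [->|Hk0].
  - assert (B0 : bp 0 = 0) by reflexivity. rewrite B0 in *. split.
    + destruct (Nat.eq_dec m 0) as [->|Hm2]. left. rewrite E1; simpl; ring.
      right. assert (1 <= INR m) by (apply (le_INR 1); lia). rewrite E1, E2. nra.
    + left. split; auto. rewrite Ed, block_step_eq, B0. ring.
  - pose proof (breakpoint_succ k ltac:(lia)) as Bs. split; right.
    + rewrite Bs in Hup. lra.
    + rewrite Ed, block_step_eq, Bs. assert (bp k <= hm i) by lra. nra.
Qed.

(** A block k >= 1 adds at most Q sqrt([bp (S k)]) + Q sqrt([bp k]). The bound 4 Q sqrt([bp k]) is
    inductive because 5 sqrt([bp k]) <= 3 sqrt([bp (S k)]) for breakpoints growing by 10. In the
    innermost block Phi(0) = 0 removes the lower end. *)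
Lemma half_telescope (Phi : R -> R) (Q : R) :
  0 <= Q -> Phi 0 = 0 ->
  (forall i z, (i < N)%nat -> z = hm i \/ z = hm (S i) -> hm (S i) - hm i <= 10 * H * z ->
     (hm (S i) - hm i) ^ 2 * Rabs (Phi z) <= Q * sqrt z) ->
  Rabs (sum_n_m (fun i => (hm i - hm (i - 1)) ^ 2 * (Phi (hm i) - Phi (hm (i - 1)))) 1 N) <= 4 * Q.
Proof.
  intros HQ HP0 HPhi.
  pose (T := fun M : nat => sum_n_m (fun i => (hm i - hm (i - 1)) ^ 2 * (Phi (hm i) - Phi (hm (i - 1)))) 1 M : R).
  assert (TS : forall M, T (S M) = T M + (hm (S M) - hm M) ^ 2 * (Phi (hm (S M)) - Phi (hm M))).
  { intros M. unfold T. rewrite sum_n_Sm by lia. now replace (S M - 1)%nat with M by lia. }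
  assert (Block : forall k m, (m <= n)%nat ->
     T (k * n + m)%nat = T (k * n)%nat + step k ^ 2 * (Phi (hm (k * n + m)) - Phi (hm (k * n)))).
  { intros k m. induction m as [|m IH]; intros Hm.
    - rewrite Nat.add_0_r. real_eq. ring.
    - rewrite Nat.add_succ_r, TS, IH by lia. rewrite <- Nat.add_succ_r, !half_mesh_block_le by lia.
      rewrite S_INR. real_eq. ring. }
  assert (Hbk : forall k, hm (k * n) = bp k).
  { intros k. replace (k * n)%nat with (k * n + 0)%nat by lia. rewrite half_mesh_block by lia. simpl; ring. }
  assert (Main : forall k, (k <= S K)%nat -> Rabs (T (k * n)%nat) <= 4 * Q * sqrt (bp k)).
  { induction k as [|k IH]; intros Hk.
    - simpl. unfold T. rewrite sum_n_m_zero by lia. unfold zero; simpl. rewrite Rabs_R0, sqrt_0. lra.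
    - specialize (IH ltac:(lia)). pose proof mesh_ratio_range as HH.
      replace (S k * n)%nat with (k * n + n)%nat by lia. rewrite Block by lia.
      replace (k * n + n)%nat with (S k * n)%nat by lia. rewrite !Hbk.
      pose proof (block_step_pos k ltac:(lia)) as Hs. pose proof (breakpoint_lt k ltac:(lia)) as Hlt.
      assert (Hb0 : 0 <= bp k) by (destruct k; [simpl; lra|left; apply breakpoint_pos; lia]).
      assert (Hlast : step k ^ 2 * Rabs (Phi (bp (S k))) <= Q * sqrt (bp (S k))).
      { set (i := (k * n + (n - 1))%nat).
        assert (Ei : S i = (S k * n)%nat) by (unfold i; lia).
        assert (Ed : hm (S i) - hm i = step k).
        { replace (S i) with (k * n + n)%nat by (unfold i; lia). unfold i.
          rewrite !half_mesh_block_le by lia. rewrite minus_INR by lia. simpl INR. ring. }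
        rewrite <- Ed. apply HPhi.
        - apply Nat.lt_le_trans with (S i). lia. rewrite Ei, HN. apply Nat.mul_le_mono_r; lia.
        - right. now rewrite Ei, Hbk.
        - rewrite Ed, block_step_eq. nra. }
      destruct (Nat.eq_dec k 0) as [->|Hk0].
      + assert (B0 : bp 0 = 0) by reflexivity. rewrite B0 in *. rewrite HP0, sqrt_0 in *.
        assert (T0 : T (0 * n)%nat = 0).
        { unfold T. simpl. now rewrite sum_n_m_zero by lia. }
        rewrite T0, Rminus_0_r, Rplus_0_l, Rabs_mult, (Rabs_pos_eq (step 0 ^ 2)) by apply pow2_ge_0.
        pose proof (sqrt_pos (bp 1)). nra.
      + pose proof (breakpoint_succ k ltac:(lia)) as Bs. pose proof (breakpoint_pos k ltac:(lia)) as Hbk0.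
        assert (Hfirst : step k ^ 2 * Rabs (Phi (bp k)) <= Q * sqrt (bp k)).
        { assert (Ed : hm (S (k * n)) - hm (k * n) = step k).
          { replace (S (k * n)) with (k * n + 1)%nat by lia.
            rewrite half_mesh_block_le by lia. rewrite Hbk. simpl INR. ring. }
          rewrite <- Ed. apply HPhi.
          - rewrite HN. assert (k * n + n <= K * n + n)%nat; [|lia].
            apply Nat.add_le_mono_r, Nat.mul_le_mono_r; lia.
          - left. now rewrite Hbk.
          - rewrite Ed, block_step_eq, Bs. nra. }
        assert (Sq : 5 * sqrt (bp k) <= 3 * sqrt (bp (S k))).
        { replace (5 * sqrt (bp k)) with (sqrt (25 * bp k)).
          replace (3 * sqrt (bp (S k))) with (sqrt (9 * bp (S k))).
          apply sqrt_le_1; lra.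
          rewrite sqrt_mult by lra. replace 9 with (3 * 3) by ring. rewrite sqrt_square; lra.
          rewrite sqrt_mult by lra. replace 25 with (5 * 5) by ring. rewrite sqrt_square; lra. }
        assert (Rabs (step k ^ 2 * (Phi (bp (S k)) - Phi (bp k))) <= Q * sqrt (bp (S k)) + Q * sqrt (bp k)).
        { rewrite Rabs_mult, (Rabs_pos_eq (step k ^ 2)) by apply pow2_ge_0.
          assert (Rabs (Phi (bp (S k)) - Phi (bp k)) <= Rabs (Phi (bp (S k))) + Rabs (Phi (bp k))).
          { unfold Rminus. eapply Rle_trans. apply Rabs_triang. rewrite Rabs_Ropp; lra. }
          pose proof (pow2_ge_0 (step k)). nra. }
        eapply Rle_trans. apply Rabs_triang.
        assert (Q * (5 * sqrt (bp k)) <= Q * (3 * sqrt (bp (S k)))) by (apply Rmult_le_compat_l; auto).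
        lra. }
  change (Rabs (T N) <= 4 * Q). replace N with (S K * n)%nat at 1 by lia.
  eapply Rle_trans. apply Main; lia. rewrite breakpoint_last, sqrt_1. lra.
Qed.
End Mesh.

(** * Sums over the cells *)

Lemma sum_succ (f : nat -> R) (M : nat) : sum_n_m f 1 (S M) = sum_n_m f 1 M + f (S M).
Proof. apply (sum_n_Sm f). lia. Qed.

Section Sums.
Context (N : nat).

Lemma sum_cells_plus f g : sum_cells N (fun z => f z + g z) = sum_cells N f + sum_cells N g.
Proof. unfold sum_cells. apply (sum_n_m_plus (fun j => f (Z.of_nat j - Z.of_nat N)%Z)). Qed.

Lemma sum_cells_scal k f : sum_cells N (fun z => k * f z) = k * sum_cells N f.
Proof. unfold sum_cells. apply (sum_n_m_mult_l k (fun j => f (Z.of_nat j - Z.of_nat N)%Z)). Qed.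

Lemma sum_cells_ext f g : (forall z, is_cell N z -> f z = g z) -> sum_cells N f = sum_cells N g.
Proof.
  intros H. unfold sum_cells. apply sum_n_m_ext_loc. intros k Hk. apply H. unfold is_cell. lia.
Qed.

Lemma sum_cells_le f g : (forall z, is_cell N z -> f z <= g z) -> sum_cells N f <= sum_cells N g.
Proof.
  intros H. unfold sum_cells.
  assert (G : forall M, (M <= 2 * N)%nat ->
    sum_n_m (fun j => f (Z.of_nat j - Z.of_nat N)%Z) 1 M <= sum_n_m (fun j => g (Z.of_nat j - Z.of_nat N)%Z) 1 M).
  { induction M as [|M IH]; intros HM.
    - rewrite !sum_n_m_zero by lia. lra.
    - rewrite !sum_n_Sm by lia. apply Rplus_le_compat. apply IH; lia. apply H. unfold is_cell. lia. }
  apply G. lia.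
Qed.

Lemma sum_cells_nonneg f : (forall z, is_cell N z -> 0 <= f z) -> 0 <= sum_cells N f.
Proof.
  intros H. replace 0 with (sum_cells N (fun _ => 0 * 0)). apply sum_cells_le. intros. rewrite Rmult_0_l; auto.
  rewrite sum_cells_scal. ring.
Qed.

Lemma sum_cells_term f z : (forall z, is_cell N z -> 0 <= f z) -> is_cell N z -> f z <= sum_cells N f.
Proof.
  intros H Hz. replace (f z) with (sum_cells N (fun y => if Z.eq_dec y z then f z else 0)).
  - apply sum_cells_le. intros y Hy. destruct (Z.eq_dec y z); subst; auto; lra.
  - unfold sum_cells, is_cell in *.
    set (j := Z.to_nat (z + Z.of_nat N)). assert (Hj : (1 <= j <= 2 * N)%nat) by (unfold j; lia).
    rewrite (sum_n_m_Chasles _ 1 (j - 1) (2 * N)) by lia. replace (S (j - 1)) with j by lia.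
    rewrite (sum_Sn_m _ j) by lia.
    rewrite (sum_n_m_ext_loc _ (fun _ => zero) 1 (j - 1)).
    rewrite (sum_n_m_ext_loc _ (fun _ => zero) (S j) (2 * N)).
    rewrite !sum_n_m_const_zero, plus_zero_l, plus_zero_r.
    destruct (Z.eq_dec _ _); auto. unfold j in *; lia.
    intros k Hk. destruct (Z.eq_dec _ _); auto. unfold j in *; lia.
    intros k Hk. destruct (Z.eq_dec _ _); auto. unfold j in *; lia.
Qed.

Lemma sum_cells_telescope (F : Z -> R) :
  sum_cells N (fun z => F z - F (z - 1)%Z) = F (Z.of_nat N) - F (- Z.of_nat N)%Z.
Proof.
  unfold sum_cells.
  assert (G : forall M, sum_n_m (fun j => F (Z.of_nat j - Z.of_nat N)%Z - F (Z.of_nat j - Z.of_nat N - 1)%Z) 1 M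
     = F (Z.of_nat M - Z.of_nat N)%Z - F (- Z.of_nat N)%Z).
  { induction M as [|M IH].
    - rewrite sum_n_m_zero by lia. unfold zero; simpl. ring.
    - rewrite sum_succ, IH.
      replace (Z.of_nat (S M) - Z.of_nat N - 1)%Z with (Z.of_nat M - Z.of_nat N)%Z by lia.
      real_eq. ring. }
  rewrite G. f_equal. f_equal. lia.
Qed.

Lemma is_RInt_cells (x : Z -> R) (G : R -> R) (v : Z -> R) :
  (forall z, is_cell N z -> is_RInt G (x (z - 1)%Z) (x z) (v z)) ->
  is_RInt G (x (- Z.of_nat N)%Z) (x (Z.of_nat N)) (sum_cells N v).
Proof.
  intros H. unfold sum_cells.
  assert (Gen : forall M, (M <= 2 * N)%nat ->
    is_RInt G (x (- Z.of_nat N)%Z) (x (Z.of_nat M - Z.of_nat N)%Z)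
      (sum_n_m (fun j => v (Z.of_nat j - Z.of_nat N)%Z) 1 M)).
  { induction M as [|M IH]; intros HM.
    - rewrite sum_n_m_zero by lia. apply (is_RInt_point G).
    - rewrite sum_n_Sm by lia. apply (is_RInt_Chasles G _ (x (Z.of_nat M - Z.of_nat N)%Z)). apply IH; lia.
      replace (Z.of_nat M - Z.of_nat N)%Z with (Z.of_nat (S M) - Z.of_nat N - 1)%Z by lia.
      apply H. unfold is_cell; lia. }
  specialize (Gen (2 * N)%nat ltac:(lia)).
  now replace (Z.of_nat (2 * N) - Z.of_nat N)%Z with (Z.of_nat N) in Gen by lia.
Qed.

(** Cell 1 - i, with end points x_{-i} and x_{1-i}, is the mirror image of cell i. *)
Lemma sum_cells_halves (g : Z -> R) :
  sum_cells N g = sum_n_m (fun i => g (Z.of_nat i)) 1 N + sum_n_m (fun i => g (1 - Z.of_nat i)%Z) 1 N.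
Proof.
  unfold sum_cells.
  rewrite (sum_n_m_Chasles _ 1 N (2 * N)) by lia. unfold plus; simpl. rewrite Rplus_comm. f_equal.
  - assert (G : forall M, sum_n_m (fun j => g (Z.of_nat j - Z.of_nat N)%Z) (S N) (N + M) = sum_n_m (fun i => g (Z.of_nat i)) 1 M).
    { induction M as [|M IH].
      - rewrite !sum_n_m_zero by lia. reflexivity.
      - rewrite Nat.add_succ_r, !sum_n_Sm by lia. rewrite IH. do 2 f_equal. lia. }
    rewrite Nat.add_0_r. apply G.
  - assert (G : forall M, (M <= N)%nat -> sum_n_m (fun j => g (Z.of_nat j - Z.of_nat N)%Z) (N - M + 1) N = sum_n_m (fun i => g (1 - Z.of_nat i)%Z) 1 M).
    { induction M as [|M IH]; intros HM.
      - rewrite !sum_n_m_zero by lia. reflexivity.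
      - rewrite (sum_n_Sm _ 1 M) by lia. rewrite <- IH by lia.
        replace (N - S M + 1)%nat with (N - M)%nat by lia. rewrite sum_Sn_m by lia.
        replace (N - M + 1)%nat with (S (N - M)) by lia.
        apply (eq_trans (Rplus_comm _ _)). apply (f_equal2 Rplus); [reflexivity|]. f_equal. lia. }
    rewrite <- G by lia. f_equal. lia.
Qed.
End Sums.

(** * The symmetric mesh on [-1,1] *)

Section Mesh.
Context (K N n : nat) (x : Z -> R).
Context (Hn : (0 < n)%nat).
Context (HN : N = ((K + 1) * n)%nat).
Context (Hx : forall i, x i =
  if Z.leb 0 i then half_mesh K N (Z.to_nat i) else - half_mesh K N (Z.to_nat (- i))).

Let hm := half_mesh K N.
Let H := INR (K + 1) / INR N.

Lemma mesh_nonneg (i : nat) : x (Z.of_nat i) = hm i.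
Proof. rewrite Hx, Nat2Z.id. now replace (Z.leb 0 (Z.of_nat i)) with true by (symmetry; apply Z.leb_le; lia). Qed.

Lemma mesh_nonpos (i : nat) : x (- Z.of_nat i) = - hm i.
Proof.
  destruct i as [|i].
  - change (- Z.of_nat 0)%Z with (Z.of_nat 0). rewrite mesh_nonneg. unfold hm. rewrite (half_mesh_0 K N n Hn HN). ring.
  - rewrite Hx. replace (Z.leb 0 (- Z.of_nat (S i))) with false by (symmetry; apply Z.leb_gt; lia).
    now rewrite Z.opp_involutive, Nat2Z.id.
Qed.

Lemma mesh_left : x (- Z.of_nat N) = -1.
Proof. rewrite mesh_nonpos. unfold hm. rewrite (half_mesh_N K N n Hn HN). ring. Qed.

Lemma mesh_right : x (Z.of_nat N) = 1.
Proof. rewrite mesh_nonneg. unfold hm. now rewrite (half_mesh_N K N n Hn HN). Qed.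

Lemma cell_half z : is_cell N z -> exists i, (i < N)%nat /\
  ((x (z - 1)%Z = hm i /\ x z = hm (S i)) \/ (x (z - 1)%Z = - hm (S i) /\ x z = - hm i)).
Proof.
  unfold is_cell. intros Hz. destruct (Z_lt_le_dec 0 z).
  - exists (Z.to_nat (z - 1)). split. lia. left. rewrite <- !mesh_nonneg. split; f_equal; lia.
  - exists (Z.to_nat (- z)). split. lia. right. rewrite <- !mesh_nonpos. split; f_equal; lia.
Qed.

(** [rho] is the modulus of the end point farther from 0. One alternative separates the cells
    touching 0 from those on which |y| is comparable to rho; the other separates cells with h = O(H
    |y|) from the innermost block. *)
Lemma cell_geometry z : is_cell N z ->
  let l := x (z - 1)%Z in let r := x z in
  l < r /\ -1 <= l /\ r <= 1 /\ exists rho, r - l <= rho /\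
    (forall y, l <= y <= r -> Rabs y <= rho) /\
    ((rho <= r - l /\ (l = 0 \/ r = 0)) \/ (forall y, l <= y <= r -> rho <= 10 * Rabs y)) /\
    ((forall y, l <= y <= r -> r - l <= 10 * H * Rabs y) \/
     (r - l = / 10 ^ K * H /\ rho <= / 10 ^ K)).
Proof.
  intros Hz. destruct (cell_half z Hz) as [i [Hi E]].
  destruct (half_cell_geometry K N n Hn HN i Hi) as [[G0 G1] [G2 [G3 G4]]]. fold hm in G0, G1, G2, G3, G4. fold H in G4.
  pose proof (mesh_ratio_range K N n Hn HN) as HH. fold H in HH.
  replace (breakpoint K 1) with (/ 10 ^ K) in G4 by (unfold breakpoint; now rewrite Nat.sub_0_r).
  set (L := hm i) in *. set (R0 := hm (S i)) in *. simpl.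
  assert (Ab : forall y, x (z - 1)%Z <= y <= x z -> L <= Rabs y <= R0).
  { intros y Hy. destruct E as [[E1 E2]|[E1 E2]]; rewrite E1, E2 in Hy.
    - rewrite Rabs_pos_eq; lra.
    - rewrite Rabs_left1; lra. }
  assert (Ed : x z - x (z - 1)%Z = R0 - L) by (destruct E as [[E1 E2]|[E1 E2]]; rewrite E1, E2; ring).
  assert (Ez : L = 0 -> x (z - 1)%Z = 0 \/ x z = 0).
  { intros E0. rewrite E0 in *. destruct E as [[E1 E2]|[E1 E2]]; rewrite E1, E2; [left|right]; lra. }
  rewrite Ed. split; [lra|]. split; [destruct E as [[E1 E2]|[E1 E2]]; rewrite ?E1, ?E2; lra|].
  split; [destruct E as [[E1 E2]|[E1 E2]]; rewrite ?E1, ?E2; lra|].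
  exists R0. split; [lra|]. split; [intros y Hy; now apply Ab|]. split.
  - destruct G3 as [G3|G3].
    + left. split; auto. lra.
    + right. intros y Hy. specialize (Ab y Hy). lra.
  - destruct G4 as [[G4 G5]|G4].
    + right. auto.
    + left. intros y Hy. specialize (Ab y Hy). assert (0 <= H * L) by nra.
      assert (H * L <= H * Rabs y) by nra. lra.
Qed.

(** The left half is the right half for -Phi(-y), whose increments over a cell are those of Phi over
    the mirrored cell. *)
Lemma weighted_telescope (Phi : R -> R) (Q : R) :
  0 <= Q -> Phi 0 = 0 ->
  (forall z t, is_cell N z -> t = x (z - 1)%Z \/ t = x z -> x z - x (z - 1)%Z <= 10 * H * Rabs t ->
     (x z - x (z - 1)%Z) ^ 2 * Rabs (Phi t) <= Q * sqrt (Rabs t)) ->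
  Rabs (sum_cells N (fun z => (x z - x (z - 1)%Z) ^ 2 * (Phi (x z) - Phi (x (z - 1)%Z)))) <= 8 * Q.
Proof.
  intros HQ H0 HPhi.
  assert (Pos : forall i, (i < N)%nat -> 0 <= hm i /\ 0 <= hm (S i)).
  { intros i Hi. destruct (half_cell_geometry K N n Hn HN i Hi) as [[G0 G1] _]. fold hm in G0, G1. lra. }
  rewrite sum_cells_halves. eapply Rle_trans. apply Rabs_triang.
  replace (8 * Q) with (4 * Q + 4 * Q) by ring. apply Rplus_le_compat.
  - rewrite (sum_n_m_ext_loc _ (fun i => (hm i - hm (i - 1)) ^ 2 * (Phi (hm i) - Phi (hm (i - 1))))).
    + apply (half_telescope K N n Hn HN Phi Q HQ H0). intros i z Hi Hz Hh. fold hm in Hz, Hh |- *. fold H in Hh.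
      destruct (Pos i Hi) as [P1 P2].
      assert (Hz0 : 0 <= z) by (destruct Hz; subst; auto).
      specialize (HPhi (Z.of_nat (S i)) z ltac:(unfold is_cell; lia)).
      replace (Z.of_nat (S i) - 1)%Z with (Z.of_nat i) in HPhi by lia.
      rewrite !mesh_nonneg, !(Rabs_pos_eq z) in HPhi by auto. apply HPhi; auto.
    + intros k Hk. rewrite mesh_nonneg. replace (Z.of_nat k - 1)%Z with (Z.of_nat (k - 1)) by lia.
      now rewrite mesh_nonneg.
  - rewrite (sum_n_m_ext_loc _ (fun i => (hm i - hm (i - 1)) ^ 2 * (- Phi (- hm i) - - Phi (- hm (i - 1))))).
    + apply (half_telescope K N n Hn HN (fun y => - Phi (- y)) Q HQ). rewrite Ropp_0, H0; ring.
      intros i z Hi Hz Hh. fold hm in Hz, Hh |- *. fold H in Hh.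
      destruct (Pos i Hi) as [P1 P2].
      assert (Hz0 : 0 <= z) by (destruct Hz; subst; auto).
      specialize (HPhi (- Z.of_nat i)%Z (- z) ltac:(unfold is_cell; lia)).
      replace (- Z.of_nat i - 1)%Z with (- Z.of_nat (S i))%Z in HPhi by lia.
      rewrite !mesh_nonpos, !Rabs_Ropp, !(Rabs_pos_eq z) in HPhi by auto.
      rewrite Rabs_Ropp. replace (hm (S i) - hm i) with (- hm i - - hm (S i)) in * by ring.
      apply HPhi; auto. destruct Hz; subst; auto.
    + intros k Hk. replace (1 - Z.of_nat k)%Z with (- Z.of_nat (k - 1))%Z by lia.
      replace (- Z.of_nat (k - 1) - 1)%Z with (- Z.of_nat k)%Z by lia.
      rewrite !mesh_nonpos. apply f_equal2; [|ring]. ring.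
Qed.
End Mesh.

(** * The size of the innermost interval and the regime of each cell *)

Lemma calK_bounds (eps lambda : R) (N : nat) :
  0 < eps <= 1 -> 0 < lambda < 2 -> (0 < N)%nat ->
  let K := calK eps lambda N in
  ((/ 10 ^ K) ^ 2 <= Rpower eps (1 - lambda / 2) \/ / 10 ^ K <= / INR N ^ 3) /\
  INR K <= 1 + 3 * ln (INR N).
Proof.
  intros He Hl HN K. set (s := Defs.sigma eps lambda N).
  assert (HN1 : 1 <= INR N) by (apply (le_INR 1); lia).
  assert (HN3 : 1 <= INR N ^ 3) by (apply pow_R1_Rle; auto).
  set (w := Rpower eps ((1 - lambda / 2) / 2)).
  assert (Hw : 0 < w <= 1).
  { split. apply Rpower_pos. apply Rle_trans with (Rpower 1 ((1 - lambda / 2) / 2)).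
    apply Rle_Rpower_l; lra. unfold Rpower. rewrite ln_1, Rmult_0_r, exp_0; lra. }
  assert (Hi : 0 < / INR N ^ 3 <= 1).
  { split. apply Rinv_0_lt_compat; lra. rewrite <- Rinv_1. apply Rinv_le_contravar; lra. }
  assert (Hs : 0 < s <= 1).
  { unfold s, Defs.sigma. fold w. split. eapply Rlt_le_trans. apply Hw. apply Rmax_l.
    apply Rmax_lub; lra. }
  assert (Hln : ln s <= 0).
  { rewrite <- ln_1. destruct (Rle_lt_or_eq_dec s 1 (proj2 Hs)) as [H|H].
    left; apply ln_increasing; lra. rewrite H; lra. }
  assert (L10 : 1 <= ln 10).
  { rewrite <- (ln_exp 1). pose proof exp_le_3. left; apply ln_increasing. apply exp_pos. lra. }
  set (A := 1 - ln s / ln 10).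
  assert (HA : 1 <= A).
  { unfold A, Rdiv. assert (0 < / ln 10) by (apply Rinv_0_lt_compat; lra). nra. }
  destruct (base_Int_part A) as [B1 B2].
  assert (Hip : (0 <= Int_part A)%Z).
  { apply le_IZR. assert (0 < IZR (Int_part A)) by lra. simpl. lra. }
  assert (EK : INR K = IZR (Int_part A)).
  { unfold K, calK. fold s. fold A. rewrite INR_IZR_INZ, Z2Nat.id; auto. }
  rewrite <- EK in B1, B2.
  (* The floor leaves K > -ln s / ln 10. *)
  assert (HS : / 10 ^ K <= s).
  { rewrite <- (exp_ln s) by lra. rewrite <- Rpower_pow by lra. unfold Rpower.
    rewrite <- exp_Ropp. apply exp_monotone.
    assert (ln s / ln 10 * ln 10 = ln s) by (field; lra).
    assert (- ln s / ln 10 <= INR K) by (unfold A in *; lra).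
    assert (- ln s / ln 10 * ln 10 <= INR K * ln 10) by (apply Rmult_le_compat_r; lra).
    replace (- ln s / ln 10 * ln 10) with (- ln s) in H1 by (field; lra). lra. }
  split.
  - destruct (Rle_dec (/ INR N ^ 3) w) as [H|H].
    + left. assert (Es : s = w) by (unfold s, Defs.sigma; fold w; apply Rmax_left; auto).
      replace (Rpower eps (1 - lambda / 2)) with (w ^ 2).
      apply pow_incr. split. left; apply Rinv_0_lt_compat, pow_lt; lra. lra.
      unfold w. simpl. rewrite Rmult_1_r, <- Rpower_plus. f_equal. field.
    + right. assert (Es : s = / INR N ^ 3) by (unfold s, Defs.sigma; fold w; apply Rmax_right; lra). lra.
  - assert (Hls : - (3 * ln (INR N)) <= ln s).
    { replace (- (3 * ln (INR N))) with (ln (/ INR N ^ 3)).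
      destruct (Rle_lt_or_eq_dec (/ INR N ^ 3) s) as [H|H].
      - unfold s, Defs.sigma. apply Rmax_r.
      - left. apply ln_increasing; lra.
      - rewrite H; lra.
      - rewrite ln_Rinv by lra. rewrite ln_pow by lra. simpl; ring. }
    assert (Hln0 : 0 <= ln (INR N)).
    { rewrite <- ln_1. destruct HN1 as [H|H]. left; apply ln_increasing; lra. rewrite H; lra. }
    eapply Rle_trans. exact B1. unfold A, Rdiv.
    assert (0 < / ln 10 <= 1).
    { split. apply Rinv_0_lt_compat; lra. rewrite <- Rinv_1. apply Rinv_le_contravar; lra. }
    nra.
Qed.

(* [Dd] distributes the admissible consistency error over the cells: the extra mass
   in the inner interval is available only when S <= H^3. *)
Lemma error_distribution (S H om : R) :
  0 < S -> 0 < H -> S ^ 2 <= om \/ S <= H ^ 3 ->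
  exists Dd : R -> R,
    (forall l r, l <= r -> H ^ 3 * (r - l) <= Dd r - Dd l) /\ Dd 1 - Dd (-1) <= 4 * H ^ 3 /\
    (S ^ 2 <= om \/ forall l r, - S <= l -> l <= r -> r <= S -> r - l <= Dd r - Dd l).
Proof.
  intros HS HH Hc. assert (HH3 : 0 < H ^ 3) by (apply pow_lt; auto).
  destruct (Rle_dec (S ^ 2) om) as [Ho|Ho].
  - exists (fun y => H ^ 3 * y). split; [|split]; auto. intros; lra. lra.
  - destruct Hc as [|Hc]; [contradiction|].
    (* The second summand has slope 1 on [-S,S] and is constant outside; its total increase 2 S <= 2
       H^3 fits the budget. *)
    exists (fun y => H ^ 3 * y + Rmax (- S) (Rmin S y)). split; [|split].
    + intros l r Hlr. assert (Rmax (- S) (Rmin S l) <= Rmax (- S) (Rmin S r)); [|lra].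
      unfold Rmax, Rmin; repeat destruct Rle_dec; lra.
    + assert (Rmax (- S) (Rmin S 1) <= S) by (unfold Rmax, Rmin; repeat destruct Rle_dec; lra).
      pose proof (Rmax_l (- S) (Rmin S (-1))). lra.
    + right. intros l r Hl Hlr Hr. assert (0 <= H ^ 3 * (r - l)) by (apply Rmult_le_pos; lra).
      unfold Rmax, Rmin; repeat destruct Rle_dec; lra.
Qed.

Lemma coefficient_bounds {a a1 a2 c c1 c2 f f1 f2 b gamma} :
  regular_data a a1 a2 c c1 c2 f f1 f2 b gamma ->
  exists K, 1 <= K /\ forall y, cI y ->
    Rabs (a y) <= K * Rabs y /\ Rabs (a1 y) <= K /\ Rabs (c y) <= K.
Proof.
  intros D. destruct (data_bounds D) as [K [HK HB]].
  exists K. split; auto. intros y Hy.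
  destruct (HB y Hy) as [B1 [_ [B2 _]]]. split; auto.
  destruct (MVT_zero a a1 y Hy (rd_a D)) as [z [Hz [_ Ez]]].
  assert (E0 : a 0 = 0) by (rewrite (rd_ab D) by (unfold cI; lra); ring).
  rewrite E0, Rminus_0_r in Ez. rewrite Ez, Rabs_mult.
  apply Rmult_le_compat_r. apply Rabs_pos. now apply HB.
Qed.

(** [om] stands for eps^(1 - lambda/2). The energy argument sees lambda only through this weight. *)
Definition solution_bounds (eps om M : R) (u u1 u2 u3 : R -> R) : Prop :=
  forall x, cI x ->
    Rabs (u x) <= M /\ Rabs x * Rabs (u1 x) <= M /\
    Rabs x ^ 2 * Rabs (u2 x) <= M /\ sqrt eps * Rabs x * Rabs (u2 x) <= M /\
    Rabs x ^ 3 * Rabs (u3 x) <= M /\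
    om * Rabs (u2 x) <= M /\ om * (Rabs x * Rabs (u3 x)) <= M.

(** In the outer blocks |y| is comparable to rho and h <= 10 H rho, so u'' and u''' of sizes rho^-2
    and rho^-3 fit; the worst constant is 100 times 10^3, the origin of 100000. In the innermost
    block h = S H: if S^2 <= om, the bounds M/om for u'' and 10 M/(om rho) for u''' take over;
    otherwise the cell is charged to [Dd] with its full length. *)
Lemma cell_regimes (eps om M l r rho H S : R) (Dd u u1 u2 u3 : R -> R) :
  solution_bounds eps om M u u1 u2 u3 -> (forall x, continuous u3 x) ->
  l < r -> -1 <= l -> r <= 1 -> 0 < om -> 1 <= M -> 0 < H ->
  r - l <= rho -> (forall y, l <= y <= r -> Rabs y <= rho) ->
  (rho <= r - l /\ (l = 0 \/ r = 0) \/ (forall y, l <= y <= r -> rho <= 10 * Rabs y)) ->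
  ((forall y, l <= y <= r -> r - l <= 10 * H * Rabs y) \/ (r - l = S * H /\ rho <= S)) ->
  (S ^ 2 <= om \/ forall l r, - S <= l -> l <= r -> r <= S -> r - l <= Dd r - Dd l) ->
  (exists M2 M3, (forall y, l <= y <= r -> Rabs (u2 y) <= M2) /\
     (forall y, l <= y <= r -> Rabs (u3 y) <= M3) /\
     (r - l) ^ 2 * M2 <= 100000 * M * H ^ 2 /\ (r - l) * rho * M2 <= 100000 * M * H /\
     ((r - l) ^ 2 * rho * M3 <= 100000 * M * H ^ 2 \/ rho <= r - l))
  \/ r - l <= Dd r - Dd l.
Proof.
  intros Hu Cu3 Hlr Hl Hr Hom HM HH Hhr Hrho Hgeo Hsize HS.
  set (h := r - l) in *. assert (Hh : 0 < h) by (unfold h; lra).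
  assert (HcI : forall y, l <= y <= r -> cI y) by (intros; unfold cI; lra).
  destruct Hsize as [Hout|[Eh HrS]].
  - left.
    assert (Hreg : forall y, l <= y <= r -> rho <= 10 * Rabs y).
    { destruct Hgeo as [[_ Hg]|Hg]; auto. exfalso.
      assert (h <= 10 * H * Rabs 0). { destruct Hg; apply Hout; lra. }
      rewrite Rabs_R0 in H0. lra. }
    assert (Hh10 : h <= 10 * H * rho).
    { apply Rle_trans with (10 * H * Rabs l). apply Hout; lra.
      apply Rmult_le_compat_l. lra. apply Hrho; lra. }
    assert (Hrho0 : 0 < rho) by lra.
    assert (HMr : 0 < M / rho ^ 2) by (apply Rdiv_lt_0_compat; [lra|apply pow_lt; lra]).
    assert (HMr3 : 0 < M / rho ^ 3) by (apply Rdiv_lt_0_compat; [lra|apply pow_lt; lra]).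
    assert (Hh2 : h ^ 2 <= 100 * H ^ 2 * rho ^ 2).
    { replace (100 * H ^ 2 * rho ^ 2) with ((10 * H * rho) ^ 2) by ring. apply pow_incr; lra. }
    assert (HHM : 0 <= M * H ^ 2) by (apply Rmult_le_pos; [lra|apply pow2_ge_0]).
    assert (Inv : forall y, l <= y <= r -> forall n v, Rabs y ^ n * Rabs v <= M -> Rabs v <= 10 ^ n * (M / rho ^ n)).
    { intros y Hy n v Hv. specialize (Hreg y Hy). pose proof (Rabs_pos v) as Hv0.
      assert (Hp : 0 < rho ^ n) by (apply pow_lt; auto).
      apply Rmult_le_reg_l with (rho ^ n); auto.
      apply Rle_trans with ((10 * Rabs y) ^ n * Rabs v).
      - apply Rmult_le_compat_r; auto. apply pow_incr; lra.
      - rewrite Rpow_mult_distr. replace (rho ^ n * (10 ^ n * (M / rho ^ n))) with (10 ^ n * M) by (field; lra).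
        rewrite Rmult_assoc. apply Rmult_le_compat_l; auto. apply pow_le; lra. }
    exists (10 ^ 2 * (M / rho ^ 2)), (10 ^ 3 * (M / rho ^ 3)).
    split; [|split; [|split; [|split]]].
    + intros y Hy. apply (Inv y Hy). now apply Hu, HcI.
    + intros y Hy. apply (Inv y Hy). now apply Hu, HcI.
    + apply Rle_trans with (100 * H ^ 2 * rho ^ 2 * (10 ^ 2 * (M / rho ^ 2))).
      apply Rmult_le_compat_r; lra.
      replace (100 * H ^ 2 * rho ^ 2 * (10 ^ 2 * (M / rho ^ 2))) with (10000 * (M * H ^ 2)) by (field; lra). lra.
    + apply Rle_trans with (10 * H * rho * rho * (10 ^ 2 * (M / rho ^ 2))).
      apply Rmult_le_compat_r. lra. apply Rmult_le_compat_r; lra.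
      replace (10 * H * rho * rho * (10 ^ 2 * (M / rho ^ 2))) with (1000 * (M * H)) by (field; lra). nra.
    + left. apply Rle_trans with (100 * H ^ 2 * rho ^ 2 * rho * (10 ^ 3 * (M / rho ^ 3))).
      apply Rmult_le_compat_r. lra. apply Rmult_le_compat_r; lra.
      right. field. lra.
  - destruct HS as [HS|HS].
    + left. assert (HS0 : 0 < S) by nra.
      assert (HMo : 0 < M / om) by (apply Rdiv_lt_0_compat; lra).
      assert (B2 : forall y, l <= y <= r -> Rabs (u2 y) <= M / om).
      { intros y Hy. apply Rmult_le_reg_l with om; auto. replace (om * (M / om)) with M by (field; lra).
        now apply Hu, HcI. }
      assert (Som : S ^ 2 * (M / om) <= M).
      { apply Rle_trans with (om * (M / om)). apply Rmult_le_compat_r; lra. right; field; lra. }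
      assert (HH2 : 0 <= H ^ 2) by apply pow2_ge_0.
      assert (Q1 : h ^ 2 * (M / om) <= 100000 * M * H ^ 2).
      { rewrite Eh. replace ((S * H) ^ 2 * (M / om)) with (S ^ 2 * (M / om) * H ^ 2) by ring. nra. }
      assert (Q2 : h * rho * (M / om) <= 100000 * M * H).
      { apply Rle_trans with (S * H * S * (M / om)).
        - rewrite Eh. apply Rmult_le_compat_r. lra. apply Rmult_le_compat_l; nra.
        - replace (S * H * S * (M / om)) with (S ^ 2 * (M / om) * H) by ring. nra. }
      destruct Hgeo as [[Hg _]|Hg].
      (* On a cell at 0, [M3] is just some bound for u''' on the cell; the alternative rho <= h is
         what is proved there. *)
      * destruct (continuous_bounded u3 l r ltac:(lra) (fun x _ => Cu3 x)) as [M3 [_ HM3]].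
        exists (M / om), M3. split; [|split; [|split; [|split]]]; auto.
      * exists (M / om), (10 * (M / om) / rho). split; [|split; [|split; [|split]]]; auto.
        -- intros y Hy. specialize (Hg y Hy). pose proof (Rabs_pos (u3 y)) as U3.
           assert (G : om * (Rabs y * Rabs (u3 y)) <= M) by now apply Hu, HcI.
           apply Rmult_le_reg_l with rho. lra. replace (rho * (10 * (M / om) / rho)) with (10 * (M / om)) by (field; lra).
           apply Rle_trans with (10 * (Rabs y * Rabs (u3 y))). nra.
           apply Rmult_le_compat_l. lra. apply Rmult_le_reg_l with om; auto.
           replace (om * (M / om)) with M by (field; lra). auto.
        -- left. replace (h ^ 2 * rho * (10 * (M / om) / rho)) with (10 * (h ^ 2 * (M / om))) by (field; lra).
           rewrite Eh. replace ((S * H) ^ 2 * (M / om)) with (S ^ 2 * (M / om) * H ^ 2) by ring. nra.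
    + right. pose proof (Hrho l ltac:(lra)) as R1. pose proof (Hrho r ltac:(lra)) as R2.
      apply Rabs_le_between in R1. apply Rabs_le_between in R2. apply HS; lra.
Qed.

(** Both regimes are charged to the increment of [Dd], which dominates H^3 h on every cell and h on
    the rough ones. C is the constant of [rough_cell], the larger of the two. *)
Lemma cell_estimate (a a1 c u u1 u2 u3 Dd : R -> R) (eps om delta K M gamma l r P Q p q rho H S : R) :
  solution_bounds eps om M u u1 u2 u3 ->
  (forall x, is_derive a x (a1 x)) -> (forall x, continuous a1 x) -> (forall x, continuous c x) ->
  (forall x, is_derive u x (u1 x)) -> (forall x, is_derive u1 x (u2 x)) ->
  (forall x, is_derive u2 x (u3 x)) -> (forall x, continuous u3 x) ->
  (forall y, cI y -> Rabs (a y) <= K * Rabs y /\ Rabs (a1 y) <= K /\ Rabs (c y) <= K) ->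
  0 < eps -> 0 <= delta <= H -> eps * delta <= (r - l) ^ 2 -> 1 <= K -> 0 < gamma ->
  P + Q * l = u l -> P + Q * r = u r ->
  l < r -> -1 <= l -> r <= 1 -> 0 < om -> 1 <= M -> 0 < H <= 1 ->
  r - l <= rho -> (forall y, l <= y <= r -> Rabs y <= rho) ->
  (rho <= r - l /\ (l = 0 \/ r = 0) \/ (forall y, l <= y <= r -> rho <= 10 * Rabs y)) ->
  ((forall y, l <= y <= r -> r - l <= 10 * H * Rabs y) \/ (r - l = S * H /\ rho <= S)) ->
  (S ^ 2 <= om \/ forall l r, - S <= l -> l <= r -> r <= S -> r - l <= Dd r - Dd l) ->
  H ^ 3 * (r - l) <= Dd r - Dd l ->
  let C := 2 * (44 * K * (100000 * M)) ^ 2 / gamma + 170 * (K * (100000 * M)) ^ 2 in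
  Rabs (cell_error eps delta a c u u1 u2 l r P Q p q
        + (r - l) ^ 2 / 12 * (a r * u2 r * (p + q * r) - a l * u2 l * (p + q * l)))
  <= gamma / 8 * RInt (fun y => (p + q * y) ^ 2) l r + / 2 * (eps * q ^ 2 * (r - l))
     + / 4 * (delta * RInt (fun y => (a y * q) ^ 2) l r) + C * (Dd r - Dd l)
  /\ RInt (fun y => (P + Q * y - u y) ^ 2) l r <= C * (Dd r - Dd l).
Proof.
  intros Hu Da Ca1 Cc Du Du1 Du2 Cu3 Hco He Hd Hed HK Hg HPl HPr Hlr Hl Hr Hom HM HH Hhr Hrho Hgeo Hsize HS HDd C.
  assert (HcI : forall y, l <= y <= r -> cI y) by (intros; unfold cI; lra).
  assert (Hco' : forall y, l <= y <= r -> Rabs (a y) <= K * Rabs y /\ Rabs (a1 y) <= K /\ Rabs (c y) <= K)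
    by (intros; auto).
  assert (Cu : forall x, continuous u x) by (intros; cont).
  set (M' := 100000 * M) in *. assert (HM' : 1 <= M') by (unfold M'; lra).
  assert (HKM : 1 <= K * M') by nra.
  assert (HKM2 : M' ^ 2 <= (K * M') ^ 2) by (apply pow_incr; nra).
  assert (Hgi : 0 < / gamma) by now apply Rinv_0_lt_compat.
  assert (G1 : 0 <= 2 * (44 * K * M') ^ 2 / gamma).
  { apply Rmult_le_pos; [|lra]. pose proof (pow2_ge_0 (44 * K * M')). lra. }
  assert (HC4 : 4 * M' ^ 2 <= C) by (unfold C; pose proof (pow2_ge_0 (K * M')); lra).
  assert (HC0 : 0 <= C) by (pose proof (pow2_ge_0 M'); lra).
  assert (HCs : 2 * (31 * K * M') ^ 2 / gamma + 5 * (K * M') ^ 2 <= C).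
  { unfold C. apply Rplus_le_compat.
    - apply Rmult_le_compat_r. lra. apply Rmult_le_compat_l. lra. apply pow_incr. split; nra.
    - apply Rmult_le_compat_r. apply pow2_ge_0. lra. }
  assert (Hh : 0 < r - l) by lra.
  destruct (cell_regimes eps om M l r rho H S Dd u u1 u2 u3) as [[M2 [M3 [B2 [B3 [S1 [S2 S3]]]]]]|Hrough]; auto; try lra.
  - fold M' in S1, S2, S3. split.
    + eapply Rle_trans.
      apply (smooth_cell a a1 c u u1 u2 u3 eps delta K l r P Q p q Hlr Da Ca1 Cc Du Du1 Du2 Cu3 HPl HPr He (proj1 Hd)
        HK rho Hhr Hrho Hco' H M' gamma HH HM' Hg (proj2 Hd) M2 M3 B2 B3 Hed S1 S2 S3).
      apply Rplus_le_compat_l. rewrite Rmult_assoc.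
      apply Rmult_le_compat; auto.
      * apply Rle_trans with (2 * (31 * K * M') ^ 2 / gamma).
        apply Rmult_le_pos; [|lra]. pose proof (pow2_ge_0 (31 * K * M')). lra.
        pose proof (pow2_ge_0 (K * M')). lra.
      * apply Rmult_le_pos; [apply pow_le|]; lra.
    + apply Rle_trans with (M' ^ 2 * (H ^ 3 * (r - l))).
      * pose proof (interpolation_bound u u1 u2 l r P Q M2 Hlr Du Du1 HPl HPr B2) as HI.
        replace (M' ^ 2 * (H ^ 3 * (r - l))) with ((r - l) * (M' ^ 2 * H ^ 3)) by ring.
        eapply Rle_trans. apply Rle_abs. apply RInt_bound. lra. intros; cont.
        intros y Hy. destruct (HI y Hy) as [I1 _].
        rewrite Rabs_pos_eq by apply pow2_ge_0. rewrite <- pow2_abs.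
        apply Rle_trans with ((M' * H ^ 2) ^ 2).
        -- apply pow_incr. split. apply Rabs_pos. lra.
        -- replace ((M' * H ^ 2) ^ 2) with (M' ^ 2 * (H ^ 3 * H)) by ring.
           apply Rmult_le_compat_l. apply pow2_ge_0. assert (0 <= H ^ 3) by (apply pow_le; lra). nra.
      * apply Rmult_le_compat; auto. apply pow2_ge_0. apply Rmult_le_pos; [apply pow_le|]; lra.
        pose proof (pow2_ge_0 M'). lra.
  - assert (Hu' : forall y, l <= y <= r -> Rabs (u y) <= M' /\ Rabs y * Rabs (u1 y) <= M' /\
     Rabs y ^ 2 * Rabs (u2 y) <= M' /\ sqrt eps * Rabs y * Rabs (u2 y) <= M').
    { intros y Hy. destruct (Hu y (HcI y Hy)) as [U0 [U1 [U2 [U3 _]]]]. unfold M'. lra. }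
    split.
    + eapply Rle_trans.
      apply (rough_cell a a1 c u u1 u2 u3 eps delta K l r P Q p q Hlr Da Cc Du Du1 Du2 HPl HPr He (proj1 Hd)
        HK rho Hhr Hrho Hco' H M' gamma HH HM' Hg (proj2 Hd) Hu' Hgeo).
      apply Rplus_le_compat_l. apply Rmult_le_compat_l; auto.
    + apply Rle_trans with (4 * M' ^ 2 * (r - l)).
      * replace (4 * M' ^ 2 * (r - l)) with ((r - l) * (2 * M') ^ 2) by ring.
        eapply Rle_trans. apply Rle_abs. apply RInt_bound. lra. intros; cont.
        intros y Hy. rewrite Rabs_pos_eq by apply pow2_ge_0. rewrite <- pow2_abs.
        apply pow_incr. split. apply Rabs_pos.
        destruct (Hu' y Hy) as [U0 _]. destruct (Hu' l ltac:(lra)) as [Ul _]. destruct (Hu' r ltac:(lra)) as [Ur _].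
        pose proof (interpolant_bound u l r P Q M' y Hlr HPl HPr Ul Ur Hy) as B.
        unfold Rminus. eapply Rle_trans. apply Rabs_triang. rewrite Rabs_Ropp. lra.
      * apply Rmult_le_compat; auto. pose proof (pow2_ge_0 M'); lra. lra.
Qed.

(** * Global estimate *)

(** [in_VN] provides affine coefficients only existentially and on the open cell. Reading them off
    from nodal values makes slope and intercept functions of v that are compatible with
    differences. *)
Definition slope (x : Z -> R) (v : R -> R) (z : Z) : R :=
  (v (x z) - v (x (z - 1)%Z)) / (x z - x (z - 1)%Z).

Definition icept (x : Z -> R) (v : R -> R) (z : Z) : R :=
  v (x (z - 1)%Z) - slope x v z * x (z - 1)%Z.

Lemma cell_form_sub eps delta a c l r p1 q1 p2 q2 p q :
  (forall y, continuous a y) -> (forall y, continuous c y) ->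
  cell_form eps delta a c l r (p1 - p2) (q1 - q2) p q
  = cell_form eps delta a c l r p1 q1 p q - cell_form eps delta a c l r p2 q2 p q.
Proof.
  intros Ca Cc. unfold cell_form.
  assert (E1 : forall p1 q1 p2 q2,
    RInt (fun y => eps * (q1 - q2) * q + a y * (q1 - q2) * (p + q * y)
                   + c y * (p1 - p2 + (q1 - q2) * y) * (p + q * y)) l r
    = RInt (fun y => eps * q1 * q + a y * q1 * (p + q * y) + c y * (p1 + q1 * y) * (p + q * y)) l r
      - RInt (fun y => eps * q2 * q + a y * q2 * (p + q * y) + c y * (p2 + q2 * y) * (p + q * y)) l r).
  { intros. rewrite <- RInt_sub by (intros; cont). apply RInt_ext. intros; real_eq; ring. }
  assert (E2 :
    RInt (fun y => (a y * (q1 - q2) + c y * (p1 - p2 + (q1 - q2) * y)) * (a y * q)) l r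
    = RInt (fun y => (a y * q1 + c y * (p1 + q1 * y)) * (a y * q)) l r
      - RInt (fun y => (a y * q2 + c y * (p2 + q2 * y)) * (a y * q)) l r).
  { rewrite <- RInt_sub by (intros; cont). apply RInt_ext. intros; real_eq; ring. }
  rewrite E1, E2. ring.
Qed.

Lemma in_VN_sub N x v w : in_VN N x v -> in_VN N x w -> in_VN N x (fun y => v y - w y).
Proof.
  intros [Cv [Vl [Vr Va]]] [Cw [Wl [Wr Wa]]]. split; [|split; [|split]].
  - intros y Hy. apply (filterlim_comp_2 (G := locally (v y)) (H := locally (opp (w y))) v (fun t => opp (w t)) plus).
    + now apply Cv.
    + apply (filterlim_comp _ _ _ w opp _ (locally (w y))). now apply Cw. apply (filterlim_opp (w y)).
    + apply (filterlim_plus (v y) (opp (w y))).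
  - rewrite Vl, Wl; ring.
  - rewrite Vr, Wr; ring.
  - intros i Hi. destruct (Va i Hi) as [p [q Hpq]]. destruct (Wa i Hi) as [p' [q' Hpq']].
    exists (p - p'), (q - q'). intros y Hy. rewrite Hpq, Hpq' by auto. ring.
Qed.

Section Cells.
Context (N : nat) (x : Z -> R).
Context (Hcell : forall z, is_cell N z -> x (z - 1)%Z < x z /\ -1 <= x (z - 1)%Z /\ x z <= 1).
Context (Hleft : x (- Z.of_nat N)%Z = -1).
Context (Hright : x (Z.of_nat N) = 1).

(** Integrands containing [Derive] are uncontrolled at the nodes; they are compared with continuous
    functions on open cells only, which determines the integral. *)
Lemma RInt_cells (G : R -> R) (g : Z -> R -> R) :
  (forall z, is_cell N z -> forall y, continuous (g z) y) ->
  (forall z y, is_cell N z -> x (z - 1)%Z < y < x z -> G y = g z y) ->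
  RInt G (-1) 1 = sum_cells N (fun z => RInt (g z) (x (z - 1)%Z) (x z)).
Proof.
  intros Cg E. apply is_RInt_unique. rewrite <- Hleft, <- Hright at 1.
  apply is_RInt_cells. intros z Hz. destruct (Hcell z Hz) as [H1 _].
  apply (is_RInt_ext (g z)).
  - rewrite Rmin_left, Rmax_right by lra. intros y Hy. symmetry. now apply E.
  - apply RInt_cont_correct. now apply Cg.
Qed.

Lemma VN_affine v z y : in_VN N x v -> is_cell N z -> x (z - 1)%Z <= y <= x z ->
  v y = icept x v z + slope x v z * y.
Proof.
  intros [Cv [_ [_ Va]]] Hz Hy. destruct (Va z Hz) as [p [q Hpq]]. destruct (Hcell z Hz) as [H1 [H2 H3]].
  assert (E : forall t, x (z - 1)%Z <= t <= x z -> v (clamp t) = p + q * t).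
  { apply (closed_eq_on _ _ (fun t => v (clamp t)) (fun t => p + q * t)); auto.
    - apply continuous_clamp; auto.
    - intros; cont.
    - intros t Ht. rewrite clamp_id by (unfold cI; lra). auto. }
  assert (E' : forall t, x (z - 1)%Z <= t <= x z -> v t = p + q * t).
  { intros t Ht. rewrite <- E by auto. rewrite clamp_id; auto. unfold cI; lra. }
  unfold icept, slope. rewrite (E' y), (E' (x z)), (E' (x (z - 1)%Z)) by lra. field. lra.
Qed.

Lemma VN_derive v z y : in_VN N x v -> is_cell N z -> x (z - 1)%Z < y < x z ->
  Derive v y = slope x v z /\ Derive_n v 2 y = 0.
Proof.
  intros Hv Hz Hy.
  assert (D1 : forall t, x (z - 1)%Z < t < x z -> Derive v t = slope x v z).
  { intros t Ht. transitivity (Derive (fun s => icept x v z + slope x v z * s) t).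
    - apply Derive_ext_loc. generalize (locally_interval _ _ t Ht). apply filter_imp.
      intros s Hs. apply VN_affine; auto; lra.
    - apply is_derive_unique. eapply is_derive_val. deriv. simpl; ring. }
  split. auto. change (Derive_n v 2 y) with (Derive (Derive v) y).
  transitivity (Derive (fun _ => slope x v z) y).
  - apply Derive_ext_loc. generalize (locally_interval _ _ y Hy). apply filter_imp. auto.
  - apply Derive_const.
Qed.

Lemma VN_node v z : in_VN N x v -> is_cell N z ->
  icept x v z + slope x v z * x (z - 1)%Z = v (x (z - 1)%Z) /\ icept x v z + slope x v z * x z = v (x z).
Proof.
  intros Hv Hz. destruct (Hcell z Hz). split; symmetry; apply VN_affine; auto; lra.
Qed.

Lemma B_SD_cells (eps : R) (a' c' a c : R -> R) (delta : Z -> R) (v w : R -> R) :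
  (forall y, continuous a y) -> (forall y, continuous c y) ->
  (forall y, -1 < y < 1 -> a' y = a y /\ c' y = c y) -> in_VN N x v -> in_VN N x w ->
  B_SD eps a' c' N x delta v w = sum_cells N (fun z =>
    cell_form eps (delta z) a c (x (z - 1)%Z) (x z) (icept x v z) (slope x v z) (icept x w z) (slope x w z)).
Proof.
  intros Ca Cc Eac Hv Hw.
  assert (E : forall z y, is_cell N z -> x (z - 1)%Z < y < x z -> a' y = a y /\ c' y = c y).
  { intros z y Hz Hy. destruct (Hcell z Hz). apply Eac. lra. }
  unfold B_SD, B_eps, B_Stab, inner.
  rewrite (RInt_cells _ (fun z _ => eps * slope x v z * slope x w z)).
  2:{ intros; cont. }
  2:{ intros z y Hz Hy. destruct (VN_derive v z y Hv Hz Hy) as [-> _].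
      destruct (VN_derive w z y Hw Hz Hy) as [-> _]. reflexivity. }
  rewrite (RInt_cells _ (fun z y => a y * slope x v z * (icept x w z + slope x w z * y))).
  2:{ intros; cont. }
  2:{ intros z y Hz Hy. destruct (VN_derive v z y Hv Hz Hy) as [-> _].
      rewrite (VN_affine w z y Hw Hz) by lra. destruct (E z y Hz Hy) as [-> _]. reflexivity. }
  rewrite (RInt_cells _ (fun z y => c y * (icept x v z + slope x v z * y) * (icept x w z + slope x w z * y))).
  2:{ intros; cont. }
  2:{ intros z y Hz Hy. rewrite (VN_affine w z y Hw Hz), (VN_affine v z y Hv Hz) by lra.
      destruct (E z y Hz Hy) as [_ ->]. reflexivity. }
  rewrite <- !sum_cells_plus. apply sum_cells_ext. intros z Hz. unfold cell_form.
  rewrite !RInt_add by (intros; cont). f_equal. f_equal. apply RInt_ext.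
  destruct (Hcell z Hz). rewrite Rmin_left, Rmax_right by lra. intros y Hy.
  destruct (VN_derive v z y Hv Hz Hy) as [-> ->]. destruct (VN_derive w z y Hw Hz Hy) as [-> _].
  rewrite (VN_affine v z y Hv Hz) by lra. destruct (E z y Hz Hy) as [-> ->]. real_eq. ring.
Qed.

Lemma load_cells (a' f' a f : R -> R) (delta : Z -> R) (w : R -> R) :
  (forall y, continuous a y) -> (forall y, continuous f y) ->
  (forall y, -1 < y < 1 -> a' y = a y /\ f' y = f y) -> in_VN N x w ->
  inner f' w + f_Stab a' f' N x delta w = sum_cells N (fun z =>
    cell_load (delta z) a f (x (z - 1)%Z) (x z) (icept x w z) (slope x w z)).
Proof.
  intros Ca Cf Eaf Hw.
  assert (E : forall z y, is_cell N z -> x (z - 1)%Z < y < x z -> a' y = a y /\ f' y = f y).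
  { intros z y Hz Hy. destruct (Hcell z Hz). apply Eaf. lra. }
  unfold inner, f_Stab.
  rewrite (RInt_cells _ (fun z y => f y * (icept x w z + slope x w z * y))).
  2:{ intros; cont. }
  2:{ intros z y Hz Hy. rewrite (VN_affine w z y Hw Hz) by lra. destruct (E z y Hz Hy) as [_ ->]. reflexivity. }
  rewrite <- sum_cells_plus. apply sum_cells_ext. intros z Hz. unfold cell_load. f_equal. f_equal.
  apply RInt_ext. destruct (Hcell z Hz). rewrite Rmin_left, Rmax_right by lra. intros y Hy.
  destruct (VN_derive w z y Hw Hz Hy) as [-> _]. destruct (E z y Hz Hy) as [-> ->]. reflexivity.
Qed.

Lemma RInt_square_nonneg (l r : R) (g : R -> R) :
  l <= r -> (forall y, continuous g y) -> 0 <= RInt (fun y => g y ^ 2) l r.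
Proof.
  intros Hlr Cg. rewrite <- (Rmult_0_l (r - l)), <- (RInt_cst 0 l r).
  apply RInt_mono; auto; intros; try cont. apply pow2_ge_0.
Qed.

Lemma norm_L2_cells (v : R -> R) (g : Z -> R -> R) :
  (forall z, is_cell N z -> forall y, continuous (g z) y) ->
  (forall z y, is_cell N z -> x (z - 1)%Z < y < x z -> v y = g z y) ->
  norm_L2 v ^ 2 = sum_cells N (fun z => RInt (fun y => g z y ^ 2) (x (z - 1)%Z) (x z)).
Proof.
  intros Cg E. unfold norm_L2, norm_on.
  rewrite (RInt_cells (fun y => v y ^ 2) (fun z y => g z y ^ 2)).
  - simpl (_ ^ 2) at 1. rewrite Rmult_1_r. apply sqrt_sqrt. apply sum_cells_nonneg.
    intros z Hz. destruct (Hcell z Hz). apply RInt_square_nonneg. lra. now apply Cg.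
  - intros z Hz y. apply cont_pow. now apply Cg.
  - intros z y Hz Hy. now rewrite (E z y).
Qed.

Lemma norm_SD_cells (eps : R) (a' a : R -> R) (delta : Z -> R) (v : R -> R) :
  (forall y, continuous a y) -> (forall y, -1 < y < 1 -> a' y = a y) -> in_VN N x v ->
  (forall z, is_cell N z -> 0 <= delta z) ->
  norm_SD eps a' N x delta v = sqrt (sum_cells N (fun z =>
    eps * slope x v z ^ 2 * (x z - x (z - 1)%Z)
    + RInt (fun y => (icept x v z + slope x v z * y) ^ 2) (x (z - 1)%Z) (x z)
    + delta z * RInt (fun y => (a y * slope x v z) ^ 2) (x (z - 1)%Z) (x z))).
Proof.
  intros Ca Ea Hv Hd. unfold norm_SD.
  rewrite (norm_L2_cells (Derive v) (fun z _ => slope x v z)).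
  2:{ intros; cont. } 2:{ intros z y Hz Hy. now apply VN_derive. }
  rewrite (norm_L2_cells v (fun z y => icept x v z + slope x v z * y)).
  2:{ intros; cont. } 2:{ intros z y Hz Hy. apply VN_affine; auto; lra. }
  f_equal. rewrite <- sum_cells_scal, <- !sum_cells_plus. apply sum_cells_ext. intros z Hz.
  destruct (Hcell z Hz) as [H1 [H2 H3]]. rewrite RInt_cst. f_equal. f_equal. ring.
  unfold norm_on.
  replace (RInt (fun y => (sqrt (delta z) * a' y * Derive v y) ^ 2) (x (z - 1)%Z) (x z))
    with (delta z * RInt (fun y => (a y * slope x v z) ^ 2) (x (z - 1)%Z) (x z)).
  - simpl (sqrt _ ^ 2). rewrite Rmult_1_r. apply sqrt_sqrt. apply Rmult_le_pos. auto.
    apply (RInt_square_nonneg _ _ (fun y => a y * slope x v z)). lra. intros; cont.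
  - rewrite <- RInt_mul by (intros; cont). apply RInt_ext. rewrite Rmin_left, Rmax_right by lra.
    intros y Hy. destruct (VN_derive v z y Hv Hz Hy) as [-> _]. rewrite Ea by lra.
    real_eq. replace ((sqrt (delta z) * a y * slope x v z) ^ 2) with
     (sqrt (delta z) * sqrt (delta z) * (a y * slope x v z) ^ 2) by ring.
    now rewrite sqrt_sqrt by auto.
Qed.
End Cells.

(** [real] sends an infinite supremum to 0; the bound K excludes this default. *)
Lemma norm_sup_bound (c' c : R -> R) (K : R) :
  (forall y, -1 < y < 1 -> c' y = c y) -> (forall y, cI y -> Rabs (c y) <= K) ->
  forall y, -1 < y < 1 -> Rabs (c y) <= norm_sup c'.
Proof.
  intros E HK y Hy. unfold norm_sup.
  set (S := fun r => exists y, -1 < y < 1 /\ r = Rabs (c' y)).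
  destruct (Lub_Rbar_correct S) as [Hub Hlub].
  assert (Hy' : S (Rabs (c y))) by (exists y; rewrite E; auto).
  specialize (Hub _ Hy').
  assert (Hle : Rbar_le (Lub_Rbar S) K).
  { apply Hlub. intros r [t [Ht ->]]. simpl. rewrite E by auto. apply HK. unfold cI; lra. }
  destruct (Lub_Rbar S); simpl in *; try contradiction; auto.
Qed.

Lemma square_le_sqrt_mul (w B C : R) : 0 <= B -> 0 <= w -> w ^ 2 <= B ^ 2 * C -> w <= B * sqrt C.
Proof.
  intros HB Hw H. rewrite <- (sqrt_pow2 w) by auto. rewrite <- (sqrt_pow2 B) at 1 by auto.
  rewrite <- sqrt_mult_alt by apply pow2_ge_0. apply sqrt_le_1_alt. auto.
Qed.

(** The test function is w = u_I - u_N. Summed over the cells, form minus load for u_N ([G])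
    vanishes by the discrete equation, and the nodal terms [F] vanish by the boundary values of w.
    The weighted nodal differences [T] are bounded by a multiple of H^(3/2) times the norm of w
    itself, which Young's inequality absorbs. *)
Lemma sd_energy a a1 a2 c c1 c2 f f1 f2 b gamma (K M : R) :
  regular_data a a1 a2 c c1 c2 f f1 f2 b gamma -> 1 <= K -> 1 <= M ->
  (forall y, cI y -> Rabs (a y) <= K * Rabs y /\ Rabs (a1 y) <= K /\ Rabs (c y) <= K) ->
  exists C, 0 < C /\ forall eps om (Kn N n : nat) (x delta : Z -> R) (a' c' f' U U1 U2 U3 U4 uN uI : R -> R),
    let H := INR (Kn + 1) / INR N in
    0 < eps -> 0 < om -> (0 < n)%nat -> N = ((Kn + 1) * n)%nat ->
    (forall i, x i = if Z.leb 0 i then half_mesh Kn N (Z.to_nat i) else - half_mesh Kn N (Z.to_nat (- i))) ->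
    (forall y, -1 < y < 1 -> a' y = a y /\ c' y = c y /\ f' y = f y) ->
    regular_solution eps a a1 a2 c c1 c2 f f1 f2 U U1 U2 U3 U4 ->
    solution_bounds eps om M U U1 U2 U3 ->
    (/ 10 ^ Kn) ^ 2 <= om \/ / 10 ^ Kn <= H ^ 3 ->
    admissible_delta eps gamma c' Kn N x delta ->
    sd_solution eps a' c' f' N x delta uN ->
    is_interpolant N x U uI ->
    norm_L2 (fun y => U y - uN y) ^ 2 <= C * H ^ 3 /\
    norm_SD eps a' N x delta (fun y => uI y - uN y) ^ 2 <= C * H ^ 3.
Proof.
  intros D HK HM Hco.
  set (C0 := 2 * (44 * K * (100000 * M)) ^ 2 / gamma + 170 * (K * (100000 * M)) ^ 2).
  assert (Hg := rd_gamma D).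
  assert (Hgi : 0 < / gamma) by now apply Rinv_0_lt_compat.
  assert (HC0 : 0 <= C0).
  { unfold C0. apply Rplus_le_le_0_compat.
    - apply Rmult_le_pos; [|lra]. pose proof (pow2_ge_0 (44 * K * (100000 * M))); lra.
    - pose proof (pow2_ge_0 (K * (100000 * M))); lra. }
  (* 64 = 96 times 8/12: the constant in [Q], the factor of [weighted_telescope], and the 1/12 of
     the trapezoidal correction. *)
  set (C1 := 4 * C0 + 2 * (64 * K * M) ^ 2 / gamma).
  assert (HC1 : 4 * C0 <= C1).
  { unfold C1. assert (0 <= 2 * (64 * K * M) ^ 2 / gamma); [|lra].
    apply Rmult_le_pos; [|lra]. pose proof (pow2_ge_0 (64 * K * M)); lra. }
  (* 6 = 2 + 4 undoes the weights 1/2 and 1/4 of [E2] and [S2]; [Y2] is bounded through 2/gamma,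
     doubled by the triangle inequality in the L2 estimate; the summand 1 ensures positivity. *)
  exists ((6 + 4 / gamma) * C1 + 1).
  assert (H2g : 0 < 2 / gamma /\ 0 < 4 / gamma) by (unfold Rdiv; lra).
  assert (HC2 : 0 <= 4 / gamma * C1) by (apply Rmult_le_pos; lra).
  split. lra.
  intros eps om Kn N n x delta a' c' f' U U1 U2 U3 U4 uN uI H He Hom Hn HN Hx E Hsol Hbd Hreg Hdel HuN HuI.
  pose proof (mesh_ratio_range Kn N n Hn HN) as HH. fold H in HH.
  assert (HH3 : 0 < H ^ 3) by (apply pow_lt; lra).
  destruct (error_distribution (/ 10 ^ Kn) H om) as [Dd [Dd1 [Dd2 Dd3]]]; auto; try lra.
  { apply Rinv_0_lt_compat, pow_lt; lra. }
  assert (Geo := cell_geometry Kn N n x Hn HN Hx).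
  assert (Hcell : forall z, is_cell N z -> x (z - 1)%Z < x z /\ -1 <= x (z - 1)%Z /\ x z <= 1).
  { intros z Hz. destruct (Geo z Hz) as [G1 [G2 [G3 _]]]. auto. }
  assert (Hleft := mesh_left Kn N n x Hn HN Hx). assert (Hright := mesh_right Kn N n x Hn HN Hx).
  destruct HuN as [VuN Gal]. destruct HuI as [VuI Hnode].
  set (w := fun y => uI y - uN y). assert (Vw : in_VN N x w) by now apply in_VN_sub.
  pose proof (rd_a D) as Da. pose proof (rd_a1 D) as Da1.
  pose proof (rd_c D) as Dc. pose proof (rd_f D) as Df.
  assert (Ca : forall y, continuous a y) by (intros; cont).
  assert (Ca1 : forall y, continuous a1 y) by (intros; cont).
  assert (Cc : forall y, continuous c y) by (intros; cont).
  assert (Cf : forall y, continuous f y) by (intros; cont).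
  destruct Hsol as [DU DU1 DU2 DU3 UL UR EqU _ _].
  assert (CU : forall y, continuous U y) by (intros; cont).
  assert (CU3 : forall y, continuous U3 y) by (intros; cont).
  assert (Hdelta : forall z, is_cell N z -> 0 <= delta z <= H /\
     eps * delta z <= (x z - x (z - 1)%Z) ^ 2 /\ (forall y, -1 < y < 1 -> delta z * c y ^ 2 <= gamma / 2)).
  { intros z Hz. destruct (Hdel z Hz) as [D1 D2]. fold H in D2.
    pose proof (Rle_trans _ _ _ D2 (Rmin_r _ _)) as D3. pose proof (Rle_trans _ _ _ D2 (Rmin_l _ _)) as D4.
    pose proof (Rle_trans _ _ _ D3 (Rmin_r _ _)) as D5. pose proof (Rle_trans _ _ _ D3 (Rmin_l _ _)) as D6.
    split; [auto|]. split.
    - apply Rmult_le_compat_l with (r := eps) in D6; [|lra].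
      replace (eps * ((x z - x (z - 1)%Z) ^ 2 / eps)) with ((x z - x (z - 1)%Z) ^ 2) in D6 by (field; lra). auto.
    - intros y Hy.
      assert (Hsup := norm_sup_bound c' c K (fun y Hy => proj1 (proj2 (E y Hy))) (fun y Hy => proj2 (proj2 (Hco y Hy)))).
      (* c(0) > 0 makes the supremum positive, so that gamma / (2 nc^2) is a genuine quotient. *)
      pose proof (Hsup 0 ltac:(lra)) as S0. pose proof (rd_c0 D) as Hc0.
      rewrite Rabs_pos_eq in S0 by lra. specialize (Hsup y Hy).
      set (nc := norm_sup c') in *.
      assert (c y ^ 2 <= nc ^ 2) by (rewrite <- pow2_abs; apply pow_incr; split; auto; apply Rabs_pos).
      apply Rle_trans with (gamma / (2 * nc ^ 2) * nc ^ 2).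
      + apply Rmult_le_compat; auto. apply pow2_ge_0.
      + right. field. lra. }
  set (p := icept x w). set (q := slope x w).
  set (n2 := fun z => RInt (fun y => (p z + q z * y) ^ 2) (x (z - 1)%Z) (x z)).
  set (e2 := fun z => eps * q z ^ 2 * (x z - x (z - 1)%Z)).
  set (s2 := fun z => delta z * RInt (fun y => (a y * q z) ^ 2) (x (z - 1)%Z) (x z)).
  set (Phi := fun y => a y * U2 y * w y).
  (* Nodal values from both integrations by parts: eps u' w from the consistency identity and a w^2
     / 2 from coercivity. *)
  set (F := fun z => eps * (U1 (x z) * w (x z)) - / 2 * (a (x z) * w (x z) ^ 2)).
  set (G := fun z => cell_form eps (delta z) a c (x (z - 1)%Z) (x z) (icept x uN z) (slope x uN z) (p z) (q z)
      - cell_load (delta z) a f (x (z - 1)%Z) (x z) (p z) (q z)).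
  set (T := fun z => (x z - x (z - 1)%Z) ^ 2 * (Phi (x z) - Phi (x (z - 1)%Z))).
  assert (Node : forall z, is_cell N z -> p z + q z * x (z - 1)%Z = w (x (z - 1)%Z) /\ p z + q z * x z = w (x z)).
  { intros z Hz. apply (VN_node N x Hcell w z Vw Hz). }
  assert (NodeI : forall z, is_cell N z -> icept x uI z + slope x uI z * x (z - 1)%Z = U (x (z - 1)%Z) /\
     icept x uI z + slope x uI z * x z = U (x z)).
  { intros z Hz. destruct (VN_node N x Hcell uI z VuI Hz) as [-> ->]. unfold is_cell in Hz. split; apply Hnode; lia. }
  assert (Hpq : forall z, is_cell N z -> p z = icept x uI z - icept x uN z /\ q z = slope x uI z - slope x uN z).
  { intros z Hz. destruct (Hcell z Hz). unfold p, q, icept, slope, w. split; field; lra. }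
  assert (Est : forall z, is_cell N z ->
     / 2 * e2 z + 5 / 8 * gamma * n2 z + / 4 * s2 z <=
       C0 * (Dd (x z) - Dd (x (z - 1)%Z)) + - (/ 12) * T z + - 1 * G z + (F z - F (z - 1)%Z)
     /\ RInt (fun y => (icept x uI z + slope x uI z * y - U y) ^ 2) (x (z - 1)%Z) (x z)
        <= C0 * (Dd (x z) - Dd (x (z - 1)%Z))).
  { intros z Hz. destruct (Geo z Hz) as [G1 [G2 [G3 [rho [R1 [R2 [R3 R4]]]]]]]. fold H in R4.
    destruct (Hdelta z Hz) as [D1 [D2 D3]]. destruct (NodeI z Hz) as [I1 I2]. destruct (Node z Hz) as [W1 W2].
    destruct (Hpq z Hz) as [P1 P2].
    destruct (cell_estimate a a1 c U U1 U2 U3 Dd eps om (delta z) K M gamma (x (z - 1)%Z) (x z)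
      (icept x uI z) (slope x uI z) (p z) (q z) rho H (/ 10 ^ Kn)) as [B1 B2]; auto; try lra.
    { apply Dd1. lra. }
    fold C0 in B1, B2. split; [|exact B2].
    pose proof (cell_coercive a a1 c eps (delta z) (x (z - 1)%Z) (x z) (p z) (q z) G1 Da Ca1 Cc (proj1 D1) gamma) as Co.
    spec Co. { intros y Hy. apply (rd_coercive D). unfold cI; lra. }
    spec Co. { intros y Hy. apply D3. lra. }
    pose proof (cell_form_error a a1 c U U1 U2 U3 eps (delta z) (x (z - 1)%Z) (x z) (icept x uI z) (slope x uI z)
      (p z) (q z) G1 Da Cc DU DU1 DU2 I1 I2 f Cf) as Er.
    spec Er. { intros y Hy. apply EqU. unfold cI; lra. }
    cbv beta zeta in Co, Er.
    assert (Sub : cell_form eps (delta z) a c (x (z - 1)%Z) (x z) (p z) (q z) (p z) (q z)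
      = cell_form eps (delta z) a c (x (z - 1)%Z) (x z) (icept x uI z) (slope x uI z) (p z) (q z)
        - cell_form eps (delta z) a c (x (z - 1)%Z) (x z) (icept x uN z) (slope x uN z) (p z) (q z)).
    { rewrite P1 at 1. rewrite P2 at 1. now apply cell_form_sub. }
    rewrite Sub in Co. rewrite W1, W2 in Co, Er, B1.
    apply Rabs_le_between in B1. destruct B1 as [_ B1].
    fold (n2 z) in Co, B1. unfold T, Phi, G, F, e2, s2. 
    lra. }
  assert (SG : sum_cells N G = 0).
  { assert (EG := Gal w Vw).
    rewrite (B_SD_cells N x Hcell Hleft Hright eps a' c' a c delta uN w Ca Cc) in EG; auto.
    2:{ intros y Hy. destruct (E y Hy) as [E1 [E2 _]]. auto. }
    rewrite (load_cells N x Hcell Hleft Hright a' f' a f delta w Ca Cf) in EG; auto.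
    2:{ intros y Hy. destruct (E y Hy) as [E1 [_ E2]]. auto. }
    fold p q in EG. unfold G.
    rewrite (sum_cells_ext N _ (fun z => cell_form eps (delta z) a c (x (z - 1)%Z) (x z) (icept x uN z) (slope x uN z) (p z) (q z)
      + -1 * cell_load (delta z) a f (x (z - 1)%Z) (x z) (p z) (q z))) by (intros; ring).
    rewrite sum_cells_plus, sum_cells_scal. lra. }
  assert (SF : sum_cells N (fun z => F z - F (z - 1)%Z) = 0).
  { rewrite sum_cells_telescope. unfold F. rewrite Hleft, Hright.
    destruct Vw as [_ [W1 [W2 _]]]. rewrite W1, W2. ring. }
  assert (SD : sum_cells N (fun z => Dd (x z) - Dd (x (z - 1)%Z)) <= 4 * H ^ 3).
  { rewrite (sum_cells_telescope N (fun z => Dd (x z))). rewrite Hleft, Hright. auto. }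
  assert (Hn2 : forall z, is_cell N z -> 0 <= n2 z).
  { intros z Hz. destruct (Hcell z Hz). apply (RInt_square_nonneg _ _ (fun y => p z + q z * y)). lra. intros; cont. }
  assert (He2 : forall z, is_cell N z -> 0 <= e2 z).
  { intros z Hz. destruct (Hcell z Hz). unfold e2. apply Rmult_le_pos; [|lra]. apply Rmult_le_pos. lra. apply pow2_ge_0. }
  assert (Hs2 : forall z, is_cell N z -> 0 <= s2 z).
  { intros z Hz. destruct (Hcell z Hz). unfold s2. apply Rmult_le_pos. now apply Hdelta.
    apply (RInt_square_nonneg _ _ (fun y => a y * q z)). lra. intros; cont. }
  set (Y2 := sum_cells N n2). set (E2 := sum_cells N e2). set (S2 := sum_cells N s2).
  assert (HY2 : 0 <= Y2) by now apply sum_cells_nonneg.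
  assert (HE2 : 0 <= E2) by now apply sum_cells_nonneg.
  assert (HS2 : 0 <= S2) by now apply sum_cells_nonneg.
  assert (Hsq : sqrt Y2 ^ 2 = Y2) by (simpl; rewrite Rmult_1_r; now apply sqrt_sqrt).
  assert (Hsh : sqrt (H ^ 3) ^ 2 = H ^ 3) by (apply pow2_sqrt; lra).
  (* 96 is 3 times 32: |w| <= 3 X at a node, and 32^2 >= 10^3 with h <= 10 H |t|. *)
  set (Q := 96 * K * M * sqrt (H ^ 3) * sqrt Y2).
  assert (HQ : 0 <= Q).
  { unfold Q. pose proof (sqrt_pos (H ^ 3)). pose proof (sqrt_pos Y2). repeat apply Rmult_le_pos; lra. }
  assert (ST : Rabs (sum_cells N T) <= 8 * Q).
  { apply (weighted_telescope Kn N n x Hn HN Hx Phi Q HQ).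
    { unfold Phi. rewrite (rd_ab D) by (unfold cI; lra). ring. }
    intros z t Hz Ht Hh. fold H in Hh. destruct (Hcell z Hz) as [G1 [G2 G3]]. destruct (Node z Hz) as [W1 W2].
    set (h := x z - x (z - 1)%Z) in *. assert (Hh0 : 0 < h) by (unfold h; lra).
    destruct (affine_size (x (z - 1)%Z) (x z) (p z) (q z) G1) as [X [HX [EX [_ HchiX]]]]. fold h in EX.
    change (h * X ^ 2 = n2 z) in EX.
    assert (Htc : x (z - 1)%Z <= t <= x z) by (destruct Ht; subst; lra).
    assert (HtI : cI t) by (unfold cI; lra).
    assert (Ht0 : 0 < Rabs t) by (pose proof (Rabs_pos t); nra).
    assert (Hw : Rabs (w t) <= 3 * X).
    { replace (w t) with (p z + q z * t). apply HchiX; auto. destruct Ht; subst; auto. }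
    destruct (Hco t HtI) as [Hat _]. destruct (Hbd t HtI) as [_ [_ [Hu2 _]]].
    assert (HnY : n2 z <= Y2) by now apply (sum_cells_term N n2).
    (* h^2 X = h^(3/2) (h X^2)^(1/2), where h X^2 is the squared local norm [n2 z], at most [Y2]. *)
    assert (HhX : h ^ 2 * X <= 32 * (Rabs t * sqrt (Rabs t)) * sqrt (H ^ 3) * sqrt Y2).
    { rewrite Rmult_assoc. rewrite <- sqrt_mult by lra. apply square_le_sqrt_mul.
      - pose proof (sqrt_pos (Rabs t)). repeat apply Rmult_le_pos; lra.
      - apply Rmult_le_pos; auto. apply pow2_ge_0.
      - replace ((h ^ 2 * X) ^ 2) with (h ^ 3 * (h * X ^ 2)) by ring. rewrite EX.
        assert (Est2 : sqrt (Rabs t) ^ 2 = Rabs t) by (simpl; rewrite Rmult_1_r; apply sqrt_sqrt; lra).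
        replace ((32 * (Rabs t * sqrt (Rabs t))) ^ 2) with (1024 * Rabs t ^ 2 * sqrt (Rabs t) ^ 2) by ring.
        rewrite Est2.
        replace (1024 * Rabs t ^ 2 * Rabs t * (H ^ 3 * Y2)) with (1024 * (Rabs t ^ 3 * H ^ 3) * Y2) by ring.
        assert (h ^ 3 <= (10 * H * Rabs t) ^ 3) by (apply pow_incr; lra).
        replace ((10 * H * Rabs t) ^ 3) with (1000 * (Rabs t ^ 3 * H ^ 3)) in H0 by ring.
        assert (0 <= Rabs t ^ 3 * H ^ 3) by (apply Rmult_le_pos; apply pow_le; lra).
        apply Rmult_le_compat; auto. apply pow_le; lra. lra. }
    assert (HPh : Rabs t * Rabs (Phi t) <= 3 * (K * M) * X).
    { unfold Phi. rewrite !Rabs_mult.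
      apply Rle_trans with (Rabs t * (K * Rabs t * Rabs (U2 t) * (3 * X))).
      - apply Rmult_le_compat_l. lra. pose proof (Rabs_pos (U2 t)).
        apply Rmult_le_compat; auto; try apply Rabs_pos. apply Rmult_le_pos; auto; apply Rabs_pos.
        apply Rmult_le_compat_r; auto.
      - replace (Rabs t * (K * Rabs t * Rabs (U2 t) * (3 * X))) with (3 * K * X * (Rabs t ^ 2 * Rabs (U2 t))) by ring.
        replace (3 * (K * M) * X) with (3 * K * X * M) by ring. apply Rmult_le_compat_l; auto.
        repeat apply Rmult_le_pos; lra. }
    apply Rmult_le_reg_l with (Rabs t); auto.
    apply Rle_trans with (h ^ 2 * (3 * (K * M) * X)).
    - replace (Rabs t * (h ^ 2 * Rabs (Phi t))) with (h ^ 2 * (Rabs t * Rabs (Phi t))) by ring.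
      apply Rmult_le_compat_l; auto. apply pow2_ge_0.
    - replace (h ^ 2 * (3 * (K * M) * X)) with (3 * (K * M) * (h ^ 2 * X)) by ring.
      apply Rle_trans with (3 * (K * M) * (32 * (Rabs t * sqrt (Rabs t)) * sqrt (H ^ 3) * sqrt Y2)).
      + apply Rmult_le_compat_l; auto. repeat apply Rmult_le_pos; lra.
      + right. unfold Q. ring. }
  assert (Total : / 2 * E2 + / 2 * gamma * Y2 + / 4 * S2 <= C1 * H ^ 3).
  { assert (Sum : / 2 * E2 + 5 / 8 * gamma * Y2 + / 4 * S2 <=
       C0 * sum_cells N (fun z => Dd (x z) - Dd (x (z - 1)%Z)) + - (/ 12) * sum_cells N T + -1 * sum_cells N G
        + sum_cells N (fun z => F z - F (z - 1)%Z)).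
    { unfold E2, Y2, S2. rewrite <- !sum_cells_scal, <- !sum_cells_plus. apply sum_cells_le. intros z Hz. now apply Est. }
    rewrite SG, SF in Sum.
    assert (C0 * sum_cells N (fun z => Dd (x z) - Dd (x (z - 1)%Z)) <= C0 * (4 * H ^ 3)) by (apply Rmult_le_compat_l; auto).
    apply Rabs_le_between in ST.
    (* Of the 3/4 gamma from coercivity the cell errors took gamma/8; this step takes another
       gamma/8 and leaves gamma/2. *)
    pose proof (young (64 * K * M * sqrt (H ^ 3)) (sqrt Y2) gamma Hg) as Yg. rewrite Hsq in Yg.
    replace (2 * (64 * K * M * sqrt (H ^ 3)) ^ 2 / gamma) with (2 * (64 * K * M) ^ 2 / gamma * sqrt (H ^ 3) ^ 2) in Yg by (field; lra).
    rewrite Hsh in Yg. unfold Q in ST. unfold C1. lra. }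
  assert (HYb : Y2 <= 2 / gamma * C1 * H ^ 3).
  { apply Rmult_le_reg_l with (gamma / 2). lra.
    replace (gamma / 2 * (2 / gamma * C1 * H ^ 3)) with (C1 * H ^ 3) by (field; lra). lra. }
  assert (Z1 : 0 <= C1 * H ^ 3) by (apply Rmult_le_pos; lra).
  assert (Z2 : 0 <= 2 / gamma * C1 * H ^ 3) by (apply Rmult_le_pos; lra).
  assert (Z4 : 0 <= gamma * Y2) by (apply Rmult_le_pos; lra).
  assert (Z3 : 4 * C0 * H ^ 3 <= C1 * H ^ 3) by (apply Rmult_le_compat_r; lra).
  replace (4 / gamma) with (2 * (2 / gamma)) by (field; lra).
  split.
  - rewrite (norm_L2_cells N x Hcell Hleft Hright _
      (fun z y => (p z + q z * y) - (icept x uI z + slope x uI z * y - U y))).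
    + apply Rle_trans with (2 * Y2 + 2 * (C0 * (4 * H ^ 3))); [|lra].
      apply Rle_trans with (2 * Y2 + 2 * (C0 * sum_cells N (fun z => Dd (x z) - Dd (x (z - 1)%Z)))).
      2:{ apply Rplus_le_compat_l, Rmult_le_compat_l. lra. apply Rmult_le_compat_l; auto. }
      unfold Y2. rewrite <- !sum_cells_scal, <- sum_cells_plus. apply sum_cells_le. intros z Hz.
      destruct (Est z Hz) as [_ Hint]. destruct (Hcell z Hz) as [G1 _].
      apply Rle_trans with (2 * n2 z + 2 * RInt (fun y => (icept x uI z + slope x uI z * y - U y) ^ 2) (x (z - 1)%Z) (x z)); [|lra].
      unfold n2. rewrite <- !RInt_mul by (intros; cont). rewrite <- RInt_add by (intros; cont).
      apply RInt_mono. lra. intros; cont. intros; cont. intros y _.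
      set (A := p z + q z * y). set (B := icept x uI z + slope x uI z * y - U y).
      pose proof (pow2_ge_0 (A + B)). lra.
    + intros; cont.
    + intros z y Hz Hy. rewrite (VN_affine N x Hcell uN z y VuN Hz) by lra.
      destruct (Hpq z Hz) as [-> ->]. ring.
  - rewrite (norm_SD_cells N x Hcell Hleft Hright eps a' a delta w Ca); auto.
    2:{ intros y Hy. now apply E. } 2:{ intros z Hz. now apply Hdelta. }
    fold p q.
    rewrite (sum_cells_plus N (fun z => _ + _)), sum_cells_plus.
    change ((sqrt (E2 + Y2 + S2)) ^ 2 <= ((6 + 2 * (2 / gamma)) * C1 + 1) * H ^ 3).
    simpl (sqrt _ ^ 2). rewrite Rmult_1_r, sqrt_sqrt by lra. lra.
Qed.

(* "Sufficiently smooth" data: class C^m for some fixed order m.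
   C1, C2 are the two occurrences of the generic constant C. *)
Theorem theorem4p4 :
  exists m : nat,
  forall (a da c f : R -> R) (gamma lambda : R),
    admissible_data m a da c f gamma ->
    admissible_lambda da c lambda ->
    exists (C1 C2 : R) (N0 : nat), 0 < C1 /\ 0 < C2 /\
    forall (eps : R) (N : nat) (delta : Z -> R) (u uN uI : R -> R),
      0 < eps <= 1 ->
      (0 < N)%nat -> (N0 <= N)%nat ->
      let K := calK eps lambda N in
      let x := mesh eps lambda N in
      Nat.divide (K + 1) N ->
      admissible_delta eps gamma c K N x delta ->
      bvp_solution eps a c f u ->
      sd_solution eps a c f N x delta uN ->
      is_interpolant N x u uI ->
      norm_L2 (fun y => u y - uN y)
        + norm_SD eps a N x delta (fun y => uI y - uN y)
        <= C1 * Rpower (INR (K + 1) / INR N) (3 / 2)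
      /\ C1 * Rpower (INR (K + 1) / INR N) (3 / 2)
        <= C2 * Rpower (/ INR N * ln (INR N)) (3 / 2).
Proof.
  (* The bound for u''' rests on the equation differentiated twice, hence on two derivatives of the
     data. *)
  exists 2%nat. intros a' da c' f' gamma lambda Had [Hl Hlb].
  destruct (admissible_data_regular a' da c' f' gamma Had)
    as [a [a1 [a2 [c [c1 [c2 [f [f1 [f2 [b [D [Eda E]]]]]]]]]]]].
  pose proof (rd_a1_0 D) as Ea1.
  assert (Hb0 : 0 < b 0) by (apply (rd_b_pos D); unfold cI; lra).
  assert (Ec0 : c' 0 = c 0) by (apply E; lra).
  rewrite Eda, Ea1, Rabs_Ropp, Rabs_pos_eq, Ec0 in Hlb by lra.
  assert (Hlc : lambda * b 0 <= c 0 /\ (lambda = 1 -> b 0 < c 0)).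
  { assert (Ecb : c 0 / b 0 * b 0 = c 0) by (field; lra).
    destruct Hlb as [Hlb|[Hlb Hint]].
    - assert (lambda * b 0 < c 0) by (rewrite <- Ecb; apply Rmult_lt_compat_r; auto).
      split. lra. intros ->. lra.
    (* In the equality case lambda = 1 would make c(0)/|a'(0)| an integer. *)
    - split. rewrite <- Ecb, <- Hlb; lra. intros ->. exfalso. apply (Hint 1%Z). now rewrite <- Hlb. }
  destruct (a_priori_bounds D lambda Hl (proj1 Hlc) (proj2 Hlc)) as [M [HM Hap]].
  destruct (coefficient_bounds D) as [K0 [HK0 Hco]].
  destruct (sd_energy _ _ _ _ _ _ _ _ _ _ _ K0 M D HK0 HM Hco) as [C [HC Hen]].
  set (C1 := 2 * sqrt C + 1). assert (HsC : 0 < sqrt C) by now apply sqrt_lt_R0.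
  (* N >= 3 >= e gives ln N >= 1, so K + 1 <= 2 + 3 ln N <= 5 ln N. The two norms contribute sqrt C
     each to C1. *)
  exists C1, (C1 * Rpower 5 (3 / 2)), 3%nat.
  pose proof (Rpower_pos 5 (3 / 2)) as H5.
  split; [unfold C1; lra|]. split; [apply Rmult_lt_0_compat; [unfold C1; lra|auto]|].
  intros eps N delta u uN uI He HN0 HN3 K x [n Hn] Hdel Hu HuN HuI.
  assert (Hn0 : (0 < n)%nat) by lia.
  assert (HNn : N = ((K + 1) * n)%nat) by lia.
  assert (E' : forall y, -1 < y < 1 -> a' y = a y /\ c' y = c y /\ f' y = f y) by auto.
  destruct (bvp_solution_regular _ _ _ _ _ _ _ _ _ _ _ _ _ _ eps u D E' (proj1 He) Hu)
    as [U [U1 [U2 [U3 [U4 [HU EU]]]]]].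
  destruct (calK_bounds eps lambda N He Hl HN0) as [HS HKN]. fold K in HS, HKN.
  set (H := INR (K + 1) / INR N) in *.
  pose proof (mesh_ratio_range K N n Hn0 HNn) as HH. fold H in HH.
  assert (HNpos : 0 < INR N) by (apply lt_0_INR; lia).
  assert (HHN : / INR N <= H).
  { unfold H, Rdiv. rewrite <- (Rmult_1_l (/ INR N)) at 1. apply Rmult_le_compat_r.
    left; now apply Rinv_0_lt_compat. apply (le_INR 1); lia. }
  assert (HuI' : is_interpolant N x U uI).
  { destruct HuI as [V1 V2]. split; auto. intros i Hi. rewrite V2 by auto. apply EU.
    assert (Hx : forall i, x i = if Z.leb 0 i then half_mesh K N (Z.to_nat i) else - half_mesh K N (Z.to_nat (- i)))
      by (intros; reflexivity).
    assert (Geo := cell_geometry K N n x Hn0 HNn Hx).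
    destruct (Z.eq_dec i (- Z.of_nat N)) as [->|Hi'].
    - rewrite (mesh_left K N n x Hn0 HNn Hx). unfold cI; lra.
    - destruct (Geo i ltac:(unfold is_cell; lia)) as [G1 [G2 [G3 _]]]. unfold cI; lra. }
  destruct (Hen eps (Rpower eps (1 - lambda / 2)) K N n x delta a' c' f' U U1 U2 U3 U4 uN uI)
    as [N1 N3]; auto; try lra.
  { apply Rpower_pos. }
  { intros y Hy. now apply (Hap eps U U1 U2 U3 U4 He HU). }
  (* N^-3 <= H^3 because H = (K + 1)/N >= 1/N. *)
  { destruct HS as [HS|HS]; [left; auto|right]. eapply Rle_trans. exact HS. fold H.
    rewrite <- pow_inv. apply pow_incr. split; auto. left; now apply Rinv_0_lt_compat. }
  fold H in N1, N3.
  assert (ER : Rpower H (3 / 2) ^ 2 = H ^ 3).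
  { simpl. rewrite Rmult_1_r, <- Rpower_plus. replace (3 / 2 + 3 / 2) with (INR 3) by (simpl; field).
    rewrite Rpower_pow by lra. simpl; ring. }
  pose proof (Rpower_pos H (3 / 2)) as HR.
  assert (Root : forall w, w ^ 2 <= C * H ^ 3 -> w <= sqrt C * Rpower H (3 / 2)).
  { intros w Hw. destruct (Rle_dec 0 w) as [|Hw0].
    2:{ apply Rle_trans with 0. lra. apply Rmult_le_pos; lra. }
    rewrite Rmult_comm. apply square_le_sqrt_mul; auto; try lra. rewrite ER. lra. }
  split.
  - replace (norm_L2 (fun y => u y - uN y)) with (norm_L2 (fun y => U y - uN y)).
    + pose proof (Root _ N1). pose proof (Root _ N3). unfold C1. lra.
    + unfold norm_L2, norm_on. f_equal. apply RInt_ext. rewrite Rmin_left, Rmax_right by lra.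
      intros y Hy. rewrite EU; auto. unfold cI; lra.
  - rewrite Rmult_assoc. apply Rmult_le_compat_l. unfold C1; lra.
    assert (Hln : 1 <= ln (INR N)).
    { rewrite <- (ln_exp 1). assert (exp 1 <= INR N).
      { apply Rle_trans with 3. apply exp_le_3. apply (le_INR 3) in HN3. simpl in HN3. lra. }
      destruct H0 as [H0|H0]. left; apply ln_increasing; auto. apply exp_pos. rewrite H0; lra. }
    assert (HNi : 0 < / INR N) by now apply Rinv_0_lt_compat.
    rewrite Rpower_mult_distr; [|lra|apply Rmult_lt_0_compat; lra]. apply Rle_Rpower_l. lra. split. lra.
    unfold H, Rdiv. rewrite plus_INR. simpl (INR 1).
    apply Rle_trans with ((5 * ln (INR N)) * / INR N). apply Rmult_le_compat_r; lra. right; ring.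
Qed.
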